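(* Let $\mathcal U$ be a fine ultrafilter on $\mathfrak L$ and let $\mathbb E$ be the associated field of Euclidean numbers. Then Axioms 1, 2, 3 and 4 below are consistent: there exist (a) a net of finite sets $\Gamma_\lambda\subset\mathbb R$ with Λ-limit $\Gamma$ satisfying $\mathbb R\subset\Gamma$ and $\omega=\lim_{\lambda\uparrow\Lambda}\omega_\lambda=\max\Gamma=-\min\Gamma$ (where $\omega_\lambda=\max\Gamma_\lambda=-\min\Gamma_\lambda$), and (b) a net of finite-dimensional subspaces $V_\lambda(\mathbb R)\subset V(\mathbb R)$ with $V(\mathbb R)\cap\lambda\subseteq V_\lambda(\mathbb R)$, with $uv\in V_\lambda(\mathbb R)$ whenever $u,v\in C^{0,1}(\mathbb R)\cap\lambda$, and such that restriction to $\Gamma_\lambda$ is a bijection $V_\lambda(\mathbb R)\to\mathbb R^{\Gamma_\lambda}$, such that the following hold. Axiom 1 (Approximation). $V(\Gamma)$ is the set of functions $u:\Gamma\to\mathbb E$ for which there is a net $u_\lambda\in V_\lambda(\mathbb R)$ with $u(x)=\lim_{\lambda\uparrow\Lambda}u_\lambda(x_\lambda)$ for every $x=\lim_{\lambda\uparrow\Lambda}x_\lambda\in\Gamma$. Axiom 2. For every $a\in\Gamma$ the characteristic function $\chi_a$ of $\{a\}$ belongs to $V(\Gamma)$. Axiom 3 (Integral). For every $a\in\Gamma$, $\int^\circ\chi_a(x)\,dx>0$. Axiom 4 (Derivative). For every $a\in\Gamma$, $\{x\in\Gamma: D\chi_a(x)\neq0\}\subset\mathfrak{mon}(a)$; and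 for every $u\in V(\Gamma)$, $Du=0$ if and only if $u=c\mathbf 1^\circ$ for some $c\in\mathbb E$, where $\mathbf 1^\circ$ is the constant function $1$ on $\Gamma$.
   Context: $\Lambda$ is a sufficiently large set containing $\mathbb R$, all functions $\mathbb R\to\mathbb R$ and all real functions on that set of functions; $\mathfrak L$ is the set of finite subsets of $\Lambda$. An ultrafilter $\mathcal U$ on $\mathfrak L$ is fine if $\{\mu\in\mathfrak L:\mu\supseteq\lambda\}\in\mathcal U$ for all $\lambda\in\mathfrak L$. $\mathbb E$ is the ordered field $\mathbb R^{\mathfrak L}/\mathcal U$ (with $\mathbb R\subset\mathbb E$ via constant nets), and $\lim_{\lambda\uparrow\Lambda}\varphi(\lambda)$ (the Λ-limit) is the class of the net $\varphi:\mathfrak L\to\mathbb R$. The Λ-limit of a net of sets $E_\lambda$ is $\{\lim_{\lambda\uparrow\Lambda}x_\lambda: x_\lambda\in E_\lambda\ \forall\lambda\}$. $\xi\sim\zeta$ means that $\xi-\zeta$ is infinitesimal, and $\mathfrak{mon}(a)=\{\zeta\in\mathbb E:\zeta\sim a\}$. $V(\mathbb R)$ is the space of epilogic functions: $f:\mathbb R\to\mathbb R$ of locally bounded variation (genuine functions, not classes) with $f(x)=\lim_{\varepsilon\to0^+}\frac12[f(x+\varepsilon)+f(x-\varepsilon)]$ for all $x\in\mathbb R$. $C^{0,1}(\mathbb R)$ denotes the locally Lipschitz functions. For $f\in V(\mathbb R)$, $\partial f$ is its distributional derivative (a Radon measure); for a Radon measure $\mu$ and a bounded Borel function $\varphi$,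 $\langle\mu,\varphi\rangle_\lambda=\int_{[-\omega_\lambda,\omega_\lambda]}\varphi\,d\mu$. For $u\in V(\Gamma)$, $u_\lambda\in V_\lambda(\mathbb R)$ is a net representing $u$ as in Axiom 1 (unique $\mathcal U$-eventually, i.e. for all $\lambda$ in a set of $\mathcal U$, by the bijectivity in (b)). The pointwise integral is $\int^\circ u\,dx=\lim_{\lambda\uparrow\Lambda}\int_{-\omega_\lambda}^{\omega_\lambda}u_\lambda(x)\,dx$. For $a\in\Gamma$ put $d(a)=\int^\circ\chi_a\,dx$ and $\delta_a=\chi_a/d(a)$, with representing net $\delta_{a_\lambda}\in V_\lambda(\mathbb R)$. The generalized derivative $D:V(\Gamma)\to V(\Gamma)$ is $Du(a)=\lim_{\lambda\uparrow\Lambda}\langle\partial u_\lambda,\delta_{a_\lambda}\rangle_\lambda$. *)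

(* Defs.v *)
From HB Require Import structures.
From mathcomp Require Import all_boot all_order all_algebra finmap.
From mathcomp Require Import generic_quotient.
From mathcomp Require Import all_classical all_reals all_analysis.

Set Implicit Arguments.
Unset Strict Implicit.
Unset Printing Implicit Defensive.

Import Order.TTheory GRing.Theory Num.Theory.
Import numFieldNormedType.Exports.

Local Open Scope classical_set_scope.
Local Open Scope ring_scope.
Local Open Scope quotient_scope.

(* A set containing (disjoint copies of) the reals, the functions R -> R and
   the functionals (R -> R) -> R, and possibly more. *)
Record bigset (R : realType) := BigSet {
  bigset_sort :> choiceType ;
  bigset_in : R + (R -> R) + ((R -> R) -> R) -> bigset_sort ;
  bigset_in_inj : injective bigset_in }.

Definition fun_in (R : realType) (L : bigset R) (f : R -> R) : L :=
  bigset_in L (inl (inr f)).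

Record fine_ultrafilter (L : choiceType) := FineUltrafilter {
  fine_sets :> set {fset L} -> Prop ;
  fine_ultra : UltraFilter fine_sets ;
  fine_fine : forall l : {fset L}, fine_sets [set m | (l `<=` m)%fset] }.

#[global] Existing Instance fine_ultra.

Section EuclideanNumbers.
Variables (R : realType) (L : choiceType) (U : fine_ultrafilter L).

Definition net_eq (f g : {fset L} -> R) : bool :=
  `[< U [set l | f l = g l] >].

Lemma net_eqP f g : reflect (U [set l | f l = g l]) (net_eq f g).
Proof. exact: asboolP. Qed.

Lemma net_eq_equiv : equiv_class_of net_eq.
Proof.
split=> [f|f g|g f h].
- by apply/net_eqP; apply: filterE.
- by apply/net_eqP/net_eqP; apply: filterS => l.
- move=> /net_eqP fg /net_eqP gh; apply/net_eqP.
  by apply: filterS2 fg gh => l /= -> ->.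
Qed.

Canonical net_eq_equivRel := EquivRelPack net_eq_equiv.

Definition euclid := {eq_quot net_eq}.
HB.instance Definition _ := Choice.on euclid.

Definition lam_lim (f : {fset L} -> R) : euclid := \pi_euclid f.

Lemma lam_limP f g : lam_lim f = lam_lim g <-> U [set l | f l = g l].
Proof.
by split=> [/eqquotP/net_eqP|h] //; apply/eqquotP/net_eqP.
Qed.

Lemma lam_lim_repr (x : euclid) : lam_lim (repr x) = x.
Proof. exact: reprK. Qed.

Lemma near_repr f : U [set l | repr (lam_lim f) l = f l].
Proof. by apply/lam_limP; rewrite lam_lim_repr. Qed.

Definition eucl (r : R) : euclid := lam_lim (fun=> r).

Let add (x y : euclid) : euclid := lam_lim (fun l => repr x l + repr y l).
Let opp (x : euclid) : euclid := lam_lim (fun l => - repr x l).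
Let mul (x y : euclid) : euclid := lam_lim (fun l => repr x l * repr y l).
Let inv (x : euclid) : euclid := lam_lim (fun l => (repr x l)^-1).
Let abs (x : euclid) : euclid := lam_lim (fun l => `|repr x l|).
Let le (x y : euclid) : bool := `[< U [set l | repr x l <= repr y l] >].
Let lt (x y : euclid) : bool := (y != x) && le x y.

Let addE f g : add (lam_lim f) (lam_lim g) = lam_lim (fun l => f l + g l).
Proof.
by apply/lam_limP; apply: filterS2 (near_repr f) (near_repr g) => l /= -> ->.
Qed.
Let oppE f : opp (lam_lim f) = lam_lim (fun l => - f l).
Proof. by apply/lam_limP; apply: filterS (near_repr f) => l /= ->. Qed.
Let mulE f g : mul (lam_lim f) (lam_lim g) = lam_lim (fun l => f l * g l).
Proof.
by apply/lam_limP; apply: filterS2 (near_repr f) (near_repr g) => l /= -> ->.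
Qed.
Let invE f : inv (lam_lim f) = lam_lim (fun l => (f l)^-1).
Proof. by apply/lam_limP; apply: filterS (near_repr f) => l /= ->. Qed.
Let absE f : abs (lam_lim f) = lam_lim (fun l => `|f l|).
Proof. by apply/lam_limP; apply: filterS (near_repr f) => l /= ->. Qed.
Let leE f g : le (lam_lim f) (lam_lim g) = `[< U [set l | f l <= g l] >].
Proof.
rewrite /le; apply/asboolP/asboolP => h.
  by apply: filterS3 (near_repr f) (near_repr g) h => l /= -> ->.
by apply: filterS3 (near_repr f) (near_repr g) h => l /= -> ->.
Qed.

Let lim_eq f g : f =1 g -> lam_lim f = lam_lim g.
Proof. by move=> /funext ->. Qed.

Let addA : associative add.
Proof.
move=> x y z; rewrite -(lam_lim_repr x) -(lam_lim_repr y) -(lam_lim_repr z).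
by rewrite !addE; apply: lim_eq => l; rewrite addrA.
Qed.
Let addC : commutative add.
Proof. by move=> x y; apply: lim_eq => l; rewrite addrC. Qed.
Let add0 : left_id (eucl 0) add.
Proof.
move=> x; rewrite -(lam_lim_repr x) addE.
by apply: lim_eq => l; rewrite add0r.
Qed.
Let addN : left_inverse (eucl 0) opp add.
Proof.
move=> x; rewrite -(lam_lim_repr x) oppE addE.
by apply: lim_eq => l; rewrite addNr.
Qed.

HB.instance Definition _ := GRing.isZmodule.Build euclid addA addC add0 addN.

Let mulA : associative mul.
Proof.
move=> x y z; rewrite -(lam_lim_repr x) -(lam_lim_repr y) -(lam_lim_repr z).
by rewrite !mulE; apply: lim_eq => l; rewrite mulrA.
Qed.
Let mulC : commutative mul.
Proof. by move=> x y; apply: lim_eq => l; rewrite mulrC. Qed.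
Let mul1 : left_id (eucl 1) mul.
Proof.
move=> x; rewrite -(lam_lim_repr x) mulE.
by apply: lim_eq => l; rewrite mul1r.
Qed.
Let mulD : left_distributive mul add.
Proof.
move=> x y z; rewrite -(lam_lim_repr x) -(lam_lim_repr y) -(lam_lim_repr z).
by rewrite !(mulE, addE); apply: lim_eq => l; rewrite mulrDl.
Qed.
Let one_neq0 : eucl 1 != eucl 0.
Proof.
apply/eqP => /lam_limP h; apply: (@filter_not_empty _ (fine_sets U) _).
by apply: filterS h => l /eqP; rewrite oner_eq0.
Qed.

HB.instance Definition _ :=
  GRing.Zmodule_isComNzRing.Build euclid mulA mulC mul1 mulD one_neq0.

Let mulV (x : euclid) : x != 0 -> inv x * x = 1.
Proof.
rewrite -(lam_lim_repr x); set f := repr x => /eqP fn0.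
rewrite [LHS]/GRing.mul/= invE mulE; apply/lam_limP.
have [h|h] := in_ultra_setVsetC [set l | f l = 0] (fine_ultra U).
  by case: fn0; apply/lam_limP.
by apply: filterS h => l /= /eqP fl; rewrite mulVf.
Qed.
Let inv0 : inv 0 = 0.
Proof.
by rewrite [in LHS]/GRing.zero/= invE; apply: lim_eq => l; rewrite invr0.
Qed.

HB.instance Definition _ := GRing.ComNzRing_isField.Build euclid mulV inv0.

Let le0_add (x y : euclid) : le 0 x -> le 0 y -> le 0 (x + y).
Proof.
rewrite -(lam_lim_repr x) -(lam_lim_repr y) [_ + _]addE !leE.
move=> /asboolP hx /asboolP hy; apply/asboolP.
by apply: filterS2 hx hy => l /=; exact: addr_ge0.
Qed.
Let le0_mul (x y : euclid) : le 0 x -> le 0 y -> le 0 (x * y).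
Proof.
rewrite -(lam_lim_repr x) -(lam_lim_repr y) [_ * _]mulE !leE.
move=> /asboolP hx /asboolP hy; apply/asboolP.
by apply: filterS2 hx hy => l /=; exact: mulr_ge0.
Qed.
Let le0_anti (x : euclid) : le 0 x -> le x 0 -> x = 0.
Proof.
rewrite -(lam_lim_repr x) !leE => /asboolP h1 /asboolP h2; apply/lam_limP.
by apply: filterS2 h1 h2 => l /= h1 h2; apply/eqP; rewrite eq_le h1 h2.
Qed.
Let sub_ge0 (x y : euclid) : le 0 (y - x) = le x y.
Proof.
rewrite -(lam_lim_repr x) -(lam_lim_repr y) [- _]oppE [_ + _]addE !leE.
by congr asbool; congr (fine_sets U _); apply/seteqP; split=> l /=;
  rewrite subr_ge0.
Qed.
Let le0_total (x : euclid) : le 0 x || le x 0.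
Proof.
rewrite -(lam_lim_repr x) !leE; set f := repr x.
have [h|h] := in_ultra_setVsetC [set l | 0 <= f l] (fine_ultra U).
  by apply/orP; left; apply/asboolP.
apply/orP; right; apply/asboolP; apply: filterS h => l /= /negP.
by rewrite -ltNge => /ltW.
Qed.
Let normN (x : euclid) : abs (- x) = abs x.
Proof.
rewrite -(lam_lim_repr x) [- _]oppE !absE.
by apply: lim_eq => l; rewrite normrN.
Qed.
Let ge0_norm (x : euclid) : le 0 x -> abs x = x.
Proof.
rewrite -(lam_lim_repr x) leE absE => /asboolP h; apply/lam_limP.
by apply: filterS h => l /=; exact: ger0_norm.
Qed.
Let lt_def (x y : euclid) : lt x y = (y != x) && le x y.
Proof. by []. Qed.

HB.instance Definition _ := Num.IntegralDomain_isLeReal.Build euclid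
  le0_add le0_mul le0_anti sub_ge0 le0_total normN ge0_norm lt_def.

(* The field structure of [euclid] is the pointwise one. *)
Lemma lam_limD f g : lam_lim f + lam_lim g = lam_lim (f \+ g).
Proof. exact: addE. Qed.
Lemma lam_limN f : - lam_lim f = lam_lim (\- f).
Proof. exact: oppE. Qed.
Lemma lam_limM f g : lam_lim f * lam_lim g = lam_lim (f \* g).
Proof. exact: mulE. Qed.
Lemma lam_limV f : (lam_lim f)^-1 = lam_lim (fun l => (f l)^-1).
Proof. exact: invE. Qed.
Lemma lam_lim_norm f : `|lam_lim f| = lam_lim (fun l => `|f l|).
Proof. exact: absE. Qed.
Lemma lam_lim_le f g : lam_lim f <= lam_lim g <-> U [set l | f l <= g l].
Proof. by rewrite [_ <= _]leE; split=> [/asboolP|/asboolP]. Qed.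

Definition infinitesimal (x : euclid) : Prop :=
  forall r : R, 0 < r -> `|x| < eucl r.

Definition monad (a : euclid) : set euclid :=
  [set z | infinitesimal (z - a)].

Definition lam_lim_set (E : {fset L} -> set R) : set euclid :=
  [set lam_lim x | x in [set x | forall l, E l (x l)]].

End EuclideanNumbers.

Arguments lam_lim {R L} U f.
Arguments eucl {R L} U r.
Arguments lam_lim_set {R L} U E.

Definition is_max d (T : porderType d) (A : set T) (m : T) : Prop :=
  A m /\ ubound A m.
Definition is_min d (T : porderType d) (A : set T) (m : T) : Prop :=
  A m /\ lbound A m.

Section RealFunctions.
Variable R : realType.
Implicit Types (f phi : R -> R).

Definition locally_BV f : Prop :=
  forall a b : R, a <= b -> bounded_variation a b f.

Definition epilogic : set (R -> R) :=
  [set f | locally_BV f /\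
    forall x : R, (f (x + e) + f (x - e)) / 2 @[e --> 0^'+] --> f x].

Definition locally_lipschitz : set (R -> R) :=
  [set f | forall x : R, exists2 A, nbhs x A & [lipschitz f y | y in A]].

Definition findim_subspace (V : set (R -> R)) : Prop :=
  submod_closed [in V] /\
  exists (n : nat) (b : 'I_n -> R -> R),
    forall f, V f -> exists c : 'I_n -> R, f = \sum_(i < n) c i *: b i.

Definition locally_finite
    (m : {measure set (measurableTypeR R) -> \bar R}) : Prop :=
  forall K : set R, compact K -> (m K < +oo)%E.

(* A real Radon measure on the line, given as a difference of two locally
   finite (hence regular) positive Borel measures. *)
Record radon := Radon {
  radon_pos : {measure set (measurableTypeR R) -> \bar R} ;
  radon_neg : {measure set (measurableTypeR R) -> \bar R} ;
  radon_pos_lf : locally_finite radon_pos ;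
  radon_neg_lf : locally_finite radon_neg }.

HB.instance Definition _ := gen_eqMixin radon.
HB.instance Definition _ := gen_choiceMixin radon.

(* Meaningful when phi is integrable on A for both parts, e.g. phi bounded Borel
   and A bounded: [fine] sends an infinite integral to 0. *)
Definition radon_int (m : radon) (A : set R) phi : R :=
  \int[radon_pos m]_(x in A) phi x - \int[radon_neg m]_(x in A) phi x.

Definition test_function phi : Prop :=
  (forall (n : nat) (x : R), derivable (derive1n n phi) x 1) /\
  compact (closure [set x | phi x != 0]).

Definition distr_derivative f (m : radon) : Prop :=
  forall phi, test_function phi ->
    radon_int m setT phi = - \int[lebesgue_measure]_x (f x * derive1 phi x).

Lemma locally_finite0 : locally_finite mzero.
Proof. by move=> K _; rewrite /mzero ltry. Qed.

(* Two representations (pos, neg) of the distributional derivative have the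
   same difference, so [radon_int (partial f)] does not depend on the choice. *)
Definition partial f : radon :=
  xget (Radon locally_finite0 locally_finite0)
    [set m | distr_derivative f m].

End RealFunctions.

Section GridFunctions.
Variables (R : realType) (L : choiceType) (U : fine_ultrafilter L).
Variables (Gn : {fset L} -> {fset R}) (w : {fset L} -> R).
Variable Vn : {fset L} -> set (R -> R).

Definition grid : set (euclid R U) := lam_lim_set U (fun l => [set` Gn l]).

Implicit Types (u : grid -> euclid R U) (v : {fset L} -> R -> R) (a x : grid).

Definition represents v u : Prop :=
  (forall l, Vn l (v l)) /\
  forall (x : grid) (xn : {fset L} -> R), (forall l, xn l \in Gn l) ->
    val x = lam_lim U xn -> u x = lam_lim U (fun l => v l (xn l)).

Definition V_grid : set (grid -> euclid R U) :=
  [set u | exists v, represents v u].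

(* When restriction to the grid is a bijection from [Vn l] for every [l], the
   representing net is unique up to equality on a set of the ultrafilter. *)
Definition net_of u : {fset L} -> R -> R :=
  xget (fun _ _ => 0) [set v | represents v u].

Definition pw_integral u : euclid R U :=
  lam_lim U (fun l =>
    \int[lebesgue_measure]_(x in `[- w l, w l]) net_of u l x).

Definition chi a : grid -> euclid R U := fun x => (x == a)%:R.

Definition vol a : euclid R U := pw_integral (chi a).

Definition delta a : grid -> euclid R U := fun x => chi a x / vol a.

Definition pairing (l : {fset L}) (m : radon R) (phi : R -> R) : R :=
  radon_int m `[- w l, w l] phi.

Definition gderiv u : grid -> euclid R U := fun a =>
  lam_lim U (fun l => pairing l (partial (net_of u l)) (net_of (delta a) l)).

Definition one_grid : grid -> euclid R U := fun=> 1.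

End GridFunctions.

Arguments grid {R L} U Gn.
Arguments represents {R L U Gn} Vn v u.
Arguments V_grid {R L U Gn} Vn.
Arguments net_of {R L U Gn} Vn u.
Arguments pw_integral {R L U Gn} w Vn u.
Arguments chi {R L U Gn} a.
Arguments vol {R L U Gn} w Vn a.
Arguments delta {R L U Gn} w Vn a.
Arguments gderiv {R L U Gn} w Vn u.
Arguments one_grid {R L} U Gn.

(* Main.v *)
From HB Require Import structures.
Require Import Defs.
From mathcomp Require Import all_boot all_order all_algebra finmap.
From mathcomp Require Import all_classical all_reals all_analysis.
From mathcomp Require Import measurable_realfun ring lra zify.

(** For each finite [l] the construction is finite: given finitely many epilogic
    functions, finitely many reals and [eps > 0], there are a grid [G] with
    extreme points [-w] and [w] and a nodal family [sg a] of epilogic functions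
    reproducing the given ones, with positive integrals on [[-w, w]], such that
    the matrix of [B u v = <partial u, v>] on [[-w, w]] is [eps]-local, has zero
    column sums and has only the constants in its left kernel ([nodal_system]).
    As [D u a] is the limit of the numbers [B (u_l) (sg a) / int (sg a)], taking
    [eps] below all positive reals of [l] gives the axioms.

    The computations with [B] rest on [B u (hside p) = u w - u p] and
    [B (hside p) v = v p], for the epilogic Heaviside function [hside p].  Cut
    [[-w, w]] into short pieces and use on each piece its indicator, the given
    functions cut off so as to vanish at the right end, with interpolation nodes
    [t], and the indicators of the intervals [[t, q t]], where [q t] is close to
    the right end and decreases with [t].  These indicators are isotropic, and
    pair with the cut functions almost like the identity, so the left kernel of
    [B] consists of constants.  Extra nodes, bearing step functions, carry a
    positive quadrature that makes all the integrals positive.  The step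
    functions are perturbed by pairs [z, z'] with integral zero that are
    [B]-orthogonal to everything else and satisfy [B z z' = 1 = - B z' z]: for a
    suitable multiple of the [z] the Schur complement is invertible and the
    kernel is unchanged. *)

Set Implicit Arguments.
Unset Strict Implicit.
Unset Printing Implicit Defensive.

Import Order.TTheory GRing.Theory Num.Theory.
Import numFieldNormedType.Exports.

Local Open Scope classical_set_scope.
Local Open Scope ring_scope.

(** * Functions of locally bounded variation and epilogic functions *)

(** Two demands shape the construction. Axiom 4 wants a one-dimensional left kernel, but with
    midpoint values [B u v + B v u] is only a boundary term, so the matrix of [B] is nearly
    antisymmetric, and the pairings among the given functions are arbitrary numbers. This is why the
    cut functions receive dual partners: their own block may then be anything. Axiom 3 asks for more
    than nondegeneracy. A function [u] of the span has as its integral the sum of the values [u a]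
    times the integrals of the nodal functions, so the axiom requires an exact quadrature with
    positive weights, and interpolation nodes need not carry one. Each extra node brings one
    function whose integral can be prescribed, namely as its weight. The pairings of these functions
    are again arbitrary, hence the final perturbation. It must leave grid values, integrals and all
    other pairings unchanged, which is what the conditions on [z] and [z'] express. *)

Section BoundedVariation.
Variable R : realType.
Implicit Types f g h : R -> R.

Lemma locally_BV_nondecreasing f :
  {homo f : x y / x <= y} -> locally_BV f.
Proof.
by move=> fnd a b _; apply: nondecreasing_bounded_variation => x y _ _ /fnd.
Qed.

Lemma locally_BVD f g : locally_BV f -> locally_BV g -> locally_BV (f \+ g).
Proof.
move=> bf bg a b; rewrite le_eqVlt => /predU1P[->|ab].
  exact: bounded_variationxx.
by apply: bounded_variationD => //; [apply: bf|apply: bg]; exact: ltW.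
Qed.

Lemma locally_BVN f : locally_BV f -> locally_BV (\- f).
Proof. by move=> bf a b ab; apply/bounded_variationN/bf. Qed.

(** Jordan decomposition on the whole line. The variation is counted from 0 with a sign, so that
    [V y - V x] is the variation on [[x, y]] whenever [x <= y], although the variation on the line
    may be infinite. *)
Lemma locally_BVP f : locally_BV f <->
  exists g h, [/\ {homo g : x y / x <= y}, {homo h : x y / x <= y} &
                 f = g \- h].
Proof.
split=> [bf|[g [h [gnd hnd ->]]]]; last first.
  by apply: locally_BVD; [|apply: locally_BVN];
    exact: locally_BV_nondecreasing.
pose V x : R := if 0 <= x then fine (total_variation 0 x f)
             else - fine (total_variation x 0 f).
have fin x y : x <= y -> total_variation x y f \is a fin_num.
  by move=> xy; apply/bounded_variationP/bf.
have VB x y : x <= y -> V y - V x = fine (total_variation x y f).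
  move=> xy; rewrite /V; have [x0|x0] := leP 0 x.
    rewrite (le_trans x0 xy) (total_variationD f x0 xy) fineD ?fin//.
    by rewrite addrAC subrr add0r.
  have [y0|y0] := leP 0 y.
    rewrite opprK (total_variationD f (ltW x0) y0) fineD ?fin ?(ltW x0)//=.
    by rewrite addrC.
  rewrite opprK (total_variationD f xy (ltW y0)) fineD ?fin ?(ltW y0)//=.
  by rewrite addrCA addNr addr0.
have VG x y : x <= y -> `|f y - f x| <= V y - V x.
  move=> xy; rewrite VB// -lee_fin fineK ?fin//.
  exact: total_variation_ge.
exists V, (V \- f); split=> [x y xy|x y xy|].
- by rewrite -subr_ge0 (le_trans _ (VG x y xy)).
- have := VG _ _ xy; rewrite ler_norml => /andP[_] /=.
  by move: (V x) (V y) => vx vy; lra.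
- by apply/funext => x /=; rewrite opprB addrC subrK.
Qed.

Lemma locally_BV_bounded f (a b : R) : locally_BV f ->
  exists2 M : R, 0 < M & forall x, a <= x <= b -> `|f x| <= M.
Proof.
move=> /locally_BVP[g [h [gnd hnd ->]]].
exists (1 + (`|g a| + `|g b|) + (`|h a| + `|h b|)).
  by rewrite -addrA ltr_wpDr// !addr_ge0.
move=> x /andP[ax xb]; rewrite (le_trans (ler_normB _ _))//.
have mono (k : R -> R) : {homo k : x y / x <= y} -> `|k x| <= `|k a| + `|k b|.
  move=> knd; have := knd _ _ ax; have := knd _ _ xb.
  have := ler_norm (k b); have := ler_norm (- k a); rewrite normrN.
  have := normr_ge0 (k b); have := normr_ge0 (k a).
  by move=> *; rewrite ler_norml; apply/andP; split; lra.
have := mono g gnd; have := mono h hnd; lra.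
Qed.

Lemma locally_BVZ (c : R) f : locally_BV f -> locally_BV (fun x => c * f x).
Proof.
wlog c0 : c f / 0 <= c => [hw bf|].
  have [c0|c0] := leP 0 c; first exact: hw.
  have -> : (fun x => c * f x) = (fun x => (- c) * (\- f) x).
    by apply/funext => x; rewrite mulrNN.
  by apply: hw; [rewrite oppr_ge0 ltW|exact: locally_BVN].
move=> /locally_BVP[g [h [gnd hnd ->]]]; apply/locally_BVP.
exists (fun x => c * g x), (fun x => c * h x); split => [x y xy|x y xy|].
- by rewrite ler_wpM2l// gnd.
- by rewrite ler_wpM2l// hnd.
- by apply/funext => x /=; rewrite mulrBr.
Qed.

Lemma locally_BV_cst (c : R) : locally_BV (fun=> c).
Proof. exact: locally_BV_nondecreasing. Qed.

Lemma locally_BVM f g : locally_BV f -> locally_BV g ->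
  locally_BV (fun x => f x * g x).
Proof.
have mono (u v : R -> R) : {homo u : x y / x <= y} -> {homo v : x y / x <= y} ->
    locally_BV (fun x => u x * v x).
  move=> und vnd a b ab.
  (* On [[a, b]] the factors [u - u a] and [v - v a] are nonnegative, so their product is
     nondecreasing; what remains of [u * v] is affine in [u] and [v]. *)
  have : bounded_variation a b
    ((fun x => (u x - u a) * (v x - v a)) \+
     ((fun x => u a * v x) \+ ((fun x => v a * u x) \+ (fun=> - (u a * v a))))).
    move: ab; rewrite le_eqVlt => /predU1P[->|ab].
      exact: bounded_variationxx.
    apply: bounded_variationD => //.
      apply: nondecreasing_bounded_variation => x y.
      rewrite !in_itv/= => /andP[ax _] /andP[ay _] xy.
      by rewrite ler_pM// ?subr_ge0 ?lerD2r ?und ?vnd.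
    apply: bounded_variationD => //.
      by apply: (locally_BVZ _ (locally_BV_nondecreasing vnd)); exact: ltW.
    apply: bounded_variationD => //.
      by apply: (locally_BVZ _ (locally_BV_nondecreasing und)); exact: ltW.
    by apply: locally_BV_cst; exact: ltW.
  by congr (bounded_variation _ _ _); apply/funext => x /=; ring.
move=> /locally_BVP[g1 [h1 [gnd1 hnd1 ->]]] /locally_BVP[g2 [h2 [gnd2 hnd2 ->]]].
have -> : (fun x => (g1 \- h1) x * (g2 \- h2) x) =
  ((fun x => g1 x * g2 x) \+ (fun x => h1 x * h2 x)) \+
   ((\- (fun x => g1 x * h2 x)) \+ (\- (fun x => h1 x * g2 x))).
  by apply/funext => x /=; ring.
by apply: locally_BVD; apply: locally_BVD => //; rewrite -?/(locally_BV _);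
  do ?apply: locally_BVN; apply: mono.
Qed.

Lemma locally_BV_comp f h : locally_BV f -> {homo h : x y / x <= y} ->
  locally_BV (f \o h).
Proof.
move=> /locally_BVP[g1 [h1 [gnd1 hnd1 ->]]] hnd; apply/locally_BVP.
exists (g1 \o h), (h1 \o h); split => // x y xy /=.
  by apply/gnd1/hnd.
by apply/hnd1/hnd.
Qed.


Lemma bounded_variation_cat (a c b : R) f : a <= c -> c <= b ->
  bounded_variation a c f -> bounded_variation c b f ->
  bounded_variation a b f.
Proof.
move=> ac cb; have ab := le_trans ac cb.
move=> /(bounded_variationP _ ac) bf /(bounded_variationP _ cb) bg.
by apply/(bounded_variationP _ ab); rewrite (total_variationD f ac cb) fin_numD bf.
Qed.

Lemma locally_lipschitz_ball f (x : R) : locally_lipschitz f ->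
  exists d M : R, [/\ 0 < d, 0 < M & forall y z, x - d < y < x + d ->
    x - d < z < x + d -> `|f y - f z| <= M * `|y - z|].
Proof.
move=> /(_ x)[A /nbhs_ballP[d /= d0 dA] [M [_ AM]]].
exists d, (`|M| + 1); split=> // y z yd zd.
have Ab t : x - d < t < x + d -> A t.
  by move=> td; apply: dA; rewrite /ball/= ltr_distlC.
have /AM/(_ (y, z)) : M < `|M| + 1 by rewrite (le_lt_trans (ler_norm _))// ltrDl.
by apply; split; exact: Ab.
Qed.

Lemma locally_lipschitz_continuous f : locally_lipschitz f -> continuous f.
Proof.
move=> /locally_lipschitz_ball fl x.
have {fl} [d [M [d0 M0 fM]]] := fl x.
apply/cvgrPdist_le => e e0; apply/nbhs_ballP.
exists (Num.min d (e / M)) => /=; first by rewrite lt_min d0 divr_gt0.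
move=> y; rewrite /ball/= lt_min ltr_distlC => /andP[xy xye].
apply: le_trans (fM _ _ _ xy) _; first by rewrite ltrDl gtrBl d0.
by rewrite mulrC -ler_pdivlMr// ltW.
Qed.

(* The local bounds propagate to compact intervals by a supremum argument. *)
Lemma locally_lipschitz_BV f : locally_lipschitz f -> locally_BV f.
Proof.
move=> /locally_lipschitz_ball fl a b; rewrite le_eqVlt => /predU1P[->|ab].
  exact: bounded_variationxx.
pose S := [set c | a <= c <= b /\ bounded_variation a c f].
have Sa : S a by split; [rewrite lexx ltW|exact: bounded_variationxx].
have ubS : has_sup S.
  by split; [exists a|exists b => c [/andP[]]].
set s := sup S.
have as_ : a <= s by apply: sup_ubound => //; case: ubS.
have sb : s <= b by apply: sup_le_ub; [exists a|move=> c [/andP[]]].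
have [d [M [d0 M0 fM]]] := fl s.
have [c Sc cs] := sup_adherent d0 ubS.
have cles : c <= s by apply: sup_ubound => //; case: ubS.
pose t := Num.min b (s + d / 2).
have ct : c <= t by rewrite le_min (le_trans cles sb) ler_wpDr// divr_ge0// ltW.
have bvt : bounded_variation c t f.
  move: (ct); rewrite le_eqVlt => /predU1P[->|clt].
    exact: bounded_variationxx.
  have -> : f = (fun x => f x + M * x) \+ (\- (fun x => M * x)).
    by apply/funext => x /=; rewrite addrK.
  apply: bounded_variationD => //; last first.
    apply: locally_BVN => //; apply: locally_BV_nondecreasing => x y xy.
    by rewrite ler_pM2l.
  apply: nondecreasing_bounded_variation => x y; rewrite !in_itv/= => xt yt xy.
  have ineq z : c <= z <= t -> s - d < z < s + d.
    move=> /andP[cz zt]; rewrite (lt_le_trans cs cz)/=.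
    by rewrite (le_lt_trans zt)// gt_min ltrD2l ltr_pdivrMr// ltr_pMr// ltrDl ltr01 orbT.
  have := fM _ _ (ineq _ xt) (ineq _ yt).
  rewrite (distrC x y) (ger0_norm (_ : 0 <= y - x)) ?subr_ge0//.
  by rewrite ler_norml => /andP[_]; lra.
have St : S t.
  case: Sc => /andP[ac cb] bvc; split.
    by rewrite (le_trans ac ct) ge_min lexx.
  exact: bounded_variation_cat bvc bvt.
have ts : t <= s by apply: sup_ubound => //; case: ubS.
have tb : t = b.
  move: ts; rewrite /t minElt; case: ifP => // _ h.
  by exfalso; lra.
by case: St; rewrite tb.
Qed.

End BoundedVariation.


(** * Epilogic functions, Heaviside functions and freezing outside an interval *)

Section Epilogic.
Variable R : realType.
Implicit Types f g h : R -> R.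

Definition avg_at f (x : R) :=
  (f (x + e) + f (x - e)) / 2 @[e --> 0^'+] --> f x.

Lemma avg_atP f (x : R) : avg_at f x <->
  forall eta : R, 0 < eta -> exists2 d : R, 0 < d & forall e, 0 < e < d ->
    `|(f (x + e) + f (x - e)) / 2 - f x| < eta.
Proof.
split=> [/cvgrPdist_lt h eta /h|h].
  move=> [d /= d0 dh]; exists d => // e /andP[e0 ed].
  by rewrite distrC; apply: dh => //=; rewrite sub0r normrN gtr0_norm.
apply/cvgrPdist_lt => eta /h[d d0 dh].
near=> e; rewrite distrC; apply: dh; apply/andP; split.
  by near: e; exact: nbhs_right_gt.
by near: e; exact: nbhs_right_lt.
Unshelve. all: by end_near. Qed.

Lemma continuous_atP f (x : R) : {for x, continuous f} <->
  forall eta : R, 0 < eta -> exists2 d : R, 0 < d & forall y, `|y - x| < d ->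
    `|f y - f x| < eta.
Proof.
split=> [/cvgrPdist_lt h eta /h /nbhs_ballP[d/= d0 dh]|h].
  by exists d => // y yd; rewrite distrC; apply: dh; rewrite /ball/= distrC.
apply/cvgrPdist_lt => eta /h[d d0 dh]; apply/nbhs_ballP; exists d => //= y yd.
by rewrite distrC; apply: dh; rewrite distrC.
Qed.

Lemma avg_at_continuous f (x : R) : {for x, continuous f} -> avg_at f x.
Proof.
move=> /continuous_atP cf; apply/avg_atP => eta /cf[d d0 dh].
exists d => // e /andP[e0 ed].
have h1 : `|f (x + e) - f x| < eta by apply: dh; rewrite addrAC subrr add0r gtr0_norm.
have h2 : `|f (x - e) - f x| < eta.
  by apply: dh; rewrite addrAC subrr add0r normrN gtr0_norm.
by move: h1 h2; rewrite !ltr_norml => /andP[? ?] /andP[? ?]; apply/andP; split; lra.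
Qed.

Lemma epilogic_continuous f : locally_BV f -> continuous f -> epilogic f.
Proof. by move=> bf cf; split=> // x; apply: avg_at_continuous; exact: cf. Qed.

Lemma epilogic_cst (c : R) : epilogic (fun=> c).
Proof.
by apply: epilogic_continuous; [exact: locally_BV_cst|exact: cst_continuous].
Qed.

Lemma epilogicD f g : epilogic f -> epilogic g -> epilogic (f \+ g).
Proof.
move=> [bf cf] [bg cg]; split; first exact: locally_BVD.
move=> x; have -> : (fun e => ((f \+ g) (x + e) + (f \+ g) (x - e)) / 2) =
  (fun e => (f (x + e) + f (x - e)) / 2 + (g (x + e) + g (x - e)) / 2).
  by apply/funext => e /=; rewrite -mulrDl addrACA.
by apply: cvgD; [exact: cf|exact: cg].
Qed.

Lemma epilogicZ (c : R) f : epilogic f -> epilogic (fun x => c * f x).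
Proof.
move=> [bf cf]; split; first exact: locally_BVZ.
move=> x; have -> : (fun e => (c * f (x + e) + c * f (x - e)) / 2) =
  (fun e => c * ((f (x + e) + f (x - e)) / 2)).
  by apply/funext => e /=; rewrite mulrA mulrDr.
by apply: cvgM; [exact: cvg_cst|exact: cf].
Qed.

Lemma epilogicN f : epilogic f -> epilogic (\- f).
Proof.
move=> /(epilogicZ (-1)); congr (epilogic _); apply/funext => x.
by rewrite mulN1r.
Qed.

Lemma epilogicB f g : epilogic f -> epilogic g -> epilogic (f \- g).
Proof. by move=> ef eg; apply: epilogicD => //; exact: epilogicN. Qed.

(** Averages do not multiply across a common jump, so at each point one of the factors is asked to
    be continuous. *)
Lemma epilogicM f g : epilogic f -> epilogic g ->
  (forall x, {for x, continuous f} \/ {for x, continuous g}) ->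
  epilogic (fun x => f x * g x).
Proof.
have half u v x : epilogic u -> epilogic v -> {for x, continuous v} ->
    avg_at (fun x => u x * v x) x.
  move=> [bu au] [bv _] /continuous_atP cv; apply/avg_atP => eta eta0.
  have [M M0 uM] := locally_BV_bounded (x - 1) (x + 1) bu.
  have vx0 : 0 < 2 * (`|v x| + 1) by rewrite mulr_gt0// ltr_wpDl.
  have [d1 d10 h1] := (avg_atP u x).1 (au x) _ (divr_gt0 eta0 vx0).
  have M20 : 0 < 2 * M by rewrite mulr_gt0.
  have [d2 d20 h2] := cv _ (divr_gt0 eta0 M20).
  exists (Num.min 1 (Num.min d1 d2)); first by rewrite !lt_min ltr01 d10.
  move=> e; rewrite !lt_min => /andP[e0 /and3P[e1 ed1 ed2]].
  have k1 : `|v (x + e) - v x| < eta / (2 * M).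
    by apply: h2; rewrite addrAC subrr add0r gtr0_norm.
  have k2 : `|v (x - e) - v x| < eta / (2 * M).
    by apply: h2; rewrite addrAC subrr add0r normrN gtr0_norm.
  have m1 : `|u (x + e)| <= M by apply: uM; apply/andP; split; lra.
  have m2 : `|u (x - e)| <= M by apply: uM; apply/andP; split; lra.
  have a1 := h1 e (introT andP (conj e0 ed1)).
  (* The averaging error of [u] times [v x], plus bounded values of [u] times the oscillation of the
     continuous factor [v]. *)
  rewrite (_ : _ - _ = ((u (x + e) + u (x - e)) / 2 - u x) * v x +
    (u (x + e) * (v (x + e) - v x) + u (x - e) * (v (x - e) - v x)) / 2);
    last by field.
  have b1 : `|((u (x + e) + u (x - e)) / 2 - u x) * v x| < eta / 2.
    rewrite normrM; apply: (@le_lt_trans _ _ (eta / (2 * (`|v x| + 1)) * `|v x|)).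
      by rewrite ler_wpM2r// ltW.
    rewrite invfM mulrA -mulrA gtr_pMr ?divr_gt0//.
    by rewrite mulrC ltr_pdivrMr ?mul1r ?ltrDl// ltr_wpDl.
  have b2 : `|u (x + e) * (v (x + e) - v x)| < eta / 2.
    rewrite normrM; apply: (@le_lt_trans _ _ (M * `|v (x + e) - v x|)).
      by rewrite ler_wpM2r.
    by rewrite mulrC -ltr_pdivlMr// (lt_le_trans k1)// invfM mulrA.
  have b3 : `|u (x - e) * (v (x - e) - v x)| < eta / 2.
    rewrite normrM; apply: (@le_lt_trans _ _ (M * `|v (x - e) - v x|)).
      by rewrite ler_wpM2r.
    by rewrite mulrC -ltr_pdivlMr// (lt_le_trans k2)// invfM mulrA.
  move: b1 b2 b3; rewrite !ltr_norml => /andP[? ?] /andP[? ?] /andP[? ?].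
  by apply/andP; split; lra.
move=> ef eg fg; split; first by apply: locally_BVM; [case: ef|case: eg].
move=> x; rewrite -/(avg_at (fun x => f x * g x) x).
have [cf|cg] := fg x; last exact: half.
have -> : (fun x => f x * g x) = (fun x => g x * f x).
  by apply/funext => y; rewrite mulrC.
exact: half.
Qed.

Lemma epilogicM_lipschitz f g : locally_lipschitz f -> locally_lipschitz g ->
  epilogic (f \* g).
Proof.
move=> lf lg.
have cf := locally_lipschitz_continuous lf.
have cg := locally_lipschitz_continuous lg.
apply: epilogicM; do ?[by apply: epilogic_continuous => //; exact: locally_lipschitz_BV].
by move=> x; left; exact: cf.
Qed.

(** The value 1/2 at the jump makes the function epilogic; in a pairing it counts half of an atom at
    [p]. *)
Definition hside (p x : R) : R := if x < p then 0 else if x == p then 2^-1 else 1.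

Lemma hside_lt p x : x < p -> hside p x = 0.
Proof. by rewrite /hside => ->. Qed.

Lemma hside_gt p x : p < x -> hside p x = 1.
Proof. by rewrite /hside; case: ltgtP. Qed.

Lemma hside_eq p : hside p p = 2^-1.
Proof. by rewrite /hside ltxx eqxx. Qed.

Lemma hside_ge0 p x : 0 <= hside p x.
Proof. by rewrite /hside; case: ltgtP. Qed.

Lemma hside_le1 p x : hside p x <= 1.
Proof. by rewrite /hside; case: ltgtP => //; rewrite invf_le1// ler1n. Qed.

Lemma continuous_at_eq f g (x d : R) : 0 < d ->
  (forall y, `|y - x| < d -> f y = g y) ->
  {for x, continuous f} -> {for x, continuous g}.
Proof.
move=> d0 fg /continuous_atP cf; apply/continuous_atP => eta /cf[d' d'0 h].
exists (Num.min d d'); first by rewrite lt_min d0.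
move=> y; rewrite lt_min => /andP[yd yd'].
by rewrite -!fg ?subrr ?normr0//; exact: h.
Qed.

Lemma avg_at_eq f g (x d : R) : 0 < d ->
  (forall y, `|y - x| < d -> f y = g y) -> avg_at f x -> avg_at g x.
Proof.
move=> d0 fg /avg_atP cf; apply/avg_atP => eta /cf[d' d'0 h].
exists (Num.min d d'); first by rewrite lt_min d0.
move=> e; rewrite lt_min => /and3P[e0 ed ed'].
rewrite -!fg ?subrr ?normr0//; first by apply: h; rewrite e0.
- by rewrite addrAC subrr add0r normrN gtr0_norm.
- by rewrite addrAC subrr add0r gtr0_norm.
Qed.

Lemma hside_continuous p x : x != p -> {for x, continuous (hside p)}.
Proof.
rewrite neq_lt => /orP[xp|px].
  apply: (@continuous_at_eq (fun=> 0) _ _ (p - x)); rewrite ?subr_gt0//.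
    move=> y; rewrite ltr_norml => /andP[_ yx]; rewrite hside_lt//; lra.
  exact: cst_continuous.
apply: (@continuous_at_eq (fun=> 1) _ _ (x - p)); rewrite ?subr_gt0//.
  move=> y; rewrite ltr_norml => /andP[yx _]; rewrite hside_gt//; lra.
exact: cst_continuous.
Qed.

Lemma epilogic_hside p : epilogic (hside p).
Proof.
split.
  apply: locally_BV_nondecreasing => x y; rewrite /hside.
  by case: (ltgtP x p) => [||->]; case: (ltgtP y p) => //=; lra.
move=> x; have [->|xp] := eqVneq x p; last first.
  exact/avg_at_continuous/hside_continuous.
apply/avg_atP => eta eta0; exists 1 => // e /andP[e0 _].
rewrite hside_gt ?ltrDl// hside_lt ?gtrBl// hside_eq addr0 mul1r subrr normr0//.
Qed.

(** Composition with [clamp w] freezes a function at its end values outside [[- w, w]]. For epilogic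
    functions continuous at both ends this changes no pairing on the interval. *)
Definition clamp (w x : R) : R := Num.max (- w) (Num.min x w).

Lemma clamp_id (w x : R) : - w <= x <= w -> clamp w x = x.
Proof. by rewrite /clamp => /andP[wx xw]; rewrite (min_idPl xw) (max_idPr wx). Qed.

Lemma clamp_ge (w x : R) : 0 <= w -> w <= x -> clamp w x = w.
Proof.
move=> w0 wx; rewrite /clamp (min_idPr wx) (max_idPr _)//.
by rewrite (le_trans _ w0)// oppr_le0.
Qed.

Lemma clamp_le (w x : R) : 0 <= w -> x <= - w -> clamp w x = - w.
Proof. by move=> w0 wx; apply/max_idPl; rewrite ge_min wx. Qed.

Lemma clamp_itv (w x : R) : 0 <= w -> - w <= clamp w x <= w.
Proof.
move=> w0; rewrite le_max lexx/= ge_max ge_min lexx orbT andbT.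
by rewrite (le_trans _ w0)// oppr_le0.
Qed.

Lemma clamp_nondecreasing w : {homo clamp w : x y / x <= y}.
Proof.
move=> x y xy; rewrite /clamp ge_max le_max lexx/= le_max.
by apply/orP; right; rewrite le_min ge_min xy/= ge_min lexx orbT.
Qed.

Lemma clamp_dist (w x y : R) : `|clamp w x - clamp w y| <= `|x - y|.
Proof.
wlog xy : x y / x <= y.
  by move=> h; have [/h//|/ltW/h] := leP x y; rewrite distrC (distrC y).
rewrite distrC ger0_norm ?subr_ge0 ?clamp_nondecreasing//.
rewrite distrC ger0_norm ?subr_ge0// /clamp.
by have [?|?] := leP x w; have [?|?] := leP y w;
  have [?|?] := leP (- w) x; have [?|?] := leP (- w) y;
  have [?|?] := leP (- w) w; lra.
Qed.

Lemma clamp_continuous w f (x : R) : {for clamp w x, continuous f} ->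
  {for x, continuous (f \o clamp w)}.
Proof.
move=> /continuous_atP cf; apply/continuous_atP => eta /cf[d d0 h].
exists d => // y yd /=; apply: h; exact: le_lt_trans (clamp_dist _ _ _) yd.
Qed.

Lemma epilogic_clamp (w : R) f : 0 < w -> epilogic f ->
  {for w, continuous f} -> {for - w, continuous f} ->
  epilogic (f \o clamp w).
Proof.
move=> w0 [bf af] cw cmw; split.
  by apply: locally_BV_comp => //; exact: clamp_nondecreasing.
move=> x; have [xw|wx] := leP x (- w).
  by apply/avg_at_continuous/clamp_continuous; rewrite clamp_le// ltW.
have [wx'|xw] := leP w x.
  by apply/avg_at_continuous/clamp_continuous; rewrite clamp_ge// ltW.
apply: (@avg_at_eq f _ _ (Num.min (x + w) (w - x))); last exact: af.
  by rewrite lt_min; apply/andP; split; lra.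
move=> y; rewrite lt_min => /andP[y1 y2] /=.
move: y1 y2; rewrite !ltr_norml => /andP[? ?] /andP[? ?].
by rewrite clamp_id//; apply/andP; split; lra.
Qed.

End Epilogic.

(** * Smooth test functions *)

Section SmoothBump.
Variable R : realType.
Implicit Types (p q : {poly R}) (f g : R -> R).

(** Carrying the polynomial as a parameter gives a family closed under differentiation, so that
    continuity at 0 has to be checked only once. *)
Definition flat p (x : R) : R :=
  if 0 < x then p.[x^-1] * expR (- x^-1) else 0.

Lemma horner_bound q : exists2 C : R, 0 <= C &
  forall t, 1 <= t -> `|q.[t]| <= C * t ^+ size q.
Proof.
exists (\sum_(i < size q) `|q`_i|); first exact: sumr_ge0.
move=> t t1; rewrite horner_coef mulr_suml.
apply: (le_trans (ler_norm_sum _ _ _)); apply: ler_sum => i _.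
rewrite normrM ler_wpM2l// normrX (ger0_norm (le_trans ler01 t1)).
by rewrite ler_weXn2l// ltnW.
Qed.

Lemma flat_continuous0 q : {for 0, continuous (flat q)}.
Proof.
have [C C0 qC] := horner_bound q; set n := size q in qC.
have key z : 0 < z -> z < 1 -> `|flat q z| <= C * n.+1`!%:R * z.
  move=> z0 z1; rewrite /flat z0.
  have t1 : 1 <= z^-1 by rewrite invf_ge1 ?posrE// ltW.
  have t0 : 0 < z^-1 by rewrite invr_gt0.
  (* With [t = z^-1], the exponential dominates [t ^+ n.+1] divided by the factorial of [n.+1].
     Against the bound [C * t ^+ n] for the polynomial, one factor [t^-1 = z] is left over. *)
  have E := expR_ge1Dxn n (ltW t0).
  rewrite normrM expRN (ger0_norm (ltW (_ : 0 < (expR z^-1)^-1))); last first.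
    by rewrite invr_gt0 expR_gt0.
  rewrite ler_pdivrMr ?expR_gt0//.
  apply: le_trans (qC _ t1) _; rewrite -!mulrA ler_wpM2l//.
  have -> : z^-1 ^+ n = z^-1 ^+ n.+1 * z by rewrite exprSr -mulrA mulVf ?gt_eqF// mulr1.
  rewrite [leRHS]mulrCA [leLHS]mulrC ler_pM2l//.
  rewrite -ler_pdivrMl ?ltr0n ?fact_gt0// mulrC.
  by apply: le_trans E; rewrite lerDr.
apply/continuous_atP => eta eta0.
exists (Num.min 1 (eta / (C * n.+1`!%:R + 1))).
  rewrite lt_min ltr01 divr_gt0// ltr_wpDl// mulr_ge0//.
move=> y; rewrite subr0 lt_min => /andP[y1 y2].
have -> : flat q 0 = 0 by rewrite /flat ltxx.
rewrite subr0; have [y0|y0] := ltP 0 y; last by rewrite /flat (ltNge 0 y) y0/= normr0.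
move: y1 y2; rewrite gtr0_norm// => y1 y2.
apply: le_lt_trans (key y y0 y1) _.
have D0 : 0 < C * n.+1`!%:R + 1 by rewrite ltr_wpDl// mulr_ge0.
move: y2; rewrite ltr_pdivlMr//; apply: le_lt_trans.
by rewrite mulrC ler_wpM2l ?(ltW y0)// lerDl.
Qed.

Lemma is_derive_flat p (x : R) :
  is_derive x 1 (flat p) (flat ('X^2 * (p - p^`())) x).
Proof.
have [x0|x0|x0] := ltgtP x 0.
- rewrite {2}/flat (ltNge 0 x) (ltW x0)/=.
  apply: (@near_eq_is_derive _ _ _ (cst 0)).
    near=> y; rewrite /flat (ltNge 0 y) ltW//=; near: y; exact: lt_nbhsl.
- rewrite {2}/flat x0.
  apply: (@near_eq_is_derive R R R (fun x : R => p.[x^-1] * expR (- x^-1))).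
  + near=> y; rewrite /flat; suff -> : 0 < y by [].
    by near: y; exact: lt_nbhsr.
  + have xn0 : x != 0 by rewrite gt_eqF.
    have dV : is_derive x 1 (fun y : R => y^-1) (- x ^- 2 *: 1).
      by apply: is_deriveV.
    have d1 : is_derive x 1 (fun y : R => p.[y^-1]) (p^`().[x^-1] * (- x ^- 2 *: 1)).
      by apply: (@is_derive1_comp _ (horner p) (fun y => y^-1)).
    have d2 : is_derive x 1 (fun y : R => expR (- y^-1))
        (expR (- x^-1) * - (- x ^- 2 *: 1)).
      by apply: (@is_derive1_comp _ expR (fun y => - y^-1)).
    apply: DeriveDef; first by case: (is_deriveM d1 d2).
    case: (is_deriveM d1 d2) => _ /= ->.
    rewrite !hornerE /GRing.scale/=; set e := expR _; set s := x^-1.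
    rewrite -exprVn -/s; ring.
(* At 0 the difference quotient is [flat ('X * p)], a function of the same family, already known to
   be continuous at 0. *)
- rewrite x0; apply/is_derive1_caratheodory; exists (flat ('X * p)); split.
  + move=> z; rewrite subr0 {2}/flat ltxx subr0 /flat; case: ifPn => [z0|].
      rewrite hornerM hornerX; set e := expR _; set u := p.[_].
      by field; rewrite gt_eqF.
    by rewrite mul0r.
  + exact: flat_continuous0.
  + by rewrite /flat ltxx.
Unshelve. all: by end_near. Qed.

Lemma flat_ge0 (x : R) : 0 <= flat 1 x.
Proof. by rewrite /flat; case: ifP => // _; rewrite hornerE mul1r expR_ge0. Qed.

Lemma flat_lt1 (x : R) : flat 1 x < 1.
Proof.
by rewrite /flat; case: ifP => // x0; rewrite hornerE mul1r expR_lt1 oppr_lt0 invr_gt0.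
Qed.

Lemma flat_gt0 (x : R) : (0 < flat 1 x) = (0 < x).
Proof. by rewrite /flat; case: ifP => // x0; rewrite ?ltxx// hornerE mul1r expR_gt0. Qed.

(* An algebra of functions closed under differentiation. *)
Inductive bump_expr (a b : R) : (R -> R) -> Prop :=
| bump_cst c : bump_expr a b (fun=> c)
| bump_left p : bump_expr a b (fun x => flat p (x - a))
| bump_right p : bump_expr a b (fun x => flat p (b - x))
| bump_add f g : bump_expr a b f -> bump_expr a b g ->
    bump_expr a b (fun x => f x + g x)
| bump_mul f g : bump_expr a b f -> bump_expr a b g ->
    bump_expr a b (fun x => f x * g x).

Lemma bump_expr_derive (a b : R) f : bump_expr a b f ->
  exists2 g, bump_expr a b g & forall x : R, is_derive x 1 f (g x).
Proof.
elim=> [c|p|p|{}f g ef [f' ef' df] eg [g' eg' dg]|{}f g ef [f' ef' df] eg [g' eg' dg]].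
- by exists (fun=> 0) => [|x]; [exact: bump_cst|exact: is_derive_cst].
- exists (fun x => flat ('X^2 * (p - p^`())) (x - a)); first exact: bump_left.
  move=> x; have D : is_derive x (1 : R) (fun y : R => y - a) (1 - 0).
    by apply: is_deriveB.
  by have := @is_derive1_comp _ (flat p) (fun y => y - a) x _ _ (is_derive_flat p (x - a)) D; rewrite subr0 mulr1.
- exists (fun x => (-1) * flat ('X^2 * (p - p^`())) (b - x)).
    by apply: bump_mul; [exact: bump_cst|exact: bump_right].
  move=> x; have D : is_derive x (1 : R) (fun y : R => b - y) (0 - 1).
    by apply: is_deriveB.
  by have := @is_derive1_comp _ (flat p) (fun y => b - y) x _ _ (is_derive_flat p (b - x)) D; rewrite sub0r mulrC.
- exists (fun x => f' x + g' x) => [|x]; first exact: bump_add.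
  by have := df x; have := dg x => *; apply: is_deriveD.
- exists (fun x => f x * g' x + g x * f' x) => [|x].
    by apply: bump_add; exact: bump_mul.
  by have := df x; have := dg x => *; apply: is_deriveM.
Qed.

Lemma bump_expr_smooth (a b : R) f n (x : R) : bump_expr a b f ->
  derivable (derive1n n f) x 1.
Proof.
elim: n f => [|n IH] f ef; have [g eg dg] := bump_expr_derive ef.
  by case: (dg x).
rewrite derive1Sn; suff -> : derive1 f = g by exact: IH.
by apply/funext => y; rewrite derive1E; case: (dg y).
Qed.

(** The product of the two flat functions lies strictly between 0 and 1 on []a, b[] and vanishes
    elsewhere, so these test functions increase to the indicator of the open interval, as monotone
    convergence requires. *)
Definition bump_seq (a b : R) (n : nat) (x : R) : R :=
  1 - (1 - flat 1 (x - a) * flat 1 (b - x)) ^+ n.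

Lemma bump_seq_out (a b : R) n x : ~~ (a < x < b) -> bump_seq a b n x = 0.
Proof.
rewrite negb_and -!leNgt /bump_seq => h.
suff -> : flat 1 (x - a) * flat 1 (b - x) = 0 by rewrite subr0 expr1n subrr.
case/orP: h => h; rewrite /flat.
  by rewrite subr_gt0 (ltNge a) h/= mul0r.
by rewrite (subr_gt0 x b) (ltNge x b) h/= mulr0.
Qed.

Let phi01 (a b x : R) : 0 <= 1 - flat 1 (x - a) * flat 1 (b - x) <= 1.
Proof.
rewrite gerBl mulr_ge0 ?flat_ge0// andbT subr_ge0.
by rewrite mulr_ile1 ?flat_ge0// ltW// flat_lt1.
Qed.

Lemma bump_seq_ge0 (a b : R) n x : 0 <= bump_seq a b n x.
Proof. by rewrite subr_ge0; have /andP[? ?] := phi01 a b x; exact: exprn_ile1. Qed.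

Lemma bump_seq_le1 (a b : R) n x : bump_seq a b n x <= 1.
Proof. by rewrite gerBl exprn_ge0//; have /andP[] := phi01 a b x. Qed.

Lemma bump_seq_nd (a b : R) x : nondecreasing_seq (fun n => bump_seq a b n x).
Proof.
move=> n m nm; rewrite lerB// ler_wiXn2l//; by have /andP[] := phi01 a b x.
Qed.

Lemma bump_seq_cvg (a b : R) x :
  bump_seq a b n x @[n --> \oo] --> (\1_(`]a, b[%classic) x : R).
Proof.
have [xab|xab] := boolP (a < x < b); last first.
  rewrite indicE memNset; last by rewrite /= in_itv/=; exact/negP.
  under eq_fun do rewrite bump_seq_out//; exact: cvg_cst.
have -> : \1_(`]a, b[%classic) x = 1 :> R.
  by rewrite indicE mem_set//= in_itv.
rewrite -[X in _ --> X]subr0; apply: cvgB; first exact: cvg_cst.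
apply: cvg_expr; have /andP[p0 p1] := phi01 a b x.
rewrite ger0_norm// ltrBlDr ltrDl mulr_gt0// flat_gt0 subr_gt0; by case/andP: xab.
Qed.

Lemma bump_seq_expr (a b : R) n : bump_expr a b (bump_seq a b n).
Proof.
have e1 : bump_expr a b (fun x => (1 - flat 1 (x - a) * flat 1 (b - x))).
  apply: bump_add; first exact: bump_cst.
  have -> : (fun x => - (flat 1 (x - a) * flat 1 (b - x))) =
            (fun x => (-1) * (flat 1 (x - a) * flat 1 (b - x))).
    by apply/funext => x; rewrite mulN1r.
  apply: bump_mul; first exact: bump_cst.
  by apply: bump_mul; [exact: bump_left|exact: bump_right].
have en : bump_expr a b (fun x => (1 - flat 1 (x - a) * flat 1 (b - x)) ^+ n).
  elim: n => [|n IH].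
    by under eq_fun do rewrite expr0; exact: bump_cst.
  by under eq_fun do rewrite exprS; exact: bump_mul.
apply: bump_add; first exact: bump_cst.
have -> : (fun x => - (1 - flat 1 (x - a) * flat 1 (b - x)) ^+ n) =
          (fun x => (-1) * (1 - flat 1 (x - a) * flat 1 (b - x)) ^+ n).
  by apply/funext => x; rewrite mulN1r.
by apply: bump_mul => //; exact: bump_cst.
Qed.

Lemma bump_seq_test (a b : R) n : test_function (bump_seq a b n).
Proof.
split=> [k x|]; first by apply: (@bump_expr_smooth a b); exact: bump_seq_expr.
apply: (@subclosed_compact _ _ `[a, b]%classic).
- exact: closed_closure.
- exact: segment_compact.
- rewrite [X in _ `<=` X](_ : _ = closure `[a, b]%classic); last first.
    by apply/closure_id; exact: itv_closed.
  apply: closureS => x /= xn0; rewrite in_itv/=.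
  have : a < x < b by apply: contraNT xn0 => h; rewrite bump_seq_out.
  by move=> /andP[/ltW -> /ltW ->].
Qed.

End SmoothBump.

(** * Uniqueness of the Radon measure *)

Section RadonUniqueness.
Variable R : realType.
Notation MR := (measurableTypeR R).
Implicit Types (mu : {measure set MR -> \bar R}) (m : radon R) (u v : R -> R).

Lemma locally_finite_lty mu (A : set R) (a b : R) : locally_finite mu ->
  measurable (A : set MR) -> A `<=` `[a, b]%classic -> (mu A < +oo)%E.
Proof.
move=> lf mA Aab; have := lf _ (@segment_compact _ a b).
by apply: le_lt_trans; apply: le_measure => //; rewrite inE//; exact: measurable_itv.
Qed.

Lemma locally_finite_integrable mu (A : set R) (a b M : R) v :
  locally_finite mu -> measurable (A : set MR) -> A `<=` `[a, b]%classic ->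
  measurable_fun (A : set MR) (v : MR -> R) -> (forall x, A x -> `|v x| <= M) ->
  mu.-integrable (A : set MR) (EFin \o v).
Proof.
move=> lf mA Aab mv vM; apply: measurable_bounded_integrable => //.
  exact: locally_finite_lty Aab.
exists M; split; first by rewrite num_real.
by move=> x Mx y Ay /=; apply: le_trans (vM _ Ay) (ltW Mx).
Qed.

(** Open intervals are stable under intersection and generate the Borel sets. Both measures are
    restricted to []a, b[], so that the hypothesis on subintervals covers every generator. *)
Lemma open_interval_measure_unique (mu nu : {measure set MR -> \bar R})
    (a b : R) : locally_finite mu ->
  (forall c d : R, a <= c -> d <= b -> mu `]c, d[%classic = nu `]c, d[%classic) ->
  forall X, measurable (X : set MR) -> X `<=` `]a, b[%classic -> mu X = nu X.
Proof.
move=> lf h X mX Xab.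
have mO : measurable (`]a, b[%classic : set MR) by exact: measurable_itv.
have itvI (c d c' d' : R) : `]c, d[%classic `&` `]c', d'[%classic =
    `]Num.max c c', Num.min d d'[%classic.
  apply/seteqP; split => x /=; rewrite !in_itv/= gt_max lt_min.
    by move=> [/andP[-> ->] /andP[-> ->]].
  by move=> /andP[/andP[-> ->] /andP[-> ->]].
rewrite -(setIidl Xab) -[LHS]/(mrestr mu mO X) -[RHS]/(mrestr nu mO X).
apply: (@measure_unique _ _ MR (@RGenOpens.G R)
  (fun n => `](- n%:R), n%:R[%classic) _ _ _ _ (mrestr mu mO) (mrestr nu mO)) => //.
- exact: RGenOpens.measurableE.
- by move=> _ _ [c [d ->]] [c' [d' ->]]; exists (Num.max c c'), (Num.min d d').
- by move=> n; exists (- n%:R), n%:R.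
- apply/seteqP; split => // x _; exists (Num.bound x) => //=.
  by rewrite in_itv/= -ltr_norml unstable.ltr_norm_bound.
- move=> _ [c [d ->]]; change (mu (`]c, d[%classic `&` `]a, b[%classic) =
    nu (`]c, d[%classic `&` `]a, b[%classic)).
  by rewrite itvI h// ?le_max ?ge_min ?lexx ?orbT.
- move=> n; apply: (@locally_finite_lty _ (`](- n%:R), n%:R[%classic `&` _) a b) => //.
    by apply: measurableI => //; exact: measurable_itv.
  by move=> x [_] /=; rewrite !in_itv/= => /andP[/ltW -> /ltW ->].
Qed.

Lemma measurable_bump (a b : R) n :
  measurable_fun [set: MR] (bump_seq a b n : MR -> R).
Proof.
apply: continuous_measurable_fun => x.
have [+ _] := bump_seq_test a b n => /(_ 0%N x).
by move=> /derivable1_diffP/differentiable_continuous.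
Qed.

Lemma bump_cvg_measure mu (a b : R) :
  (\int[mu]_x (bump_seq a b n x)%:E)%E @[n --> \oo] --> mu `]a, b[%classic.
Proof.
have mO : measurable (`]a, b[%classic : set MR) by exact: measurable_itv.
rewrite (_ : mu _ = \int[mu]_x limn (fun n => (bump_seq a b n x)%:E))%E; last first.
  transitivity (\int[mu]_x (\1_(`]a, b[%classic) x)%:E)%E.
    by rewrite integral_indic// setIT.
  apply: eq_integral => x _; apply/esym/cvg_lim => //.
  by apply/fine_cvgP; split; [exact: nearW|exact: bump_seq_cvg].
apply: cvg_monotone_convergence => //.
- by move=> n; apply/measurable_EFinP; exact: measurable_bump.
- by move=> n x _; rewrite lee_fin bump_seq_ge0.
- by move=> x _ n k nk; rewrite lee_fin bump_seq_nd.
Qed.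

Lemma bump_integrable mu (a b : R) n : locally_finite mu ->
  mu.-integrable setT (fun x => (bump_seq a b n x)%:E).
Proof.
move=> lf; have mI : measurable (`[a, b]%classic : set MR) by exact: measurable_itv.
have -> : (fun x => (bump_seq a b n x)%:E) =
  ((fun x : MR => (bump_seq a b n x)%:E) \_ `[a, b])%E.
  apply/funext => x; rewrite /patch; case: ifPn => // /negP xab.
  rewrite bump_seq_out//; apply/negP => /andP[/ltW ax /ltW xb]; apply: xab.
  by rewrite inE/= in_itv/= ax.
apply/integrable_restrict => //; rewrite setTI.
apply: (@locally_finite_integrable _ _ a b 1) => //.
  by apply: measurable_funTS; exact: measurable_bump.
by move=> x _; rewrite ger0_norm ?bump_seq_ge0// bump_seq_le1.
Qed.

(** Written with sums, because differences of the positive and negative parts may be undefined.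
    Testing both derivatives on [bump_seq c d n] and letting [n] grow gives equality on the open
    subintervals. *)
Lemma radon_int_measure_eq u1 u2 m1 m2 (a b : R) :
  distr_derivative u1 m1 -> distr_derivative u2 m2 ->
  (forall x, a < x < b -> u1 x = u2 x) ->
  forall X, measurable (X : set MR) -> X `<=` `]a, b[%classic ->
  (radon_pos m1 X + radon_neg m2 X)%E = (radon_pos m2 X + radon_neg m1 X)%E.
Proof.
move=> d1 d2 u12 X mX Xab.
rewrite -!measure_addE; apply: open_interval_measure_unique Xab => //.
  move=> K cK; rewrite [X in (X < _)%E]measure_addE.
  by apply: lte_add_pinfty; [exact: (radon_pos_lf m1)|exact: (radon_neg_lf m2)].
move=> c d ac db.
have key n : (\int[measure_add (radon_pos m1) (radon_neg m2)]_x (bump_seq c d n x)%:E =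
      \int[measure_add (radon_pos m2) (radon_neg m1)]_x (bump_seq c d n x)%:E)%E.
  have bi mu : locally_finite mu ->
      mu.-integrable setT (fun x => (bump_seq c d n x)%:E).
    exact: bump_integrable.
  have mb : measurable_fun [set: MR] (fun x : MR => (bump_seq c d n x)%:E).
    by apply/measurable_EFinP; exact: measurable_bump.
  rewrite !ge0_integral_measure_add//;
    try by move=> x _; rewrite lee_fin bump_seq_ge0.
  have fin mu : locally_finite mu ->
      ((\int[mu]_x (bump_seq c d n x)%:E) \is a fin_num)%E.
    by move=> lf; apply: integrable_fin_num => //; exact: bi.
  rewrite -(fineK (fin _ (radon_pos_lf m1))) -(fineK (fin _ (radon_neg_lf m1))).
  rewrite -(fineK (fin _ (radon_pos_lf m2))) -(fineK (fin _ (radon_neg_lf m2))).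
  rewrite -!EFinD; congr (_%:E).
  have := d1 _ (bump_seq_test c d n); have := d2 _ (bump_seq_test c d n).
  rewrite /radon_int /Rintegral.
  have -> : (\int[lebesgue_measure]_x (u2 x * derive1 (bump_seq c d n) x)%:E =
         \int[lebesgue_measure]_x (u1 x * derive1 (bump_seq c d n) x)%:E)%E.
    apply: eq_integral => x _; have [xcd|xcd] := boolP (c < x < d).
      rewrite u12//; case/andP: xcd => cx xd.
      by rewrite (le_lt_trans ac cx) (lt_le_trans xd db).
    (* A point outside []c, d[], possibly an endpoint, is a minimum of the bump. *)
    suff -> : derive1 (bump_seq c d n) x = 0 by rewrite !mulr0.
    rewrite derive1E; suff D : is_derive x 1 (bump_seq c d n) 0 by exact: derive_val.
    apply: (@derive1_at_min _ _ (x - 1) (x + 1)).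
    - lra.
    - by move=> t _; have [+ _] := bump_seq_test c d n => /(_ 0%N t).
    - by rewrite in_itv/= ltrDl ltr01 andbT gtrBl ltr01.
    - by move=> t _; rewrite (bump_seq_out _ xcd) bump_seq_ge0.
  lra.
have A := @bump_cvg_measure (measure_add (radon_pos m1) (radon_neg m2)) c d.
have B := @bump_cvg_measure (measure_add (radon_pos m2) (radon_neg m1)) c d.
move: A; rewrite (funext key) => A.
exact: (cvg_unique (@ereal_hausdorff R) A B).
Qed.

(** For [u1 = u2] this says that the representation of the derivative does not matter; in general it
    is locality of the pairing. *)
Lemma radon_int_eq u1 u2 m1 m2 (a b M : R) (A : set R) v :
  distr_derivative u1 m1 -> distr_derivative u2 m2 ->
  (forall x, a < x < b -> u1 x = u2 x) ->
  measurable (A : set MR) -> measurable_fun (A : set MR) (v : MR -> R) ->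
  (forall x, A x -> `|v x| <= M) ->
  (forall x, A x -> ~~ (a < x < b) -> v x = 0) ->
  radon_int m1 A v = radon_int m2 A v.
Proof.
move=> d1 d2 u12 mA mv vM v0; set O := `]a, b[%classic.
have mAO : measurable (A `&` O : set MR).
  by apply: measurableI => //; exact: measurable_itv.
have AO_ab : A `&` O `<=` `[a, b]%classic.
  by move=> x [_] /=; rewrite !in_itv/= => /andP[/ltW -> /ltW ->].
have restr (mu : {measure set MR -> \bar R}) :
    \int[mu]_(x in A) v x = \int[mu]_(x in A `&` O) v x.
  rewrite [RHS]Rintegral_mkcondr; apply: eq_Rintegral => x /set_mem Ax.
  rewrite /patch; case: ifPn => // xO; apply: v0 => //.
  by apply: contra xO => xab; apply/mem_set; rewrite /O/= in_itv.
rewrite /radon_int !restr.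
have bi mu : locally_finite mu ->
    mu.-integrable (A `&` O : set MR) (EFin \o v).
  move=> lf; apply: (@locally_finite_integrable _ _ a b M) => //.
    by apply: measurable_funS mv => //; apply: subIset; left.
  by move=> x [Ax _]; exact: vM.
have fin mu : locally_finite mu ->
    ((\int[mu]_(x in A `&` O) (v x)%:E) \is a fin_num)%E.
  by move=> lf; apply: integrable_fin_num => //; exact: bi.
have me : measurable_fun (A `&` O : set MR) (EFin \o v).
  by apply/measurable_EFinP; apply: measurable_funS mv => //; apply: subIset; left.
have : (\int[measure_add (radon_pos m1) (radon_neg m2)]_(x in A `&` O) (v x)%:E =
      \int[measure_add (radon_pos m2) (radon_neg m1)]_(x in A `&` O) (v x)%:E)%E.
  apply: eq_measure_integral => X mX XAO. etransitivity; first exact: measure_addE.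
  etransitivity; last by apply/esym; exact: measure_addE.
  by apply: (radon_int_measure_eq d1 d2 u12) => // x /XAO[].
rewrite !integral_measure_add//; try (by apply: bi; apply: radon_pos_lf);
  try (by apply: bi; apply: radon_neg_lf).
rewrite -(fineK (fin _ (radon_pos_lf m1))) -(fineK (fin _ (radon_neg_lf m1))).
rewrite -(fineK (fin _ (radon_pos_lf m2))) -(fineK (fin _ (radon_neg_lf m2))).
rewrite -!EFinD => -[]; rewrite /Rintegral; lra.
Qed.

End RadonUniqueness.

(** * Discontinuities *)

Section OneSidedLimits.
Variable R : realType.
Variable g : R -> R.
Hypothesis gnd : {homo g : x y / x <= y}.

Definition rlim (x : R) := inf (g @` `]x, +oo[).
Definition llim (x : R) := sup (g @` `]-oo, x[).

Let lbr x : has_lbound (g @` `]x, +oo[).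
Proof.
by exists (g x) => z [y /=]; rewrite in_itv/= andbT => /ltW xy <-; exact: gnd.
Qed.

Let ubl x : has_ubound (g @` `]-oo, x[).
Proof. by exists (g x) => z [y /=]; rewrite in_itv/= => /ltW xy <-; exact: gnd. Qed.

Lemma rlim_le x y : x < y -> rlim x <= g y.
Proof.
move=> xy; apply: ge_inf; first exact: lbr.
by exists y => //=; rewrite in_itv/= xy.
Qed.

Lemma le_rlim x : g x <= rlim x.
Proof.
apply: lb_le_inf; first by exists (g (x + 1)), (x + 1) => //=; rewrite in_itv/= ltrDl ltr01.
by move=> z [y /=]; rewrite in_itv/= andbT => /ltW xy <-; exact: gnd.
Qed.

Lemma le_llim y x : y < x -> g y <= llim x.
Proof.
by move=> xy; apply: ub_le_sup; [exact: ubl|exists y => //=; rewrite in_itv/=].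
Qed.

Lemma llim_le x : llim x <= g x.
Proof.
apply: ge_sup; first by exists (g (x - 1)), (x - 1) => //=; rewrite in_itv/= gtrBl ltr01.
by move=> z [y /=]; rewrite in_itv/= => /ltW xy <-; exact: gnd.
Qed.

Lemma rlim_nd : {homo rlim : x y / x <= y}.
Proof.
move=> x y; rewrite le_eqVlt => /predU1P[->//|xy].
exact: le_trans (rlim_le xy) (le_rlim y).
Qed.

Lemma cvg_rlim x : g y @[y --> x^'+] --> rlim x.
Proof. by apply: nondecreasing_at_right_cvgr => // y z _ _; exact: gnd. Qed.

Lemma rlim_adherent x (e : R) : 0 < e -> exists2 y, x < y & g y < rlim x + e.
Proof.
move=> e0; have hi : has_inf (g @` `]x, +oo[).
  by split => //; exists (g (x + 1)), (x + 1) => //=; rewrite in_itv/= ltrDl ltr01.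
have [z [y /=]] := inf_adherent e0 hi.
by rewrite in_itv/= andbT => xy <- ?; exists y.
Qed.

Lemma llim_adherent x (e : R) : 0 < e -> exists2 y, y < x & llim x - e < g y.
Proof.
move=> e0; have hi : has_sup (g @` `]-oo, x[).
  by split => //; exists (g (x - 1)), (x - 1) => //=; rewrite in_itv/= gtrBl ltr01.
have [z [y /=]] := sup_adherent e0 hi.
by rewrite in_itv/= => xy <- ?; exists y.
Qed.

Lemma cvg_llim x : g y @[y --> x^'-] --> llim x.
Proof.
apply/cvgrPdist_lt => e e0; have [y yx gy] := llim_adherent x e0.
near=> z.
have zx : z < x by near: z; exact: nbhs_left_lt.
have yz : y < z by near: z; exact: nbhs_left_gt.
rewrite ger0_norm ?subr_ge0 ?le_llim// ltrBlDl -ltrBlDr.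
exact: lt_le_trans gy (gnd (ltW yz)).
Unshelve. all: by end_near. Qed.

Lemma rlim_near x (e : R) : 0 < e -> exists2 d, 0 < d &
  forall t, 0 < t < d -> rlim x <= g (x + t) < rlim x + e.
Proof.
move=> /(rlim_adherent x)[y xy gy]; exists (y - x); first by rewrite subr_gt0.
move=> t /andP[t0 ty]; rewrite rlim_le ?ltrDl//=.
by apply: le_lt_trans gy; apply: gnd; lra.
Qed.

Lemma llim_near x (e : R) : 0 < e -> exists2 d, 0 < d &
  forall t, 0 < t < d -> llim x - e < g (x - t) <= llim x.
Proof.
move=> /(llim_adherent x)[y xy gy]; exists (x - y); first by rewrite subr_gt0.
move=> t /andP[t0 ty]; rewrite le_llim ?gtrBl// andbT.
by apply: lt_le_trans gy _; apply: gnd; lra.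
Qed.

Lemma rlim_rc x : rlim y @[y --> x^'+] --> rlim x.
Proof.
apply/cvgrPdist_lt => e e0; have [y xy gy] := rlim_adherent x e0.
near=> z.
have xz : x < z by near: z; exact: nbhs_right_gt.
have zy : z < y by near: z; exact: nbhs_right_lt.
rewrite distrC ger0_norm ?subr_ge0 ?rlim_nd ?ltW// ltrBlDl.
exact: le_lt_trans (rlim_le zy) gy.
Unshelve. all: by end_near. Qed.

Lemma lrlim_continuous x : llim x = rlim x -> {for x, continuous g}.
Proof.
move=> lr; have lg : llim x = g x.
  by apply/eqP; rewrite eq_le llim_le lr le_rlim.
apply/left_right_continuousP; split.
  by rewrite -lg; exact: cvg_llim.
by rewrite -lg lr; exact: cvg_rlim.
Qed.

Lemma continuous_rlim x : {for x, continuous g} -> rlim x = g x.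
Proof.
move=> /left_right_continuousP[_ gr].
exact: (cvg_unique _ (cvg_rlim (x:=x)) gr).
Qed.

Lemma nondecreasing_discontinuity_countable :
  countable [set x | ~ {for x, continuous g}].
Proof.
have -> : [set x | ~ {for x, continuous g}] =
   \bigcup_n ([set x | x \in (`](- n%:R), n%:R[) /\ discontinuity g x] `&`
     [set x | ~ {for x, continuous g}]).
  apply/seteqP; split => [x xc|x [n _ []]//].
  exists (Num.bound x) => //; split => //; split.
    by rewrite in_itv/= -ltr_norml unstable.ltr_norm_bound.
  have Lr : lim (g y @[y --> x^'+]) = rlim x by apply/cvg_lim => //; exact: cvg_rlim.
  have Ll : lim (g y @[y --> x^'-]) = llim x by apply/cvg_lim => //; exact: cvg_llim.
  split.
  - by apply/cvg_ex; exists (llim x); exact: cvg_llim.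
  - by apply/cvg_ex; exists (rlim x); exact: cvg_rlim.
  - by rewrite Lr Ll; apply/eqP => /lrlim_continuous.
apply: bigcup_countable => // n _; apply: sub_countable (discontinuity_countable _).
  by apply: subset_card_le; exact: subIsetl.
by move=> x y _ _; exact: gnd.
Qed.

End OneSidedLimits.

Section BVLimits.
Variable R : realType.
Implicit Types (f g h : R -> R).

Lemma locally_BV_discontinuity_countable f : locally_BV f ->
  countable [set x | ~ {for x, continuous f}].
Proof.
move=> /locally_BVP[g [h [gnd hnd ->]]].
apply: (@sub_countable _ _ _ ([set x | ~ {for x, continuous g}] `|`
   [set x | ~ {for x, continuous h}])).
  apply: subset_card_le => x /= xc; apply: contrapT => /not_orP[/contrapT cg /contrapT ch].
  by apply: xc; apply: continuousB.
rewrite -bigcup2E; apply: bigcup_countable => //.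
by move=> [|[|n]] _ /=; [exact: nondecreasing_discontinuity_countable..|exact: countable0].
Qed.

(** An epilogic value is the mean of the one-sided limits. It is expressed through a Jordan
    decomposition because [rlim] and [llim], an infimum and a supremum, are one-sided limits for
    nondecreasing functions. *)
Lemma epilogic_lim g h x : {homo g : x y / x <= y} -> {homo h : x y / x <= y} ->
  epilogic (g \- h) ->
  g x - h x = ((rlim g x + llim g x) - (rlim h x + llim h x)) / 2.
Proof.
move=> gnd hnd [_ /(_ x) /avg_atP av].
apply/eqP; rewrite -subr_eq0 -normr_le0; apply/ler_addgt0Pr => e e0; rewrite add0r.
have e4 : 0 < e / 4 by rewrite divr_gt0.
have [d1 d10 h1] := rlim_near gnd x e4.
have [d2 d20 h2] := llim_near gnd x e4.
have [d3 d30 h3] := rlim_near hnd x e4.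
have [d4 d40 h4] := llim_near hnd x e4.
have [d5 d50 h5] := av _ e4.
pose d := Num.min d1 (Num.min d2 (Num.min d3 (Num.min d4 d5))).
have d0 : 0 < d by rewrite !lt_min d10 d20 d30 d40.
have : d / 2 < d by rewrite ltr_pdivrMr// ltr_pMr// ltrDl ltr01.
have t0 : 0 < d / 2 by rewrite divr_gt0.
move: (d / 2) t0 => t t0; rewrite !lt_min => /and5P[t1 t2 t3 t4 t5].
have /andP[? ?] := h1 t (introT andP (conj t0 t1)).
have /andP[? ?] := h2 t (introT andP (conj t0 t2)).
have /andP[? ?] := h3 t (introT andP (conj t0 t3)).
have /andP[? ?] := h4 t (introT andP (conj t0 t4)).
have := h5 t (introT andP (conj t0 t5)).
rewrite /= ltr_norml ler_norml => /andP[? ?]; apply/andP; split; lra.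
Qed.

End BVLimits.

(** * Stieltjes measures *)

Section StieltjesMeasure.
Variable R : realType.
Notation MR := (measurableTypeR R).
Variables (g : R -> R) (gnd : {homo g : x y / x <= y}).

(** The monotonicity proof is an argument so that the structure of a cumulative function can be
    attached to the right-continuous version of [g]. *)
Definition rc_of (_ : {homo g : x y / x <= y}) : R -> R := rlim g.

HB.instance Definition _ :=
  isCumulative.Build R _ R (rc_of gnd) (rlim_nd gnd) (rlim_rc gnd).

Definition ls_measure : {measure set MR -> \bar R} :=
  lebesgue_stieltjes_measure (rc_of gnd).

Lemma ls_measure_oc (a b : R) : a <= b ->
  ls_measure `]a, b]%classic = (rlim g b - rlim g a)%:E.
Proof.
move=> ab; rewrite /ls_measure /= /lebesgue_stieltjes_measure /measure_extension.
rewrite measurable_mu_extE/=; last exact: is_ocitv.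
by rewrite wlength_itv_bnd.
Qed.

Lemma ls_measure_lf : locally_finite ls_measure.
Proof.
move=> K cK; have [M [_ KM]] := compact_bounded cK.
have {}KM : K `<=` `](- (`|M| + 2)), `|M| + 2]%classic.
  move=> x Kx /=; have := KM (`|M| + 1) _ x Kx; rewrite in_itv/=.
  have M1 : M < `|M| + 1 by rewrite (le_lt_trans (ler_norm _))// ltrDl.
  move=> /(_ M1); rewrite /= ler_norml => /andP[? ?]; apply/andP; split; lra.
apply: (@le_lt_trans _ _ (ls_measure `](- (`|M| + 2)), `|M| + 2]%classic)).
  apply: le_measure => //; rewrite inE; last exact: measurable_itv.
  by apply: compact_measurable.
rewrite ls_measure_oc ?ltry//; have := normr_ge0 M; lra.
Qed.

Lemma ls_measure_set1 (a : R) :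
  ls_measure [set a] = (rlim g a - llim g a)%:E.
Proof.
have E n : ls_measure `](a - n.+1%:R^-1), a]%classic =
    (rlim g a - rlim g (a - n.+1%:R^-1))%:E.
  by rewrite ls_measure_oc// gerBl invr_ge0.
have mI n : measurable (`](a - n.+1%:R^-1), a]%classic : set MR).
  exact: measurable_itv.
have A : (ls_measure `](a - n.+1%:R^-1), a]%classic) @[n --> \oo] -->
    ls_measure (\bigcap_n `](a - n.+1%:R^-1), a]%classic).
  apply: nonincreasing_cvg_mu => //=.
  - by rewrite (E 0%N) ltry.
  - exact: (bigcapT_measurable mI).
  - move=> m n mn; apply/subsetPset => x /=; rewrite !in_itv/= => /andP[ax ->].
    rewrite andbT; apply: le_lt_trans ax; rewrite lerB// lef_pV2 ?posrE//.
    by rewrite ler_nat ltnS.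
rewrite -set1_bigcap_oc in A.
rewrite (funext E) in A.
apply: (cvg_unique (@ereal_hausdorff R) A).
apply/fine_cvgP; split; first exact: nearW.
rewrite /comp/=; apply: cvgB; first exact: cvg_cst.
apply/cvgrPdist_lt => e e0; have [d d0 h] := llim_near gnd a e0.
near=> n.
have nd : n.+1%:R^-1 < d.
  by near: n; exact: (near_infty_natSinv_lt (PosNum d0)).
have n0 : (0 : R) < n.+1%:R^-1 by rewrite invr_gt0.
have n2 : (n.+1%:R^-1 : R) / 2 < n.+1%:R^-1 by rewrite ltr_pdivrMr// ltr_pMr// ltrDl ltr01.
have h1 := h _ (introT andP (conj n0 nd)).
(* With [h3] this squeezes [rlim g] between [g] at the same point, which is close to the left limit
   by [h1], and the left limit itself. *)
have h2 : rlim g (a - n.+1%:R^-1) <= llim g a.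
  apply: (@le_trans _ _ (g (a - n.+1%:R^-1 / 2))).
    by apply: rlim_le => //; rewrite ltrD2l ltrN2.
  by apply: le_llim => //; rewrite gtrBl divr_gt0.
have h3 := le_rlim gnd (a - n.+1%:R^-1).
case/andP: h1 => ? ?; rewrite ger0_norm ?subr_ge0//; lra.
Unshelve. all: by end_near. Qed.

End StieltjesMeasure.

(** * Integration by parts against test functions *)

Section IntegrationByParts.
Variable R : realType.
Notation MR := (measurableTypeR R).

Lemma compact_sub_itv (K : set R) : compact K ->
  exists2 M : R, 0 < M & K `<=` `]- M, M[%classic.
Proof.
move=> cK; have [M [_ KM]] := compact_bounded cK.
exists (`|M| + 2); first by rewrite ltr_wpDl.
move=> x Kx /=; have := KM (`|M| + 1) _ x Kx; rewrite in_itv/=.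
have M1 : M < `|M| + 1 by rewrite (le_lt_trans (ler_norm _))// ltrDl.
move=> /(_ M1); rewrite /= ler_norml => /andP[? ?]; apply/andP; split; lra.
Qed.

Lemma lebesgue_locally_finite : locally_finite (@lebesgue_measure R).
Proof.
move=> K cK; have [M M0 KM] := compact_sub_itv cK.
apply: (@le_lt_trans _ _ (lebesgue_measure (`]- M, M[%classic : set MR))).
  apply: le_measure => //; rewrite inE; last exact: measurable_itv.
  by apply: compact_measurable.
by rewrite lebesgue_measure_itv/=; case: ifP => _; rewrite ?ltry// -EFinB ltry.
Qed.

Lemma locally_finite_integrableT (mu : {measure set MR -> \bar R}) (f : R -> R)
    (K C : R) : locally_finite mu -> measurable_fun [set: MR] (f : MR -> R) ->
  (forall x, `|f x| <= C) -> (forall x, K <= `|x| -> f x = 0) ->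
  mu.-integrable setT (fun x : MR => (f x)%:E).
Proof.
move=> lf mf fC fK.
pose I : set MR := `[- K, K]%classic.
have mI : measurable I by exact: measurable_itv.
have -> : (fun x : MR => (f x)%:E) = ((fun x : MR => (f x)%:E) \_ I).
  apply/funext => x; rewrite /patch; case: ifPn => // /negP xK.
  rewrite fK// leNgt; apply/negP => xlt; apply: xK.
  by rewrite inE/I/= in_itv/= -ler_norml ltW.
apply/integrable_restrict => //; rewrite setTI.
apply: (@locally_finite_integrable _ _ _ (- K) K C) => //.
exact: measurable_funTS.
Qed.

Section TestFunction.
Variable phi : R -> R.
Hypothesis tphi : test_function phi.

Lemma test_continuous n : continuous (derive1n n phi).
Proof.
by move=> x; have [/(_ n x) + _] := tphi => /derivable1_diffP/differentiable_continuous.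
Qed.

Lemma test_support : exists2 K : R, 0 < K & forall x, K <= `|x| ->
  phi x = 0 /\ derive1 phi x = 0.
Proof.
have [_ /compact_sub_itv[K K0 KM]] := tphi; exists K => // x Kx.
have nx : nbhs x [set y | phi y = 0].
  have : (~` closure [set x | phi x != 0]) x.
    by move=> /KM/=; rewrite in_itv/= -ltr_norml ltNge Kx.
  rewrite -[X in X -> _]/((~` closure _) x) => h.
  have : nbhs x (~` closure [set x | phi x != 0]).
    by apply: open_nbhs_nbhs; split => //; apply: closed_openC; exact: closed_closure.
  apply: filterS => y /= yc; apply/eqP/negPn/negP => py; apply: yc.
  exact: subset_closure.
split; first exact: nbhs_singleton nx.
rewrite derive1E; suff D : is_derive x (1 : R) phi 0 by exact: derive_val.
apply: (@near_eq_is_derive R R R (cst 0)).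
by apply: filterS nx => y ->.
Qed.

Lemma continuous_bounded_itv (f : R -> R) (a b : R) : continuous f ->
  exists2 C : R, 0 <= C & forall x, a <= x <= b -> `|f x| <= C.
Proof.
move=> cf; have [ab|ab] := leP a b; last by exists 0 => // x ?; exfalso; lra.
have cn : {within `[a, b], continuous (fun x => `|f x|)}.
  by apply: continuous_subspaceT => x; apply: continuous_comp; [exact: cf|exact: norm_continuous].
have [c _ h] := EVT_max ab cn.
by exists `|f c| => // x xab; apply: h; rewrite in_itv.
Qed.

Lemma test_continuous1 : continuous (derive1 phi).
Proof. exact: (@test_continuous 1). Qed.

Lemma test_continuous0 : continuous phi.
Proof. exact: (@test_continuous 0). Qed.

Lemma test_ftc (K x : R) : (forall x, K <= `|x| -> phi x = 0) ->
  - K < x -> x <= K ->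
  (\int[lebesgue_measure]_(t in (`[x, K]%classic : set MR)) (- derive1 phi t)%:E = (phi x)%:E)%E.
Proof.
move=> phiK Kx; rewrite le_eqVlt => /predU1P[->|xK].
  by rewrite set_itv1 integral_set1 phiK// ler_norm.
rewrite (@continuous_FTC2 _ (fun t => - derive1 phi t) (fun t => - phi t))//.
- by rewrite phiK ?ler_norm// oppr0 -EFinB sub0r opprK.
- by apply: continuous_subspaceT => t; apply: continuousN; exact: test_continuous1.
- have c : continuous (fun t => - phi t).
    by move=> t; apply: continuousN; exact: test_continuous0.
  split; first by move=> t _; apply: derivableN; have [/(_ 0%N)] := tphi.
  + by apply: cvg_at_right_filter; exact: c.
  + by apply: cvg_at_left_filter; exact: c.
- move=> t _; rewrite derive1E deriveN ?derive1E//.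
  by have [/(_ 0%N)] := tphi.
Qed.

(* Fubini for [- phi' t] on the triangle x <= t. *)
Lemma ls_measure_ibp (g : R -> R) (gnd : {homo g : x y / x <= y}) :
  (\int[ls_measure gnd]_x (phi x)%:E =
   \int[lebesgue_measure]_t (- (rlim g t * derive1 phi t))%:E)%E.
Proof.
have [K K0 hK] := test_support.
have phiK x : K <= `|x| -> phi x = 0 by move=> /hK[].
have dphiK x : K <= `|x| -> derive1 phi x = 0 by move=> /hK[].
have [C C0 hC] := continuous_bounded_itv (- K) K test_continuous1.
have dC x : `|derive1 phi x| <= C.
  have [xK|/ltW/dphiK ->] := leP `|x| K; last by rewrite normr0.
  by apply: hC; rewrite -ler_norml.
pose S : set (MR * MR) := [set p | [/\ - K < p.1, p.1 <= p.2 & p.2 <= K]].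
have mfst : measurable_fun [set: MR * MR] (fst : MR * MR -> R) by exact: measurable_fst.
have msnd : measurable_fun [set: MR * MR] (snd : MR * MR -> R) by exact: measurable_snd.
have mS : measurable S.
  have -> : S = ((fun p : MR * MR => - K < p.1) @^-1` [set true]) `&`
     (((fun p : MR * MR => p.1 <= p.2) @^-1` [set true]) `&`
      ((fun p : MR * MR => p.2 <= K) @^-1` [set true])).
    by apply/seteqP; split => p /=; [move=> [-> -> ->]|move=> [? [? ?]]].
  apply: measurableI; last apply: measurableI; rewrite -[X in measurable X]setTI.
  - exact: (measurable_fun_ltr (measurable_cst (- K)) mfst).
  - exact: (measurable_fun_ler mfst msnd).
  - exact: (measurable_fun_ler msnd (measurable_cst K)).
pose F (p : MR * MR) : \bar R := (\1_S p * - derive1 phi p.2)%:E.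
have mdphi : measurable_fun [set: MR] (derive1 phi : MR -> R).
  by apply: continuous_measurable_fun; exact: test_continuous1.
have mF : measurable_fun setT F.
  apply/measurable_EFinP; apply: measurable_funM; first exact: measurable_indic.
  apply: measurableT_comp => //.
  by apply: (@measurableT_comp _ _ _ _ _ _ (derive1 phi : MR -> R) _ snd).
pose m1 : {sigma_finite_measure set MR -> \bar R} :=
  lebesgue_stieltjes_measure (rc_of gnd).
pose m2 : {sigma_finite_measure set MR -> \bar R} := @lebesgue_measure R.
have m1lf : locally_finite m1 by exact: (ls_measure_lf gnd).
pose I : set MR := `[- K, K]%classic.
have mI : measurable I by exact: measurable_itv.
have finI (mu : {measure set MR -> \bar R}) : locally_finite mu -> (mu I < +oo)%E.
  by move=> lf; apply: (@locally_finite_lty _ _ _ (- K) K).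
have iF : (m1 \x m2)%E.-integrable setT F.
  have -> : F = F \_ (I `*` I).
    apply/funext => -[x t]; rewrite /patch; case: ifPn => // /negP xt.
    rewrite /F /= indicE memNset ?mul0r// => -[/= h1 h2 h3].
    apply: xt; apply/mem_set; split; rewrite /I/= in_itv/=; apply/andP; split; lra.
  apply/(integrable_mkcond _ (measurableX mI mI)).
  apply: measurable_bounded_integrable.
  - exact: measurableX.
  - change ((m1 \x m2)%E (I `*` I) < +oo)%E; rewrite product_measure1E//.
    by rewrite lte_mul_pinfty ?finI// ?ge0_fin_numE ?finI//; exact: lebesgue_locally_finite.
  - by apply: measurable_funTS; apply/measurable_EFinP; exact: mF.
  - exists C; split; first by rewrite num_real.
    move=> M CM p _ /=; rewrite normrM normrN.
    apply: le_trans (ltW CM); rewrite -[leRHS]mul1r ler_pM//.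
    by rewrite indicE; case: (_ \in _); rewrite ?normr1 ?normr0.
have := Fubini iF; rewrite /F /=.
have -> : (\int[m1]_x \int[m2]_t ((\1_S (x, t) * - derive1 phi t)%:E) =
  \int[ls_measure gnd]_x (phi x)%:E)%E.
  apply: eq_integral => x _; have [xK|xK] := boolP (- K < x <= K).
    case/andP: (xK) => Kx xlK; rewrite -(test_ftc phiK Kx xlK).
    rewrite [RHS]integral_mkcond; apply: eq_integral => t _.
    rewrite /patch indicE; case: ifPn => [/set_mem/=|/negP h].
      by rewrite in_itv/= => /andP[xt tK]; rewrite mem_set ?mul1r//; split.
    rewrite memNset ?mul0r// => -[/= h1 h2 h3]; apply: h; apply/mem_set => /=.
    by rewrite in_itv/= h2.
  rewrite (_ : phi x = 0); last first.
    rewrite phiK//; move: xK; rewrite negb_and -leNgt -ltNge => /orP[xK|/ltW Kx].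
      by rewrite -normrN (le_trans _ (ler_norm _))// lerNr.
    exact: le_trans Kx (ler_norm x).
  apply: integral0_eq => t _; rewrite indicE memNset ?mul0r// => -[/= h1 h2 h3].
  by move/negP: xK; apply; rewrite h1 (le_trans h2 h3).
move=> ->.
have G t : (\int[m1]_x (\1_S (x, t) * - derive1 phi t)%:E =
    ((rlim g t - rlim g (- K)) * - derive1 phi t)%:E)%E.
  have [tK|/negP tK] := boolP (- K <= t <= K); last first.
    rewrite (dphiK t) ?oppr0 ?mulr0; last first.
      by rewrite leNgt; apply/negP => /ltW h; apply: tK; rewrite -ler_norml.
    by apply: integral0_eq => x _; rewrite mulr0.
  case/andP: tK => Kt tK.
  have E : (fun x : MR => (\1_S (x, t) * - derive1 phi t)%:E) =
    (fun x : MR => ((\1_(`]- K, t]%classic : set MR) x)%:E * (- derive1 phi t)%:E)%E).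
    apply/funext => x; rewrite -EFinM !indicE.
    suff -> : ((x, t) \in S) = (x \in (`]- K, t]%classic : set MR)) by [].
    apply/idP/idP => /set_mem; last first.
      by rewrite /= in_itv/= => /andP[? ?]; apply/mem_set; split.
    by move=> [/= ? ? ?]; apply/mem_set; rewrite /= in_itv/=; apply/andP; split.
  have mJ : measurable (`]- K, t]%classic : set MR) by exact: measurable_itv.
  have JE : m1 (`]- K, t]%classic : set MR) = (rlim g t - rlim g (- K))%:E.
    exact: ls_measure_oc.
  rewrite E integralZr//; last first.
    apply: (@locally_finite_integrableT _ _ (K + 1) 1 m1lf) => [|y|y yK].
    - exact: measurable_indic.
    - by rewrite indicE; case: (_ \in _); rewrite ?normr1 ?normr0.
    - rewrite indicE memNset// /= in_itv/= => /andP[? ?].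
      by move: yK; rewrite leNgt ltr_norml; apply/negP/negPn/andP; split; lra.
  rewrite integral_indic// setIT; etransitivity.
    by apply: (congr1 (fun z => z * _)%E); exact: JE.
  by rewrite -EFinM.
under [LHS]eq_integral do rewrite G.
have Gbd t : `|rlim g t * derive1 phi t| <= (`|rlim g (- K)| + `|rlim g K|) * C.
  have [tK|/ltW/dphiK ->] := leP `|t| K; last first.
    by rewrite mulr0 normr0 mulr_ge0// addr_ge0.
  rewrite normrM ler_pM//; move: tK; rewrite ler_norml => /andP[Kt tK].
  have := rlim_nd gnd Kt; have := rlim_nd gnd tK.
  have := ler_norm (rlim g K); have := ler_norm (- rlim g (- K)); rewrite normrN.
  have := normr_ge0 (rlim g K); have := normr_ge0 (rlim g (- K)).
  by move=> *; rewrite ler_norml; apply/andP; split; lra.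
have mG : measurable_fun [set: MR] (fun t : MR => rlim g t * derive1 phi t : R).
  apply: measurable_funM => //; apply: nondecreasing_measurable => //.
  exact: rlim_nd.
have i1 : (@lebesgue_measure R).-integrable setT
    (fun t : MR => (- (rlim g t * derive1 phi t))%:E).
  apply: (@locally_finite_integrableT _ _ K ((`|rlim g (- K)| + `|rlim g K|) * C)).
  - exact: lebesgue_locally_finite.
  - exact: measurableT_comp.
  - by move=> t; rewrite normrN.
  - by move=> t /dphiK ->; rewrite mulr0 oppr0.
have i2 : (@lebesgue_measure R).-integrable setT (fun t : MR => (- derive1 phi t)%:E).
  apply: (@locally_finite_integrableT _ _ K C) => //.
  - exact: lebesgue_locally_finite.
  - exact: measurableT_comp.
  - by move=> t; rewrite normrN.
  - by move=> t /dphiK ->; rewrite oppr0.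
(* Since the derivative of [phi] has integral zero, the constant [rlim g (- K)] produced by Fubini
   drops out. Enlarging [K] by 1 makes [- K] an admissible left end in [test_ftc]. *)
have I0 : (\int[lebesgue_measure]_t (- derive1 phi t)%:E = 0)%E.
  have phiK1 x : K + 1 <= `|x| -> phi x = 0 by move=> h; apply: phiK; lra.
  have K1 : - (K + 1) < - K by lra.
  have K2 : - K <= K + 1 by lra.
  transitivity ((phi (- K))%:E); last by rewrite phiK// normrN ler_norm.
  rewrite -(test_ftc phiK1 K1 K2).
  rewrite [RHS]integral_mkcond; apply: eq_integral => t _.
  rewrite /patch; case: ifPn => // /negP h; rewrite dphiK ?oppr0//.
  rewrite leNgt; apply/negP; rewrite ltr_norml => /andP[? ?]; apply: h.
  by apply/mem_set; rewrite /= in_itv/=; apply/andP; split; lra.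
have -> : (\int[m2]_t ((rlim g t - rlim g (- K)) * - derive1 phi t)%:E =
    \int[m2]_t ((- (rlim g t * derive1 phi t))%:E +
                 (- rlim g (- K))%:E * (- derive1 phi t)%:E))%E.
  by apply: eq_integral => t _; rewrite -EFinM -EFinD; congr (_%:E); ring.
rewrite integralD//; last exact: integrableZl.
by rewrite integralZl// I0 mule0 adde0.
Qed.

End TestFunction.
End IntegrationByParts.

(** * Distributional derivatives as Stieltjes measures *)

Section DistributionalDerivative.
Variable R : realType.
Notation MR := (measurableTypeR R).
Implicit Types (u v f g h : R -> R) (m : radon R).

Lemma locally_BV_measurable f : locally_BV f -> measurable_fun [set: MR] (f : MR -> R).
Proof.
move=> /locally_BVP[g [h [gnd hnd ->]]].
by apply: measurable_funB; exact: nondecreasing_measurable.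
Qed.

Lemma test_integrable (mu : {measure set MR -> \bar R}) phi :
  locally_finite mu -> test_function phi -> mu.-integrable setT (fun x : MR => (phi x)%:E).
Proof.
move=> lf tphi; have [K K0 hK] := test_support tphi.
have [C C0 hC] := continuous_bounded_itv (- K) K (test_continuous0 tphi).
apply: (@locally_finite_integrableT _ _ _ K C) => //.
- by apply: continuous_measurable_fun; exact: test_continuous0.
- move=> x; have [xK|/ltW/hK[-> _]] := leP `|x| K; last by rewrite normr0.
  by apply: hC; rewrite -ler_norml.
- by move=> x /hK[].
Qed.

Lemma test_derive_integrable phi f : test_function phi -> locally_BV f ->
  (@lebesgue_measure R).-integrable setT (fun x : MR => (f x * derive1 phi x)%:E).
Proof.
move=> tphi bf; have [K K0 hK] := test_support tphi.
have [C C0 hC] := continuous_bounded_itv (- K) K (test_continuous1 tphi).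
have [M M0 hM] := locally_BV_bounded (- K) K bf.
apply: (@locally_finite_integrableT _ _ _ K (M * C)).
- exact: lebesgue_locally_finite.
- apply: measurable_funM; first exact: locally_BV_measurable.
  by apply: continuous_measurable_fun; exact: test_continuous1.
- move=> x; have [xK|/ltW/hK[_ ->]] := leP `|x| K.
    by rewrite normrM ler_pM// ?hM ?hC -?ler_norml.
  by rewrite mulr0 normr0 mulr_ge0// ltW.
- by move=> x /hK[_ ->]; rewrite mulr0.
Qed.

Definition ls_radon g h (gnd : {homo g : x y / x <= y})
  (hnd : {homo h : x y / x <= y}) : radon R :=
  Radon (ls_measure_lf gnd) (ls_measure_lf hnd).

Lemma ls_radonP g h (gnd : {homo g : x y / x <= y})
  (hnd : {homo h : x y / x <= y}) :
  distr_derivative (g \- h) (ls_radon gnd hnd).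
Proof.
move=> phi tphi; rewrite /radon_int /=.
have key k (knd : {homo k : x y / x <= y}) :
    \int[ls_measure knd]_x phi x = - \int[lebesgue_measure]_x (k x * derive1 phi x).
  have bk : locally_BV k by exact: locally_BV_nondecreasing.
  have brk : locally_BV (rlim k) by apply: locally_BV_nondecreasing; exact: rlim_nd.
  transitivity (\int[lebesgue_measure]_t (- (rlim k t * derive1 phi t))).
    by congr fine; exact: ls_measure_ibp.
  transitivity (\int[lebesgue_measure]_t ((-1) * (k t * derive1 phi t))); last first.
    by rewrite RintegralZl ?mulN1r//; exact: test_derive_integrable.
  congr fine; apply: ae_eq_integral => //.
  - apply/measurable_EFinP; apply: measurableT_comp => //; apply/measurable_EFinP.
    exact: measurable_int (test_derive_integrable tphi brk).
  - apply/measurable_EFinP; apply: measurable_funM => //; apply/measurable_EFinP.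
    exact: measurable_int (test_derive_integrable tphi bk).
  (* [rlim k] and [k] differ only at discontinuities of [k], of which there are countably many. *)
  exists [set x | ~ {for x, continuous k}]; split.
  - apply: countable_measurable => //.
    exact: nondecreasing_discontinuity_countable.
  - by apply: countable_lebesgue_measure0; exact: nondecreasing_discontinuity_countable.
  - move=> x /= nx cx; apply: nx => _.
    by rewrite (continuous_rlim knd cx) mulN1r.
have bg : locally_BV g by exact: locally_BV_nondecreasing.
have bh : locally_BV h by exact: locally_BV_nondecreasing.
transitivity (- (\int[lebesgue_measure]_x (g x * derive1 phi x))
   - - (\int[lebesgue_measure]_x (h x * derive1 phi x))).
  exact: (congr2 (fun a b : R => a - b) (key g gnd) (key h hnd)).
rewrite -opprD; congr (- _).
have ig := test_derive_integrable tphi bg.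
have ih := test_derive_integrable tphi bh.
transitivity (\int[lebesgue_measure]_x (g x * derive1 phi x - h x * derive1 phi x)).
  by rewrite RintegralB.
by apply: eq_Rintegral => x _; rewrite /= mulrBl.
Qed.

Lemma partialP f : locally_BV f -> distr_derivative f (partial f).
Proof.
move=> /locally_BVP[g [h [gnd hnd ->]]]; rewrite /partial.
by apply: (@xgetPex _ _ [set m | distr_derivative _ m]); exists (ls_radon gnd hnd); exact: ls_radonP.
Qed.

End DistributionalDerivative.

(** * The pairing of a derivative with a function *)

Section DerivativePairing.
Variable R : realType.
Notation MR := (measurableTypeR R).
Implicit Types (u v f g h : R -> R) (m : radon R).

(** The pairing [B] behind the generalized derivative. The interval is closed, so an atom at [w] or
    [- w] would count in full; hence the continuity assumptions at both ends in what follows. *)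
Definition bder (w : R) u v : R := radon_int (partial u) `[- w, w] v.

Lemma locally_BV_integrable (mu : {measure set MR -> \bar R}) (a b : R) v :
  locally_finite mu -> locally_BV v ->
  mu.-integrable (`[a, b]%classic : set MR) (fun x : MR => (v x)%:E).
Proof.
move=> lf bv; have [M M0 hM] := locally_BV_bounded a b bv.
apply: (@locally_finite_integrable _ _ _ a b M) => //.
- by apply: measurable_funTS; exact: locally_BV_measurable.
Qed.

Lemma bderE (w : R) u v m : locally_BV u -> locally_BV v ->
  distr_derivative u m -> bder w u v = radon_int m `[- w, w] v.
Proof.
move=> bu bv dm; have [M M0 hM] := locally_BV_bounded (- w) w bv.
have mI : measurable (`[- w, w]%classic : set MR) by exact: measurable_itv.
apply: (@radon_int_eq _ u u _ _ (- w - 1) (w + 1) M _ _ (partialP bu) dm) => //.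
- by apply: measurable_funTS; exact: locally_BV_measurable.
- move=> x /=; rewrite in_itv/= => /andP[? ?] /negP h; exfalso; apply: h.
  by apply/andP; split; lra.
Qed.

Lemma bder_eqr (w : R) u v1 v2 : (forall x, - w <= x <= w -> v1 x = v2 x) ->
  bder w u v1 = bder w u v2.
Proof.
move=> v12; rewrite /bder /radon_int; congr (_ - _); apply: eq_Rintegral => x;
  by rewrite inE/= in_itv/=; exact: v12.
Qed.

Lemma bder_local (w : R) u1 u2 v (a b : R) :
  locally_BV u1 -> locally_BV u2 -> locally_BV v ->
  (forall x, a < x < b -> u1 x = u2 x) ->
  (forall x, - w <= x <= w -> ~~ (a < x < b) -> v x = 0) ->
  bder w u1 v = bder w u2 v.
Proof.
move=> b1 b2 bv u12 v0; have [M M0 hM] := locally_BV_bounded (- w) w bv.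
have mI : measurable (`[- w, w]%classic : set MR) by exact: measurable_itv.
apply: (@radon_int_eq _ u1 u2 _ _ a b M _ _ (partialP b1) (partialP b2)) => //.
- by apply: measurable_funTS; exact: locally_BV_measurable.
Qed.

Lemma bderDr (w : R) u v1 v2 : locally_BV v1 -> locally_BV v2 ->
  bder w u (fun x => v1 x + v2 x) = bder w u v1 + bder w u v2.
Proof.
move=> b1 b2; have mI : measurable (`[- w, w]%classic : set MR) by exact: measurable_itv.
have key (mu : {measure set MR -> \bar R}) : locally_finite mu ->
    \int[mu]_(x in `[- w, w]) (v1 x + v2 x) =
    \int[mu]_(x in `[- w, w]) v1 x + \int[mu]_(x in `[- w, w]) v2 x.
  by move=> lf; apply: RintegralD => //; exact: locally_BV_integrable.
rewrite /bder /radon_int.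
have E1 := key _ (radon_pos_lf (partial u)).
have E2 := key _ (radon_neg_lf (partial u)).
etransitivity; first exact: (congr2 (fun a b : R => a - b) E1 E2).
by rewrite opprD addrACA.
Qed.

Lemma bderZr (w c : R) u v : locally_BV v ->
  bder w u (fun x => c * v x) = c * bder w u v.
Proof.
move=> bv; have mI : measurable (`[- w, w]%classic : set MR) by exact: measurable_itv.
have key (mu : {measure set MR -> \bar R}) : locally_finite mu ->
    \int[mu]_(x in `[- w, w]) (c * v x) = c * \int[mu]_(x in `[- w, w]) v x.
  by move=> lf; apply: RintegralZl => //; exact: locally_BV_integrable.
rewrite /bder /radon_int.
have E1 := key _ (radon_pos_lf (partial u)).
have E2 := key _ (radon_neg_lf (partial u)).
etransitivity; first exact: (congr2 (fun a b : R => a - b) E1 E2).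
by rewrite mulrBr.
Qed.

Let integral_measure_addR (mu nu : {measure set MR -> \bar R}) (A : set MR) v :
  measurable A -> mu.-integrable A (fun x => (v x)%:E) ->
  nu.-integrable A (fun x => (v x)%:E) ->
  \int[measure_add mu nu]_(x in A) v x = \int[mu]_(x in A) v x + \int[nu]_(x in A) v x.
Proof.
move=> mA i1 i2; rewrite /Rintegral integral_measure_add//.
by rewrite fineD//; exact: integrable_fin_num.
Qed.

Lemma locally_finite_add (mu nu : {measure set MR -> \bar R}) :
  locally_finite mu -> locally_finite nu -> locally_finite (measure_add mu nu).
Proof.
move=> lm ln K cK; rewrite [X in (X < _)%E]measure_addE.
by apply: lte_add_pinfty; [exact: lm|exact: ln].
Qed.

Definition radon_add m1 m2 : radon R :=
  Radon (locally_finite_add (radon_pos_lf m1) (radon_pos_lf m2))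
        (locally_finite_add (radon_neg_lf m1) (radon_neg_lf m2)).

Lemma radon_int_add m1 m2 (A : set R) v : measurable (A : set MR) ->
  (forall mu : {measure set MR -> \bar R}, locally_finite mu ->
     mu.-integrable (A : set MR) (fun x => (v x)%:E)) ->
  radon_int (radon_add m1 m2) A v = radon_int m1 A v + radon_int m2 A v.
Proof.
move=> mA iv.
have E1 := integral_measure_addR mA (iv _ (radon_pos_lf m1)) (iv _ (radon_pos_lf m2)).
have E2 := integral_measure_addR mA (iv _ (radon_neg_lf m1)) (iv _ (radon_neg_lf m2)).
etransitivity; first exact: (congr2 (fun a b : R => a - b) E1 E2).
by rewrite /radon_int opprD addrACA.
Qed.

Lemma distr_derivative_add u1 u2 m1 m2 : locally_BV u1 -> locally_BV u2 ->
  distr_derivative u1 m1 -> distr_derivative u2 m2 ->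
  distr_derivative (fun x => u1 x + u2 x) (radon_add m1 m2).
Proof.
move=> b1 b2 d1 d2 phi tphi; rewrite radon_int_add//; last first.
  by move=> mu lf; exact: test_integrable.
rewrite d1// d2// -opprD; congr (- _).
rewrite -RintegralD//; try exact: test_derive_integrable.
by apply: eq_Rintegral => x _; rewrite mulrDl.
Qed.

Lemma bderDl (w : R) u1 u2 v : locally_BV u1 -> locally_BV u2 -> locally_BV v ->
  bder w (fun x => u1 x + u2 x) v = bder w u1 v + bder w u2 v.
Proof.
move=> b1 b2 bv.
rewrite (@bderE _ _ _ (radon_add (partial u1) (partial u2)))//.
- rewrite radon_int_add// => mu lf; exact: locally_BV_integrable.
- exact: locally_BVD.
- by apply: distr_derivative_add => //; exact: partialP.
Qed.

Lemma locally_finite_scale (c : {nonneg R}) (mu : {measure set MR -> \bar R}) :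
  locally_finite mu -> locally_finite (mscale c mu).
Proof.
move=> lm K cK; rewrite /= /mscale; apply: lte_mul_pinfty => //; exact: lm.
Qed.

Definition radon_scale (c : {nonneg R}) m : radon R :=
  Radon (locally_finite_scale c (radon_pos_lf m))
        (locally_finite_scale c (radon_neg_lf m)).

Definition radon_opp m : radon R := Radon (radon_neg_lf m) (radon_pos_lf m).

Lemma radon_int_opp m A v : radon_int (radon_opp m) A v = - radon_int m A v.
Proof. by rewrite /radon_int opprB. Qed.

Lemma radon_int_scale (c : {nonneg R}) m (A : set R) v : measurable (A : set MR) ->
  (forall mu : {measure set MR -> \bar R}, locally_finite mu ->
     mu.-integrable (A : set MR) (fun x => (v x)%:E)) ->
  radon_int (radon_scale c m) A v = c%:num * radon_int m A v.
Proof.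
move=> mA iv.
have key (mu : {measure set MR -> \bar R}) : locally_finite mu ->
    \int[mscale c mu]_(x in A) v x = c%:num * \int[mu]_(x in A) v x.
  move=> lf; have i := iv _ lf; have mv := measurable_int _ i.
  rewrite /Rintegral integralE [in RHS]integralE.
  rewrite !ge0_integral_mscale//; [|exact: measurable_funeneg|exact: measurable_funepos].
  rewrite -(fineK (integrable_pos_fin_num mA i)) -(fineK (integrable_neg_fin_num mA i)).
  by rewrite -!EFinM -!EFinB /= mulrBr.
have E1 := key _ (radon_pos_lf m).
have E2 := key _ (radon_neg_lf m).
etransitivity; first exact: (congr2 (fun a b : R => a - b) E1 E2).
by rewrite /radon_int mulrBr.
Qed.

Lemma distr_derivative_opp u m : locally_BV u -> distr_derivative u m ->
  distr_derivative (fun x => - u x) (radon_opp m).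
Proof.
move=> bu d phi tphi; rewrite radon_int_opp d//; congr (- _).
transitivity (\int[lebesgue_measure]_x ((-1) * (u x * derive1 phi x))).
  by rewrite RintegralZl ?mulN1r//; exact: test_derive_integrable.
by apply: eq_Rintegral => x _; rewrite mulN1r mulNr.
Qed.

Lemma distr_derivative_scale (c : {nonneg R}) u m : locally_BV u ->
  distr_derivative u m ->
  distr_derivative (fun x => c%:num * u x) (radon_scale c m).
Proof.
move=> bu d phi tphi; rewrite radon_int_scale//; last first.
  by move=> mu lf; exact: test_integrable.
rewrite d// mulrN; congr (- _).
rewrite -RintegralZl//; last exact: test_derive_integrable.
by apply: eq_Rintegral => x _; rewrite mulrA.
Qed.

Lemma bderZl (w c : R) u v : locally_BV u -> locally_BV v ->
  bder w (fun x => c * u x) v = c * bder w u v.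
Proof.
move=> bu bv; have bcu := locally_BVZ c bu.
have mI : measurable (`[- w, w]%classic : set MR) by exact: measurable_itv.
have [c0|c0] := leP 0 c.
  rewrite (@bderE _ _ _ (radon_scale (NngNum c0) (partial u)))//.
    by rewrite radon_int_scale// => mu lf; exact: locally_BV_integrable.
  by apply: distr_derivative_scale => //; exact: partialP.
have nc0 : 0 <= - c by rewrite oppr_ge0 ltW.
rewrite (@bderE _ _ _ (radon_opp (radon_scale (NngNum nc0) (partial u))))//.
  rewrite radon_int_opp radon_int_scale//; first by rewrite /= mulNr opprK.
  by move=> mu lf; exact: locally_BV_integrable.
have -> : (fun x => c * u x) = (fun x => - ((NngNum nc0)%:num * u x)).
  by apply/funext => x; rewrite /= mulNr opprK.
apply: distr_derivative_opp; first exact: locally_BVZ.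
by apply: distr_derivative_scale => //; exact: partialP.
Qed.

End DerivativePairing.

(** * Explicit pairings with Heaviside functions and constants *)

Section PairingFormulas.
Variable R : realType.
Notation MR := (measurableTypeR R).
Implicit Types (u v f g h : R -> R) (m : radon R) (w p : R).

Lemma integral_hside (mu : {measure set MR -> \bar R}) w p :
  locally_finite mu -> - w < p < w ->
  \int[mu]_(x in `[- w, w]) hside p x =
  fine (mu [set p]) / 2 + fine (mu `]p, w]%classic).
Proof.
move=> lf /andP[wp pw].
have mp : measurable ([set p] : set MR) by exact: measurable_set1.
have mJ : measurable (`]p, w]%classic : set MR) by exact: measurable_itv.
have mI : measurable (`[- w, w]%classic : set MR) by exact: measurable_itv.
have int_indic (A : set MR) : measurable A ->
    mu.-integrable (`[- w, w]%classic : set MR) (fun x => (\1_A x)%:E).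
  move=> mA; apply: (@locally_finite_integrable _ _ _ (- w) w 1) => //.
  by move=> x _; rewrite indicE; case: (_ \in _); rewrite ?normr1 ?normr0.
transitivity (\int[mu]_(x in `[- w, w]) (2^-1 * \1_[set p] x + \1_(`]p, w]%classic : set MR) x)).
  apply: eq_Rintegral => x; rewrite inE/= in_itv/= => /andP[wx xw].
  rewrite !indicE; have [xp|px|->] := ltgtP x p.
  - rewrite hside_lt// !memNset ?mulr0 ?addr0//=; last by move=> E; rewrite E ltxx in xp.
    by rewrite in_itv/= ltNge ltW.
  - rewrite hside_gt// memNset ?mulr0 ?add0r ?mem_set//=; first by rewrite in_itv/= px.
    by move=> E; rewrite E ltxx in px.
  - rewrite hside_eq mem_set// memNset ?mulr1 ?addr0//=.
    by rewrite in_itv/= ltxx.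
rewrite RintegralD//; last 2 first.
  - exact: (@integrableZl _ MR R mu _ mI 2^-1 _ (int_indic _ mp)).
  - exact: int_indic.
rewrite RintegralZl//; last exact: int_indic.
congr (_ + _); rewrite /Rintegral integral_indic//.
  rewrite mulrC; congr (_ / _); congr (fine (mu _)).
  by apply/setIidl => x -> /=; rewrite in_itv/= !ltW.
congr (fine (mu _)); apply/setIidl => x /=; rewrite !in_itv/= => /andP[px ->].
by rewrite andbT ltW// (lt_trans wp).
Qed.

Lemma integral_one (mu : {measure set MR -> \bar R}) w :
  locally_finite mu -> 0 < w ->
  \int[mu]_(x in `[- w, w]) (1 : R) =
  fine (mu [set - w]) + fine (mu `](- w), w]%classic).
Proof.
move=> lf w0.
have mp : measurable ([set - w] : set MR) by exact: measurable_set1.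
have mJ : measurable (`](- w), w]%classic : set MR) by exact: measurable_itv.
have mI : measurable (`[- w, w]%classic : set MR) by exact: measurable_itv.
have fin (A : set MR) : measurable A -> A `<=` `[- w, w]%classic -> (mu A \is a fin_num)%E.
  by move=> mA sA; rewrite ge0_fin_numE//; exact: (locally_finite_lty lf mA sA).
have f1 : mu [set - w] \is a fin_num.
  by apply: fin => // x -> /=; rewrite in_itv/= lexx/=; lra.
have f2 : mu `](- w), w]%classic \is a fin_num.
  by apply: fin => // x /=; rewrite !in_itv/= => /andP[/ltW -> ->].
rewrite /Rintegral integral_cst// mul1e -fineD//; congr fine.
rewrite -measureU//; last first.
  by apply/seteqP; split => // x [/= ->]; rewrite in_itv/= ltxx.
congr (mu _); rewrite setU1itv//; first by rewrite bnd_simp; lra.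
Qed.

Lemma continuous_rlimB g h x : {homo g : x y / x <= y} -> {homo h : x y / x <= y} ->
  {for x, continuous (g \- h)} -> rlim g x - rlim h x = g x - h x.
Proof.
move=> gnd hnd /left_right_continuousP[_ c].
have c2 : (g \- h) y @[y --> x^'+] --> rlim g x - rlim h x.
  by apply: cvgB; exact: cvg_rlim.
exact: (cvg_unique _ c2 c).
Qed.

Lemma continuous_llimB g h x : {homo g : x y / x <= y} -> {homo h : x y / x <= y} ->
  {for x, continuous (g \- h)} -> llim g x - llim h x = g x - h x.
Proof.
move=> gnd hnd /left_right_continuousP[c _].
have c2 : (g \- h) y @[y --> x^'-] --> llim g x - llim h x.
  by apply: cvgB; exact: cvg_llim.
exact: (cvg_unique _ c2 c).
Qed.

Lemma bder_ls w v g h (gnd : {homo g : x y / x <= y}) (hnd : {homo h : x y / x <= y}) :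
  locally_BV v -> bder w (g \- h) v =
    \int[ls_measure gnd]_(x in `[- w, w]) v x -
    \int[ls_measure hnd]_(x in `[- w, w]) v x.
Proof.
move=> bv; rewrite (@bderE _ w _ _ _ _ _ (ls_radonP gnd hnd))//.
by apply/locally_BVP; exists g, h.
Qed.

(** The integral is half of the jump of [u] at [p] plus the increment of [u] to the right of [p]. As
    [u p] is the mean of the one-sided limits, the half jump turns the right limit into [u p]. *)
Lemma bder_hsider w u p : epilogic u -> {for w, continuous u} -> - w < p < w ->
  bder w u (hside p) = u w - u p.
Proof.
move=> eu cu pw; have [bu _] := eu; have /locally_BVP[g [h [gnd hnd E]]] := bu.
move: eu cu; rewrite E => eu cu.
have [bp _] := epilogic_hside p.
rewrite (bder_ls w gnd hnd bp).
have key k (knd : {homo k : x y / x <= y}) :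
    \int[ls_measure knd]_(x in `[- w, w]) hside p x =
    (rlim k p - llim k p) / 2 + (rlim k w - rlim k p).
  rewrite integral_hside//; last exact: ls_measure_lf.
  case/andP: pw => _ /ltW pw.
  have E1 := ls_measure_set1 knd p; have E2 := ls_measure_oc knd pw.
  exact: (congr2 (fun a b : \bar R => fine a / 2 + fine b) E1 E2).
have E1 := key g gnd; have E2 := key h hnd.
etransitivity; first exact: (congr2 (fun a b : R => a - b) E1 E2).
have := epilogic_lim p gnd hnd eu; have := continuous_rlimB gnd hnd cu.
cbv beta; rewrite /=.
move: (rlim g p) (llim g p) (rlim h p) (llim h p) (rlim g w) (rlim h w).
by move: (g p) (h p) (g w) (h w); clear => *; lra.
Qed.

Lemma bder_oner w u : 0 < w -> locally_BV u -> {for w, continuous u} ->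
  {for - w, continuous u} -> bder w u (fun=> 1) = u w - u (- w).
Proof.
move=> w0 bu cu cu'; have /locally_BVP[g [h [gnd hnd E]]] := bu.
move: cu cu'; rewrite E => cu cu'.
rewrite (bder_ls w gnd hnd (locally_BV_cst 1)).
have ww : - w <= w by lra.
have key k (knd : {homo k : x y / x <= y}) :
    \int[ls_measure knd]_(x in `[- w, w]) (1 : R) =
    (rlim k (- w) - llim k (- w)) + (rlim k w - rlim k (- w)).
  rewrite integral_one//; last exact: ls_measure_lf.
  have E1 := ls_measure_set1 knd (- w); have E2 := ls_measure_oc knd ww.
  exact: (congr2 (fun a b : \bar R => fine a + fine b) E1 E2).
have E1 := key g gnd; have E2 := key h hnd.
etransitivity; first exact: (congr2 (fun a b : R => a - b) E1 E2).
have := continuous_llimB gnd hnd cu'; have := continuous_rlimB gnd hnd cu.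
cbv beta; rewrite /=.
move: (rlim g (- w)) (llim g (- w)) (rlim h (- w)) (llim h (- w)) (rlim g w) (rlim h w).
by move: (g (- w)) (h (- w)) (g w) (h w); clear => *; lra.
Qed.

Lemma locally_finite_dirac p : locally_finite (@dirac _ MR p R).
Proof. by move=> K cK; rewrite /= diracE; case: (_ \in _); rewrite ltry. Qed.

Definition dirac_radon p : radon R :=
  Radon (locally_finite_dirac p) (@locally_finite0 R).

Lemma hside_dirac p : distr_derivative (hside p) (dirac_radon p).
Proof.
move=> phi tphi; rewrite /radon_int /=.
have mphi : measurable_fun [set: MR] (phi : MR -> R).
  by apply: continuous_measurable_fun; exact: test_continuous0.
have E1 : \int[@dirac _ MR p R]_(x in [set: MR]) phi x = phi p.
  rewrite /Rintegral integral_dirac//; last exact/measurable_EFinP.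
  by rewrite diracT mul1e.
have E2 : \int[mzero]_(x in [set: MR]) phi x = 0 by rewrite /Rintegral integral_measure_zero.
etransitivity; first exact: (congr2 (fun a b : R => a - b) E1 E2).
rewrite subr0; have [K K0 hK] := test_support tphi.
have bp : locally_BV (hside p) by case: (epilogic_hside p).
have phiK1 x : K + `|p| + 1 <= `|x| -> phi x = 0.
  by move=> h; apply: (hK _ _).1; have := normr_ge0 p; lra.
have p1 : - (K + `|p| + 1) < p.
  by have := ler_norm (- p); rewrite normrN; lra.
have p2 : p <= K + `|p| + 1 by have := ler_norm p; lra.
have F := test_ftc tphi phiK1 p1 p2.
transitivity (\int[lebesgue_measure]_(x in [set: MR]) ((-1) * (hside p x * derive1 phi x))); last first.
  by rewrite RintegralZl ?mulN1r//; exact: test_derive_integrable.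
transitivity (fine (phi p)%:E) => //; rewrite -F; congr fine.
rewrite [LHS]integral_mkcond; apply: ae_eq_integral => //.
- apply/measurable_restrict => //.
  apply: measurable_funTS; apply/measurable_EFinP; apply: measurableT_comp => //.
  by apply: continuous_measurable_fun; exact: test_continuous1.
- apply/measurable_EFinP; apply: measurable_funM => //; apply/measurable_EFinP.
  exact: measurable_int (test_derive_integrable tphi bp).
exists [set p]; split => //; first exact: lebesgue_measure_set1.
move=> x /= nx; apply: contrapT => xp; apply: nx => _.
rewrite /patch; case: ifPn => [/set_mem/=|/negP h].
  rewrite in_itv/= => /andP[px xK]; rewrite hside_gt ?mul1r ?mulN1r//.
  by rewrite lt_neqAle px andbT; apply/eqP => E; apply: xp.
have [xp'|px|//] := ltgtP x p; first by rewrite hside_lt// mul0r mulr0.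
rewrite (hK x _).2 ?mulr0//; rewrite leNgt; apply/negP; rewrite ltr_norml => /andP[? ?].
by apply: h; apply/mem_set; rewrite /= in_itv/=; have ? := normr_ge0 p; apply/andP; split; lra.
Qed.

Lemma bder_hsidel w p v : locally_BV v -> - w < p < w -> bder w (hside p) v = v p.
Proof.
move=> bv pw; have [bp _] := epilogic_hside p.
rewrite (@bderE _ w _ _ _ _ _ (hside_dirac p))// /radon_int /=.
have mI : measurable (`[- w, w]%classic : set MR) by exact: measurable_itv.
have E1 : \int[@dirac _ MR p R]_(x in (`[- w, w]%classic : set MR)) v x = v p.
  rewrite /Rintegral integral_dirac//; last first.
    by apply: measurable_funTS; apply/measurable_EFinP; exact: locally_BV_measurable.
  rewrite diracE mem_set ?mul1e//= in_itv/=.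
  by case/andP: pw => /ltW -> /ltW ->.
have E2 : \int[mzero]_(x in (`[- w, w]%classic : set MR)) v x = 0.
  by rewrite /Rintegral integral_measure_zero.
etransitivity; first exact: (congr2 (fun a b : R => a - b) E1 E2).
by rewrite subr0.
Qed.

(** Around [[- w, w]] the constant 1 agrees with [hside p] for some [p < - w], whose derivative is a
    Dirac mass outside the interval. *)
Lemma bder_cstl w (c : R) v : locally_BV v -> bder w (fun=> c) v = 0.
Proof.
move=> bv; have [p pw] : exists p, p < - w by exists (- w - 1); lra.
have [bp _] := epilogic_hside p.
have b1 := locally_BV_cst (1 : R).
have E0 : bder w (fun=> 1) v = bder w (hside p) v.
  apply: (@bder_local _ w (fun=> 1) (hside p) v p (w + 1) b1 bp bv).
    by move=> x /andP[px _]; rewrite hside_gt.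
  move=> x /andP[? ?] /negP h; exfalso; apply: h; apply/andP; split; lra.
have mI : measurable (`[- w, w]%classic : set MR) by exact: measurable_itv.
have E1 : \int[@dirac _ MR p R]_(x in (`[- w, w]%classic : set MR)) v x = 0.
  have mv : measurable_fun (`[- w, w]%classic : set MR) (fun x : MR => (v x)%:E).
    by apply: measurable_funTS; apply/measurable_EFinP; exact: locally_BV_measurable.
  rewrite /Rintegral integral_dirac; [|exact: mI|exact: mv].
  rewrite diracE memNset; first by rewrite mul0e.
  by rewrite /= in_itv/= leNgt pw.
have E2 : \int[mzero]_(x in (`[- w, w]%classic : set MR)) v x = 0.
  by rewrite /Rintegral integral_measure_zero.
have E3 : bder w (hside p) v = 0.
  rewrite (bderE _ bp bv (hside_dirac p)).
  etransitivity; first exact: (congr2 (fun a b : R => a - b) E1 E2).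
  by rewrite subr0.
have -> : (fun _ : R => c) = (fun _ : R => c * 1) by apply/funext => x; rewrite mulr1.
by rewrite (bderZl w c b1 bv) E0 E3 mulr0.
Qed.

(* Continuity at the endpoints excludes atoms there. *)
Lemma bder_eql w u v : 0 < w -> locally_BV u -> locally_BV v ->
  {for w, continuous u} -> {for - w, continuous u} ->
  (forall x, - w <= x <= w -> u x = 0) -> bder w u v = 0.
Proof.
move=> w0 bu bv cw cw' u0.
have /locally_BVP[g [h [gnd hnd E]]] := bu; subst u.
rewrite (bder_ls w gnd hnd bv); apply/eqP; rewrite subr_eq0; apply/eqP.
suff EX X : measurable (X : set MR) -> X `<=` `[- w, w]%classic ->
    ls_measure gnd X = ls_measure hnd X.
  rewrite /Rintegral.
  by rewrite (@eq_measure_integral _ MR R _ (ls_measure hnd) (ls_measure gnd) _ EX).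
move=> mX XI.
have atom x : {for x, continuous (g \- h)} ->
    ls_measure gnd [set x] = ls_measure hnd [set x].
  move=> c; etransitivity; first exact: ls_measure_set1.
  etransitivity; last by apply/esym; exact: ls_measure_set1.
  congr (_%:E); have := continuous_llimB gnd hnd c.
  by have := continuous_rlimB gnd hnd c; lra.
have mx (x : R) : measurable ([set x] : set MR) by exact: measurable_set1.
have mO : measurable (`](- w), w[%classic : set MR) by exact: measurable_itv.
have sub (x : R) (mu nu : {measure set MR -> \bar R}) :
    mu [set x] = nu [set x] -> mu (X `&` [set x]) = nu (X `&` [set x]).
  move=> e; have [Xx|Xx] := pselect (X x).
    by rewrite setIC setIidl// => y ->.
  have -> : X `&` [set x] = set0.
    by apply/seteqP; split => // y [Xy /= yx]; apply: Xx; rewrite -yx.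
  by rewrite !measure0.
pose X1 : set MR := X `&` `](- w), w[%classic.
pose X2 : set MR := X `&` [set - w].
pose X3 : set MR := X `&` [set w].
have m1 : measurable X1 by exact: measurableI.
have m2 : measurable X2 by exact: measurableI.
have m3 : measurable X3 by exact: measurableI.
have d23 : X2 `&` X3 = set0.
  by apply/seteqP; split => // x [[_ /= ->]] [_ /=]; clear -w0; lra.
have d1 : X1 `&` (X2 `|` X3) = set0.
  apply/seteqP; split => // x [[_ /=]]; rewrite in_itv/= => /andP[wx xw].
  by move=> [[_ /= xE]|[_ /= xE]]; [move: wx|move: xw]; rewrite xE ltxx.
have XE : X = X1 `|` (X2 `|` X3).
  rewrite -!setIUr; apply/esym/setIidl => x Xx.
  have := XI _ Xx; rewrite /= !in_itv/= => /andP[].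
  rewrite le_eqVlt => /predU1P[<-|->]; first by right; left.
  by rewrite le_eqVlt => /predU1P[->|->]; [right; right|left].
have dec (mu : {measure set MR -> \bar R}) : mu X = (mu X1 + (mu X2 + mu X3))%E.
  rewrite [in LHS]XE measureU; [|exact: m1|exact: measurableU|exact: d1].
  by rewrite measureU; [|exact: m2|exact: m3|exact: d23].
rewrite (dec (ls_measure gnd)) (dec (ls_measure hnd)).
congr (_ + (_ + _))%E; [|exact/sub/atom|exact/sub/atom].
have dr := ls_radonP gnd hnd.
have d0 : distr_derivative (fun=> 0 : R) (Radon (@locally_finite0 R) (@locally_finite0 R)).
  move=> phi tphi; rewrite /radon_int /= subrr.
  rewrite -[LHS]oppr0; congr (- _); rewrite /Rintegral integral0_eq// => x _.
  by rewrite mul0r.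
have ogh x : - w < x < w -> (g \- h) x = 0.
  by move=> /andP[? ?]; apply: u0; rewrite !ltW.
have X1O : X1 `<=` `](- w), w[%classic by move=> x [].
by have := radon_int_measure_eq dr d0 ogh m1 X1O; rewrite /= /mzero adde0 add0e.
Qed.

End PairingFormulas.

(** * Linear algebra *)

Section Interpolation.
Variable R : realType.

Definition lin_closed (L : set (R -> R)) :=
  L (fun=> 0) /\ forall (c : R) f g, L f -> L g -> L (fun x => f x + c * g x).

Lemma lin_closed_sum (L : set (R -> R)) (I : eqType) (s : seq I) (F : I -> R -> R)
    (c : I -> R) : lin_closed L -> (forall i, i \in s -> c i != 0 -> L (F i)) ->
  L (fun x => \sum_(i <- s) c i * F i x).
Proof.
move=> [L0 LD]; elim: s => [|i s IH] h.
  by under eq_fun do rewrite big_nil.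
under eq_fun do rewrite big_cons addrC.
have Ls : L (fun x => \sum_(j <- s) c j * F j x).
  by apply: IH => j js; apply: h; rewrite in_cons js orbT.
have [ci|ci] := eqVneq (c i) 0.
  by under eq_fun do rewrite ci mul0r addr0.
by apply: LD => //; apply: h; rewrite ?mem_head.
Qed.

(* [kap] and [L] localise the construction: functions of [L k] vanish at the points of [D] outside the [k]-th piece. *)
Lemma nodal_basis (K : eqType) (D : set R) (kap : R -> K) (L : K -> set (R -> R))
    (fs : seq (K * (R -> R))) :
  (forall k, lin_closed (L k)) ->
  (forall k f x, L k f -> D x -> f x != 0 -> kap x = k) ->
  (forall k f, L k f -> (forall x, D x -> f x = 0) -> forall x, f x = 0) ->
  (forall i, (i < size fs)%N -> forall d, L (nth d fs i).1 (nth d fs i).2) ->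
  exists (s : seq R) (e : R -> R -> R),
    [/\ uniq s, forall a, a \in s -> D a, forall a, a \in s -> L (kap a) (e a),
        forall a b, a \in s -> b \in s -> e a b = (a == b)%:R &
        forall i, (i < size fs)%N -> forall d x,
          (nth d fs i).2 x = \sum_(a <- s) (nth d fs i).2 a * e a x].
Proof.
move=> Llin Lkap Ldet; elim: fs => [|[k f] fs IH] Lfs.
  by exists [::], (fun _ _ => 0); split.
have [|s [e [us sD sL nod fsE]]] := IH.
  by move=> i ifs d; exact: (Lfs i.+1).
(* A Newton step: the residual of the new function after interpolation at the nodes found so far. If
   it vanishes on [D] it is zero and the basis is kept; otherwise any point of [D] where it is
   nonzero becomes a node. *)
pose f' x := f x - \sum_(a <- s) f a * e a x.
have Lf : L k f by exact: (Lfs 0%N (ltn0Sn _) (k, f)).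
have Lsum : L k (fun x => \sum_(a <- s) f a * e a x).
  apply: lin_closed_sum => // a asn fa0.
  by rewrite -(Lkap k f a Lf (sD a asn) fa0); exact: sL.
have Lf' : L k f'.
  rewrite (_ : f' = fun x => f x + (-1) * \sum_(a <- s) f a * e a x).
    by apply: (Llin k).2.
  by apply/funext => x; rewrite mulN1r.
have f's b : b \in s -> f' b = 0.
  move=> bs; rewrite /f' (bigD1_seq b)//= nod// eqxx mulr1 big1_seq ?addr0 ?subrr//.
  by move=> a /andP[ab asn]; rewrite nod// (negbTE ab) mulr0.
have [[y [Dy y0]]|nex] := pselect (exists y, D y /\ f' y != 0); last first.
  exists s, e; split => // -[_ d x /=|i ifs d x]; last exact: fsE.
  have -> // : f x = \sum_(a <- s) f a * e a x.
  apply/eqP; rewrite -subr_eq0; apply/eqP; apply: (Ldet k f' Lf') => z Dz.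
  by apply/eqP/negPn/negP => z0; apply: nex; exists z.
have ky : kap y = k by exact: Lkap Lf' Dy y0.
have ys : y \notin s by apply: contra y0 => /f's ->.
pose en x := (f' y)^-1 * f' x.
have Len : L k en.
  have -> : en = fun x => 0 + (f' y)^-1 * f' x by apply/funext => x; rewrite add0r.
  by apply: (Llin k).2 => //; exact: (Llin k).1.
have eny : en y = 1 by rewrite /en mulVf.
have ens b : b \in s -> en b = 0 by move=> /f's E; rewrite /en E mulr0.
exists (y :: s), (fun a => if a == y then en else fun x => e a x - e a y * en x).
split => [|a|a|a b|].
- by rewrite /= ys.
- by rewrite in_cons => /predU1P[->|/sD].
- rewrite in_cons => /predU1P[->|asn]; first by rewrite eqxx ky.
  case: eqP => [ay|_]; first by rewrite -ay asn in ys.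
  have -> : (fun x => e a x - e a y * en x) = (fun x => e a x + (- e a y) * en x).
    by apply/funext => x; rewrite mulNr.
  (* An old basis function is modified only if it is nonzero at the new node [y]; then [kap a] is
     the piece of [y], and the correction stays in the same space. *)
  have [E|ay0] := eqVneq (e a y) 0.
    have -> : (fun x => e a x + (- e a y) * en x) = e a.
      by apply/funext => x; rewrite E oppr0 mul0r addr0.
    exact: sL.
  have kE : kap a = k by rewrite -ky; apply/esym; exact: Lkap (sL a asn) Dy ay0.
  by apply: (Llin (kap a)).2; [exact: sL|rewrite kE].
- rewrite !in_cons => /predU1P[->|asn] /predU1P[->|bs].
  + by rewrite !eqxx eny.
  + by rewrite eqxx ens//; case: eqP => // E; rewrite E bs in ys.
  + by case: eqP => [E|_]; [rewrite -E asn in ys|rewrite eny mulr1 subrr].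
  + case: eqP => [E|_]; first by rewrite -E asn in ys.
    by rewrite ens// mulr0 subr0 nod.
have expand (c : R -> R) x : \sum_(a <- y :: s) c a * (if a == y then en else
    fun x => e a x - e a y * en x) x =
    \sum_(a <- s) c a * e a x + (c y - \sum_(a <- s) c a * e a y) * en x.
  rewrite big_cons eqxx.
  set S1 := \sum_(a <- s) c a * e a x; set S2 := \sum_(a <- s) c a * e a y.
  suff -> : \sum_(j <- s) c j * (if j == y then en else
      fun x0 => e j x0 - e j y * en x0) x = S1 - S2 * en x by ring.
  rewrite /S1 /S2 mulr_suml -sumrB; apply: eq_big_seq => a asn.
  case: eqP => [E|_]; first by rewrite -E asn in ys.
  by rewrite mulrBr mulrA.
move=> [_ d x|i ifs d x]; rewrite expand /=.
  rewrite -/(f' y) /en mulrA mulfV// mul1r /f' addrC subrK//.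
by rewrite -(fsE i ifs d y) subrr mul0r addr0 -fsE.
Qed.

(** The hypotheses make the sum [S] of the absolute values satisfy [S <= S / 2]: the map given by
    [A] is a contraction in the l1 norm, with 0 as its only fixed point. *)
Lemma small_combination (s : seq R) (c : R -> R) (A : R -> R -> R) :
  uniq s -> (forall a b, a \in s -> b \in s ->
    `|A a b| * (size s).+1%:R <= 2^-1) ->
  (forall b, b \in s -> c b = \sum_(a <- s) c a * A a b) ->
  forall a, a \in s -> c a = 0.
Proof.
move=> us hA hc; pose S := \sum_(a <- s) `|c a|.
have S0 : 0 <= S by exact: sumr_ge0.
have n0 : (0 : R) < (size s).+1%:R by rewrite ltr0n.
have bound b : b \in s -> `|c b| <= S * (2^-1 / (size s).+1%:R).
  move=> bs; rewrite hc//; apply: le_trans (ler_norm_sum _ _ _) _.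
  rewrite mulr_suml; rewrite big_seq [leRHS]big_seq; apply: ler_sum => a asn.
  by rewrite normrM ler_wpM2l// ler_pdivlMr// hA.
have : S <= S * 2^-1.
  have : S <= \sum_(b <- s) S * (2^-1 / (size s).+1%:R).
    by rewrite {1}/S big_seq [leRHS]big_seq; apply: ler_sum => b; exact: bound.
  move=> /le_trans; apply.
  rewrite (_ : \sum_(b <- s) _ = S * (2^-1 / (size s).+1%:R) * (size s)%:R); last first.
    by rewrite big_const_seq count_predT iter_addr_0 mulr_natr.
  rewrite -mulrA; apply: ler_wpM2l => //.
  by rewrite mulrAC ler_pdivrMr// ler_pM2l ?ler_nat// invr_gt0.
have [S_gt0 h|] := ltP 0 S; last first.
  move=> Sle _ a asn; apply/eqP; rewrite -normr_le0.
  apply: le_trans Sle; rewrite /S (bigD1_seq a)//= lerDl; exact: sumr_ge0.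
by exfalso; lra.
Qed.

End Interpolation.

(** * Schur complements and symplectic perturbation *)

Section SchurComplement.
Variable R : realType.

Lemma nonroot_exists (p : {poly R}) : p != 0 -> exists s : R, ~~ root p s.
Proof.
move=> p0; apply/not_existsP => h.
have ur : uniq [seq (i%:R : R) | i <- iota 0 (size p)].
  by rewrite map_inj_uniq ?iota_uniq// => i j /eqP; rewrite eqr_nat => /eqP.
have hall : all (root p) [seq (i%:R : R) | i <- iota 0 (size p)].
  by apply/allP => x _; apply/negPn/negP => /h.
by have := max_poly_roots p0 hall ur; rewrite size_map size_iota ltnn.
Qed.

Definition symplectic m : 'M[R]_(m + m) := block_mx 0 1%:M (- 1%:M) 0.

Lemma symplectic_unit m : symplectic m \in unitmx.
Proof.
have : symplectic m *m (- symplectic m) = 1%:M.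
  rewrite /symplectic opp_block_mx mulmx_block !oppr0 !(mulmx0, mul0mx, mul1mx) opprK.
  by rewrite !mulNmx !mul1mx opprK !(add0r, addr0) -scalar_mx_block.
by move=> /mulmx1_unit[].
Qed.

(** Up to the determinant of [J], the determinant of [A + s J] is the characteristic polynomial of
    [- A J^-1] at [s], so all but finitely many [s] work. *)
Lemma symplectic_perturbation m (A : 'M[R]_(m + m)) :
  exists s : R, A + s *: symplectic m \in unitmx.
Proof.
set J := symplectic m.
have [s sP] := nonroot_exists (monic_neq0 (char_poly_monic (- (A *m invmx J)))).
exists s; rewrite unitmxE unitfE; apply: contra sP => d0.
rewrite -eigenvalue_root_char.
have : \det (A *m invmx J + s%:M) = 0.
  have -> : A *m invmx J + s%:M = (A + s *: J) *m invmx J.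
    by rewrite mulmxDl -scalemxAl mulmxV ?symplectic_unit// scalemx1.
  by rewrite det_mulmx (eqP d0) mul0r.
move=> /eqP/det0P[v v0 vE]; apply/eigenvalueP; exists v => //.
apply/eqP; rewrite mulmxN -subr_eq0 -opprD oppr_eq0 -mul_mx_scalar -mulmxDr.
by rewrite vE.
Qed.

(* Eliminating [t] leaves [c (S - Phi G^+ Psi + s J) = 0]. *)
Lemma schur_kernel n m (G : 'M[R]_n) (Phi : 'M[R]_(m + m, n)) (Psi : 'M[R]_(n, m + m))
    (S : 'M[R]_(m + m)) (e : 'rV[R]_n) :
  (forall t : 'rV_n, t *m G = 0 -> exists k : R, t = k *: e) -> e *m Psi = 0 ->
  exists s : R, forall (t : 'rV_n) (c : 'rV_(m + m)),
    t *m G + c *m Phi = 0 -> t *m Psi + c *m (S + s *: symplectic m) = 0 ->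
    c = 0 /\ exists k : R, t = k *: e.
Proof.
move=> kerG ePsi.
have [s su] := symplectic_perturbation (S - Phi *m pinvmx G *m Psi).
exists s => t c E1 E2.
have cPhi : c *m Phi = - (t *m G) by apply/eqP; rewrite -addr_eq0 addrC E1.
have sub : (c *m Phi <= G)%MS by rewrite cPhi eqmx_opp submxMl.
(* By the first equation [c Phi] lies in the row space of [G], where [pinvmx G] followed by [G] is
   the identity. *)
have [k tk] : exists k : R, t + c *m Phi *m pinvmx G = k *: e.
  by apply: kerG; rewrite mulmxDl mulmxKpV.
have c0 : c = 0.
  have : c *m (S - Phi *m pinvmx G *m Psi + s *: symplectic m) = 0.
    (* The undetermined multiple of [e] is harmless here because [e Psi = 0]. *)
    have tPsi : t *m Psi = - (c *m (Phi *m pinvmx G *m Psi)).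
      have -> : t = k *: e - c *m Phi *m pinvmx G by rewrite -tk addrK.
      by rewrite mulmxBl -scalemxAl ePsi scaler0 sub0r !mulmxA.
    rewrite -E2 tPsi !mulmxDr mulmxN.
    by rewrite [X in X + _]addrC -addrA.
  by move/(congr1 (mulmx^~ (invmx (S - Phi *m pinvmx G *m Psi + s *: symplectic m))));
    rewrite mulmxK// mul0mx.
split => //; apply: kerG; move: E1; by rewrite c0 mul0mx addr0.
Qed.

(** Each kernel has dimension at least [n + 1]. Two orthogonal subspaces of a space of dimension
    [2 n + 1] cannot both be that large, so some pair has a nonzero product. *)
Lemma kernel_pairing n (A B : 'M[R]_(n.*2.+1, n)) : exists a b : 'rV[R]_(n.*2.+1),
  [/\ a *m A = 0, b *m B = 0 & \sum_i a 0 i * b 0 i = 1].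
Proof.
have rk (M : 'M[R]_(n.*2.+1, n)) : (n.+1 <= \rank (kermx M))%N.
  by rewrite mxrank_ker; have := rank_leq_col M; lia.
have : kermx A *m (kermx B)^T != 0.
  apply/eqP => /mulmx0_rank_max; rewrite mxrank_tr.
  by have := rk A; have := rk B; lia.
case/matrix0Pn => i [j]; rewrite mxE => h.
pose z := \sum_l kermx A i l * (kermx B)^T l j.
exists (row i (kermx A)), (z^-1 *: row j (kermx B)); split.
- by rewrite -row_mul mulmx_ker row0.
- by rewrite -scalemxAl -row_mul mulmx_ker row0 scaler0.
- rewrite -[RHS](mulVf h) mulr_sumr; apply: eq_bigr => l _.
  by rewrite !mxE mulrCA.
Qed.

End SchurComplement.

(** * The local spaces on a partition *)

Section GoodFunctions.
Variable R : realType.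
Variable w : R.
Hypothesis w0 : 0 < w.
Implicit Types (u v f : R -> R).

Definition good u := [/\ epilogic u, {for w, continuous u} & {for - w, continuous u}].

Lemma good_BV u : good u -> locally_BV u.
Proof. by case=> -[]. Qed.

Lemma good_lin : lin_closed good.
Proof.
split.
  by split; [exact: epilogic_cst|exact: cst_continuous|exact: cst_continuous].
move=> c f g [ef f1 f2] [eg g1 g2]; split.
- by apply: epilogicD => //; exact: epilogicZ.
- apply: (@continuousD _ _ _ f (fun x => c * g x)) => //.
  by apply: (@continuousM _ _ (fun=> c) g) => //; exact: cst_continuous.
- apply: (@continuousD _ _ _ f (fun x => c * g x)) => //.
  by apply: (@continuousM _ _ (fun=> c) g) => //; exact: cst_continuous.
Qed.

Lemma good_cst c : good (fun=> c).
Proof. by split; [exact: epilogic_cst|exact: cst_continuous|exact: cst_continuous]. Qed.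

Lemma good_hside p : p != w -> p != - w -> good (hside p).
Proof.
by move=> pw pw'; split; [exact: epilogic_hside|apply: hside_continuous; rewrite eq_sym..].
Qed.

Lemma goodB f g : good f -> good g -> good (fun x => f x - g x).
Proof.
move=> gf gg; have -> : (fun x => f x - g x) = (fun x => f x + (-1) * g x).
  by apply/funext => x; rewrite mulN1r.
exact: good_lin.2.
Qed.

Lemma goodD f g : good f -> good g -> good (fun x => f x + g x).
Proof.
move=> gf gg; have -> : (fun x => f x + g x) = (fun x => f x + 1 * g x).
  by apply/funext => x; rewrite mul1r.
exact: good_lin.2.
Qed.

Lemma goodZ c f : good f -> good (fun x => c * f x).
Proof.
move=> gf; have -> : (fun x => c * f x) = (fun x => 0 + c * f x).
  by apply/funext => x; rewrite add0r.
by apply: good_lin.2 => //; exact: good_lin.1.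
Qed.

Lemma good_sum (I : eqType) (s : seq I) (F : I -> R -> R) (c : I -> R) :
  (forall i, i \in s -> good (F i)) -> good (fun x => \sum_(i <- s) c i * F i x).
Proof. by move=> h; apply: (lin_closed_sum good_lin) => i /h. Qed.

Notation B := (bder w).

Lemma goodBDl u1 u2 v : good u1 -> good u2 -> good v ->
  B (fun x => u1 x + u2 x) v = B u1 v + B u2 v.
Proof. by move=> *; apply: bderDl; exact: good_BV. Qed.

Lemma goodBDr u v1 v2 : good v1 -> good v2 ->
  B u (fun x => v1 x + v2 x) = B u v1 + B u v2.
Proof. by move=> *; apply: bderDr; exact: good_BV. Qed.

Lemma goodBZl c u v : good u -> good v -> B (fun x => c * u x) v = c * B u v.
Proof. by move=> *; apply: bderZl; exact: good_BV. Qed.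

Lemma goodBZr c u v : good v -> B u (fun x => c * v x) = c * B u v.
Proof. by move=> *; apply: bderZr; exact: good_BV. Qed.

Lemma goodB0r u : B u (fun=> 0) = 0.
Proof.
have E := goodBZr 0 u (good_cst 0); rewrite (mul0r (B u _)) in E.
by rewrite -[RHS]E mul0r.
Qed.

Lemma goodB_sumr u (I : eqType) (s : seq I) (F : I -> R -> R) (c : I -> R) :
  (forall i, i \in s -> good (F i)) ->
  B u (fun x => \sum_(i <- s) c i * F i x) = \sum_(i <- s) c i * B u (F i).
Proof.
elim: s => [|i s IH] h.
  by under eq_fun do rewrite big_nil; rewrite big_nil goodB0r.
under eq_fun do rewrite big_cons; rewrite big_cons.
have gi : good (F i) by apply: h; rewrite mem_head.
have gs j : j \in s -> good (F j) by move=> js; apply: h; rewrite in_cons js orbT.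
by rewrite goodBDr ?goodBZr ?IH//; [exact: goodZ|exact: good_sum].
Qed.

Lemma goodB_suml v (I : eqType) (s : seq I) (F : I -> R -> R) (c : I -> R) :
  good v -> (forall i, i \in s -> good (F i)) ->
  B (fun x => \sum_(i <- s) c i * F i x) v = \sum_(i <- s) c i * B (F i) v.
Proof.
move=> gv; elim: s => [|i s IH] h.
  under eq_fun do rewrite big_nil; rewrite big_nil; apply: bder_cstl.
  exact: good_BV.
under eq_fun do rewrite big_cons; rewrite big_cons.
have gi : good (F i) by apply: h; rewrite mem_head.
have gs j : j \in s -> good (F j) by move=> js; apply: h; rewrite in_cons js orbT.
by rewrite goodBDl ?goodBZl ?IH//; [exact: goodZ|exact: good_sum].
Qed.

Lemma countable_avoid (a b : R) (E : set R) : a < b -> countable E ->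
  exists x, a < x < b /\ ~ E x.
Proof.
move=> ab cE; apply: contrapT => /forallNP h.
have sub : `]a, b[%classic `<=` E.
  move=> x /=; rewrite in_itv/= => xab; apply: contrapT => Ex; exact: (h x).
have c2 : countable (`]a, b[%classic : set R).
  by apply: sub_countable cE; exact: subset_card_le.
have := countable_lebesgue_measure0 c2; rewrite lebesgue_measure_itv/= lte_fin ab.
by move=> /eqP; rewrite -EFinD eqe subr_eq0 gt_eqF.
Qed.

(** A nonzero value is never isolated: at [w] and [- w] by continuity, and inside because [f x] is a
    limit of averages of [f (x + e)] and [f (x - e)], which then cannot both vanish. *)
Lemma near_support f (E : set R) x (eta : R) : good f -> countable E ->
  - w <= x <= w -> f x != 0 -> 0 < eta ->
  exists y, [/\ `|y - x| < eta, - w < y < w, ~ E y & f y != 0].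
Proof.
move=> [[_ af] cw cw'] cE xw fx0 eta0.
have fx : 0 < `|f x| by rewrite normr_gt0.
have nz y : `|f y - f x| < `|f x| -> f y != 0.
  by apply: contraTneq => ->; rewrite sub0r normrN ltxx.
have [xE|xnw] := eqVneq x w.
  have [d d0 h] := (continuous_atP f x).1 (eq_ind_r (fun z => {for z, continuous f}) cw xE) _ fx.
  pose m := Num.min (Num.min d eta) (2 * w).
  have m0 : 0 < m by rewrite !lt_min d0 eta0 mulr_gt0.
  have [y [/andP[y1 y2] Ey]] := @countable_avoid (x - m) x E (ltac:(lra)) cE.
  have dist : `|y - x| < m by rewrite ltr_norml; apply/andP; split; lra.
  move: (dist); rewrite !lt_min => /andP[/andP[dd de] dw].
  exists y; split => //; last exact/nz/h.
  by move: dw; rewrite ltr_norml => /andP[? ?]; apply/andP; split; lra.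
have [xE|xnw'] := eqVneq x (- w).
  have [d d0 h] := (continuous_atP f x).1 (eq_ind_r (fun z => {for z, continuous f}) cw' xE) _ fx.
  pose m := Num.min (Num.min d eta) (2 * w).
  have m0 : 0 < m by rewrite !lt_min d0 eta0 mulr_gt0.
  have [y [/andP[y1 y2] Ey]] := @countable_avoid x (x + m) E (ltac:(lra)) cE.
  have dist : `|y - x| < m by rewrite ltr_norml; apply/andP; split; lra.
  move: (dist); rewrite !lt_min => /andP[/andP[dd de] dw].
  exists y; split => //; last exact/nz/h.
  by move: dw; rewrite ltr_norml => /andP[? ?]; apply/andP; split; lra.
have [d d0 h] := (avg_atP f x).1 (af x) _ fx.
have xlt : x < w by case/andP: xw => _; rewrite le_eqVlt (negbTE xnw).
have xgt : - w < x by case/andP: xw; rewrite le_eqVlt eq_sym (negbTE xnw').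
pose m := Num.min (Num.min d eta) (Num.min (w - x) (x + w)).
have m0 : 0 < m by rewrite !lt_min d0 eta0/=; apply/andP; split; lra.
(* The offsets [e] for which [x + e] or [x - e] would fall into [E]. *)
pose E' := (fun y => y - x) @` E `|` (fun y => x - y) @` E.
have cE' : countable E'.
  rewrite /E' -bigcup2E; apply: bigcup_countable => // -[|[|n]] _ /=.
  - by apply: sub_countable cE; exact: card_image_le.
  - by apply: sub_countable cE; exact: card_image_le.
  - exact: countable0.
have [e [/andP[e0 em] Ee]] := countable_avoid m0 cE'.
move: em; rewrite !lt_min => /andP[/andP[ed eeta] /andP[ew1 ew2]].
have [f1|f1] := eqVneq (f (x + e)) 0; last first.
  exists (x + e); split => //.
  - by rewrite addrAC subrr add0r gtr0_norm.
  - by apply/andP; split; lra.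
  - by move=> Exe; apply: Ee; left; exists (x + e) => //; rewrite addrAC subrr add0r.
exists (x - e); split => //.
- by rewrite addrAC subrr add0r normrN gtr0_norm.
- by apply/andP; split; lra.
- by move=> Exe; apply: Ee; right; exists (x - e) => //; rewrite opprB addrCA subrr addr0.
- apply: contraTneq (h e (introT andP (conj e0 ed))) => f2.
  by rewrite f1 f2 addr0 mul0r sub0r normrN ltxx.
Qed.

Lemma good_eq0 f (E : set R) : good f -> countable E ->
  (forall y, - w < y < w -> ~ E y -> f y = 0) -> forall x, - w <= x <= w -> f x = 0.
Proof.
move=> gf cE h x xw; apply/eqP/negPn/negP => fx.
have [y [_ yw Ey /negP]] := near_support gf cE xw fx ltr01.
by rewrite h.
Qed.

End GoodFunctions.

Section FiniteFamilies.
Variable R : realType.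

Lemma eventually_all (I : eqType) (s : seq I) (P : I -> R -> Prop) :
  (forall i, i \in s -> exists2 d, 0 < d & forall e, 0 < e < d -> P i e) ->
  exists2 d, 0 < d & forall i, i \in s -> forall e, 0 < e < d -> P i e.
Proof.
elim: s => [|i s IH] h; first by exists 1.
have [d d0 hd] := h i (mem_head _ _).
have [|d' d'0 hd'] := IH.
  by move=> j js; apply: h; rewrite in_cons js orbT.
exists (Num.min d d'); first by rewrite lt_min d0.
move=> j jis e /andP[e0]; rewrite lt_min => /andP[e1 e2].
move: jis; rewrite in_cons => /predU1P[->|js].
  by apply: hd; rewrite e0.
by apply: hd' => //; rewrite e0.
Qed.

End FiniteFamilies.

Section LeftVanishing.
Variable R : realType.

Definition left_vanishing (r : R) (f : R -> R) := forall eta, 0 < eta ->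
  exists2 d, 0 < d & forall x, r - d < x < r -> `|f x| < eta.

Lemma left_vanishing_lin r : lin_closed (left_vanishing r).
Proof.
split.
  by move=> eta e0; exists 1 => // x _; rewrite normr0.
move=> c f g hf hg eta e0.
have [d d0 hd] := hf _ (divr_gt0 e0 (ltr0n _ 2)).
have c0 : 0 < 2 * (`|c| + 1) by rewrite mulr_gt0// ltr_wpDl.
have [d' d'0 hd'] := hg _ (divr_gt0 e0 c0).
exists (Num.min d d'); first by rewrite lt_min d0.
move=> x /andP[x1 x2].
have xd : r - d < x by move: x1; rewrite ltrBlDr -ltrBlDl lt_min => /andP[? ?]; lra.
have xd' : r - d' < x by move: x1; rewrite ltrBlDr -ltrBlDl lt_min => /andP[? ?]; lra.
have k1 := hd x (introT andP (conj xd x2)).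
have k2 := hd' x (introT andP (conj xd' x2)).
apply: le_lt_trans (ler_normD _ _) _; rewrite normrM.
have k3 : `|c| * `|g x| <= eta / 2.
  apply: (@le_trans _ _ ((`|c| + 1) * (eta / (2 * (`|c| + 1))))).
    by apply: ler_pM => //; [rewrite lerDl|exact: ltW].
  by rewrite le_eqVlt; apply/orP; left; apply/eqP; field; rewrite gt_eqF// ltr_wpDl.
lra.
Qed.

Lemma continuous_on_lin (D : set R) :
  lin_closed [set f | forall x, D x -> {for x, continuous f}].
Proof.
split; first by move=> x _; exact: cst_continuous.
move=> c f g hf hg x Dx.
apply: (@continuousD _ _ _ f (fun x => c * g x)); first exact: hf.
by apply: (@continuousM _ _ (fun=> c) g); [exact: cst_continuous|exact: hg].
Qed.

Lemma lin_closedI (L M : set (R -> R)) : lin_closed L -> lin_closed M ->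
  lin_closed (L `&` M).
Proof.
by move=> [L0 LD] [M0 MD]; split=> // c f g [? ?] [? ?]; split; [exact: LD|exact: MD].
Qed.

Lemma spanned_lin (s : seq R) (e : R -> R -> R) :
  lin_closed [set g | forall x, g x = \sum_(a <- s) g a * e a x].
Proof.
split=> [x|c f g /= hf hg x].
  by rewrite big1// => a _; rewrite mul0r.
rewrite hf hg mulr_sumr -big_split/=; apply: eq_bigr => a _.
by rewrite mulrDl mulrA.
Qed.

End LeftVanishing.

Definition disc (R : realType) (ws : seq (R -> R)) :=
  [set x | exists2 f, f \in ws & ~ {for x, continuous f}].

Lemma disc_countable (R : realType) (ws : seq (R -> R)) :
  (forall f, f \in ws -> locally_BV f) -> countable (disc ws).
Proof.
move=> bws.
have -> : disc ws = \bigcup_(f in [set` ws]) [set x | ~ {for x, continuous f}].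
  by apply/seteqP; split => x [f fw /= xk]; exists f.
apply: bigcup_countable; first exact/finite_set_countable/finite_seq.
by move=> f /bws; exact: locally_BV_discontinuity_countable.
Qed.

(** * Cut functions, nested steps and the kernel on a partition *)

Section Pieces.
Variable R : realType.
Variable w : R.
Hypothesis w0 : 0 < w.
Variables (N : nat) (beta : nat -> R).
Hypothesis N0 : (0 < N)%N.
Hypothesis beta0 : beta 0%N = - w.
Hypothesis betaN : beta N = w.
Hypothesis beta_lt : forall k, (k < N)%N -> beta k < beta k.+1.
Notation B := (bder w).

Lemma beta_mono i j : (i < j)%N -> (j <= N)%N -> beta i < beta j.
Proof.
move=> ij; elim: j ij => // j IH; rewrite ltnS leq_eqVlt => /predU1P[->|ij] jN.
  exact: beta_lt.
by apply: lt_trans (IH ij (ltnW jN)) _; exact: beta_lt.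
Qed.

Lemma beta_le i j : (i <= j)%N -> (j <= N)%N -> beta i <= beta j.
Proof.
by rewrite leq_eqVlt => /predU1P[->//|ij] jN; apply/ltW/beta_mono.
Qed.

Definition piece k x := (k < N)%N /\ beta k < x < beta k.+1.

Lemma piece_uniq j k x : piece j x -> piece k x -> j = k.
Proof.
wlog jk : j k / (j <= k)%N => [hw pj pk|[jN /andP[j1 j2]] [kN /andP[k1 k2]]].
  by case: (leqP j k) => [/hw|/ltnW/hw h]; [exact|apply/esym/h].
move: jk; rewrite leq_eqVlt => /predU1P[//|jk].
by have := beta_le jk (ltnW kN); rewrite leNgt (lt_trans k1 j2).
Qed.

Lemma piece_itv k x : piece k x -> - w < x < w.
Proof.
move=> [kN /andP[k1 k2]]; have := beta_le (leq0n k) (ltnW kN).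
by have := beta_le kN (leqnn N); rewrite beta0 betaN => *; apply/andP; split; lra.
Qed.

Lemma good_hside_itv p : - w < p < w -> good w (hside p).
Proof.
by move=> /andP[? ?]; apply: good_hside; [rewrite lt_eqF|rewrite gt_eqF].
Qed.

Lemma piece_exists x : - w < x < w -> (forall k, (0 < k < N)%N -> x <> beta k) ->
  exists k, piece k x.
Proof.
move=> /andP[wx xw] h.
have [k kP kmin] := @ex_minnP (fun k => x < beta k) (ex_intro _ N (eq_ind_r (fun z => x < z) xw betaN)).
have kN : (k <= N)%N by apply: kmin; rewrite betaN.
case: k kP kmin kN => [|k] kP kmin kN; first by move: kP; rewrite beta0; lra.
exists k; split => //; rewrite kP andbT lt_neqAle; apply/andP; split; last first.
  by rewrite leNgt; apply/negP => /kmin; rewrite ltnn.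
case: k kP kmin kN => [|k] kP kmin kN; first by rewrite beta0 lt_eqF.
by apply/eqP => E; apply: (h k.+1) => //; rewrite kN.
Qed.

Definition kap (x : R) : nat := xget 0%N [set k | piece k x].

Lemma kapE k x : piece k x -> kap x = k.
Proof.
by move=> pk; apply: (piece_uniq _ pk); exact: (@xgetPex _ 0%N [set k | piece k x] (ex_intro _ k pk)).
Qed.

Definition breaks := [set x | exists2 k, (0 < k < N)%N & x = beta k].

Lemma breaks_countable : countable breaks.
Proof.
have -> : breaks = \bigcup_(k in [set k | (0 < k < N)%N]) [set beta k].
  by apply/seteqP; split => x [k kN /= xk]; exists k.
by apply: bigcup_countable => // k _; apply: finite_set_countable; exact: finite_set1.
Qed.

(** There is no jump at either end: the first function is the constant 1 and the last one is 0. The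
    differences [chi_] therefore sum to 1 on the whole line and are continuous at [w] and [- w]. *)
Definition Hb k : R -> R :=
  if k == 0%N then fun=> 1 else if (k < N)%N then hside (beta k) else fun=> 0.

Lemma good_Hb k : good w (Hb k).
Proof.
rewrite /Hb; case: eqVneq => [_|k0]; first exact: good_cst.
case: ifP => kN; last exact: good_cst.
apply: good_hside.
  by rewrite -betaN lt_eqF// beta_mono.
by rewrite -beta0 gt_eqF// beta_mono ?lt0n// ltnW.
Qed.

Lemma bder_Hbr u k : good w u -> (k <= N)%N -> B u (Hb k) = u w - u (beta k).
Proof.
move=> gu kN; have [eu cu cu'] := gu; rewrite /Hb; case: eqVneq => [->|k0].
  by rewrite beta0 (bder_oner w0 (good_BV gu) cu cu').
case: ltnP => kN'; last first.
  have -> : k = N by apply/eqP; rewrite eqn_leq kN.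
  by rewrite betaN subrr goodB0r.
apply: bder_hsider => //; apply/andP; split.
  by rewrite -beta0 beta_mono ?lt0n// ltnW.
by rewrite -betaN beta_mono.
Qed.

Lemma Hb_in k j x : piece j x -> (k <= N)%N -> Hb k x = (k <= j)%:R.
Proof.
move=> [jN /andP[j1 j2]] kN; rewrite /Hb; case: eqVneq => [->//|k0].
case: (ltnP k N) => kN'; last first.
  by rewrite leqNgt (leq_trans jN kN').
case: leqP => kj.
  rewrite hside_gt//; apply: le_lt_trans j1; exact: beta_le (ltnW jN).
rewrite hside_lt//; apply: lt_le_trans j2 _; exact: beta_le.
Qed.

Definition chi_ k (x : R) : R := Hb k x - Hb k.+1 x.

Lemma good_chi_ k : good w (chi_ k).
Proof. by apply: goodB; exact: good_Hb. Qed.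

Lemma chi__in k j x : piece j x -> (k < N)%N -> chi_ k x = (k == j)%:R.
Proof.
move=> pj kN; rewrite /chi_ !(Hb_in pj)//; last exact: ltnW.
by case: ltngtP => //= _; rewrite ?subr0 ?subrr.
Qed.

Lemma bder_chi_r u k : good w u -> (k < N)%N ->
  B u (chi_ k) = u (beta k.+1) - u (beta k).
Proof.
move=> gu kN; have -> : chi_ k = fun x => Hb k x + (-1) * Hb k.+1 x.
  by apply/funext => x; rewrite mulN1r.
rewrite goodBDr ?goodBZr//; try exact: good_Hb; last by apply: goodZ; exact: good_Hb.
rewrite !bder_Hbr//; [lra|exact: ltnW].
Qed.

Lemma sum_chi_ x : \sum_(k < N) chi_ k x = 1.
Proof.
rewrite -(big_mkord xpredT (fun k => chi_ k x)).
rewrite (eq_bigr (fun k => (fun j => - Hb j x) k.+1 - (fun j => - Hb j x) k)); last first.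
  by move=> k _; rewrite /chi_ opprK addrC.
rewrite telescope_sumr// /Hb eqxx ltnn opprK.
by case: eqVneq N0 => [->//|_ _]; rewrite oppr0 add0r.
Qed.

Lemma chi__clamp k x : chi_ k (clamp w x) = chi_ k x.
Proof.
have Hc j : Hb j (clamp w x) = Hb j x.
  rewrite /Hb; case: eqVneq => // j0; case: ltnP => // jN.
  have b1 : - w < beta j by rewrite -beta0 beta_mono ?lt0n// ltnW.
  have b2 : beta j < w by rewrite -betaN beta_mono.
  have [xw|wx] := ltP x (- w).
    rewrite clamp_le ?(ltW w0) ?(ltW xw)// !hside_lt//; lra.
  have [xw|xw] := leP x w; first by rewrite clamp_id// wx.
  rewrite clamp_ge ?(ltW w0) ?(ltW xw)// !hside_gt//; lra.
by rewrite /chi_ !Hc.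
Qed.

Lemma chi__continuous k x : x <> beta k \/ k = 0%N -> x <> beta k.+1 \/ (N <= k.+1)%N ->
  {for x, continuous (chi_ k)}.
Proof.
have c j : x <> beta j \/ (j = 0%N \/ (N <= j)%N) -> {for x, continuous (Hb j)}.
  rewrite /Hb; case: eqVneq => [_ _|j0]; first exact: cst_continuous.
  case: ltnP => jN; last by move=> _; exact: cst_continuous.
  move=> [xb|[E|E]]; [by apply: hside_continuous; apply/eqP|by rewrite E in j0|lia].
move=> h1 h2; apply: continuousB; apply: c.
  by case: h1; [left|right; left].
by case: h2; [left|right; right].
Qed.

(** Vanishing is required on the other open pieces only: at a breakpoint an epilogic function may
    keep half of its jump, as [chi_] does. *)
Definition on_piece k (f : R -> R) := [/\ good w f, forall x, f (clamp w x) = f x &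
  forall j x, piece j x -> j <> k -> f x = 0].

Lemma on_piece_lin k : lin_closed (on_piece k).
Proof.
split; first by split=> //; exact: good_cst.
move=> c f g [gf cf pf] [gg cg pg]; split; first exact: (good_lin w).2.
  by move=> x; rewrite cf cg.
by move=> j x pj jk; rewrite (pf _ _ pj jk) (pg _ _ pj jk) mulr0 addr0.
Qed.

Lemma on_piece_chi_ k : (k < N)%N -> on_piece k (chi_ k).
Proof.
move=> kN; split; [exact: good_chi_|exact: chi__clamp|].
by move=> j x pj jk; rewrite (chi__in pj kN); case: eqVneq => // E; case: jk.
Qed.

Lemma on_piece_kap k f x j : on_piece k f -> piece j x -> f x != 0 -> kap x = k.
Proof.
move=> [_ _ h] pj fx; rewrite (kapE pj).
by apply: contrapT => jk; move: fx; rewrite (h _ _ pj jk) eqxx.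
Qed.

(** The freedom in [E] allows interpolation nodes to be confined to points of continuity: vanishing
    off a countable set already forces such a function to be zero. *)
Lemma on_piece_eq0 k f (E : set R) : countable E -> on_piece k f ->
  (forall x, (exists j, piece j x) -> ~ E x -> f x = 0) -> forall x, f x = 0.
Proof.
move=> cE [gf cf _] h x; rewrite -cf.
apply: (@good_eq0 _ w w0 f (E `|` breaks)) => //.
- rewrite -bigcup2E; apply: bigcup_countable => // -[|[|n]] _ /=.
  + exact: cE.
  + exact: breaks_countable.
  + exact: countable0.
- move=> y yw /not_orP[Ey By]; apply: h => //; apply: piece_exists => //.
  by move=> i iN yi; apply: By; exists i.
- by apply: clamp_itv; exact: ltW.
Qed.

Lemma on_piece_local k f eps x a : on_piece k f -> piece k a ->
  beta k.+1 - beta k <= eps -> - w <= x <= w -> f x != 0 -> `|x - a| <= eps.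
Proof.
move=> [gf _ h] pa be xw fx; apply/ler_addgt0Pr => e e0.
have [y [yx yw By fy]] := near_support w0 gf breaks_countable xw fx e0.
have [|j pj] := piece_exists yw.
  by move=> i iN yi; apply: By; exists i.
have jk : j = k by apply: contrapT => jk; move: fy; rewrite (h _ _ pj jk) eqxx.
case: pj => _ /andP[]; rewrite jk => y1 y2; case: pa => _ /andP[a1 a2].
rewrite (_ : x - a = (y - a) - (y - x)); last by ring.
apply: le_trans (ler_normB _ _) _; rewrite lerD ?(ltW yx)//.
by rewrite ler_norml; apply/andP; split; lra.
Qed.

Variable ws : seq (R -> R).
Hypothesis ws_good : forall f, f \in ws -> good w f.
Hypothesis ws_beta : forall f k, f \in ws -> (0 < k < N)%N -> {for beta k, continuous f}.

Lemma ws_disc_countable : countable (disc ws).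
Proof. by apply: disc_countable => f /ws_good/good_BV. Qed.

(** Subtracting the value at the right end costs nothing, as [chi_ k] also belongs to the space, and
    makes the left limit at [beta k.+1] zero. Small values near that end are what the nested steps
    exploit. *)
Definition wcut k (f : R -> R) (x : R) := (f (clamp w x) - f (beta k.+1)) * chi_ k x.

Lemma piece_not_break k x i : piece k x -> (i <= N)%N -> x <> beta i.
Proof.
move=> [kN /andP[k1 k2]] iN E; subst x.
have [ik|ki] := leqP i k.
  by have := beta_le ik (ltnW kN); rewrite leNgt k1.
by have := beta_le ki iN; rewrite leNgt k2.
Qed.

Lemma piece_chi__continuous k j x : (k < N)%N -> piece j x -> {for x, continuous (chi_ k)}.
Proof.
move=> kN px; apply: chi__continuous; left; apply: (piece_not_break px) => //.
exact: ltnW.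
Qed.

Definition cutspace k := on_piece k `&` left_vanishing (beta k.+1) `&`
  [set f | forall x, ((exists j, piece j x) /\ ~ disc ws x) -> {for x, continuous f}].

Lemma cutspace_lin k : lin_closed (cutspace k).
Proof.
apply: lin_closedI; last exact: continuous_on_lin.
by apply: lin_closedI; [exact: on_piece_lin|exact: left_vanishing_lin].
Qed.

Lemma clamp_in x : - w < x < w -> clamp w x = x.
Proof. by move=> /andP[? ?]; rewrite clamp_id// !ltW. Qed.

Lemma wcutP k f : (k < N)%N -> f \in ws -> cutspace k (wcut k f).
Proof.
move=> kN fw; have [ef cw cw'] := ws_good fw.
have eb : epilogic (f \o clamp w) by exact: epilogic_clamp.
have bp x : clamp w x = x -> {for x, continuous f} ->
    {for x, continuous (fun x => f (clamp w x) - f (beta k.+1))}.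
  move=> cx cf; apply: (@continuousB _ _ _ (f \o clamp w) (fun=> f (beta k.+1))).
    by apply: clamp_continuous; rewrite cx.
  exact: cst_continuous.
have ww : - w <= w by rewrite (le_trans _ (ltW w0))// oppr_le0 ltW.
have cw1 : clamp w w = w by rewrite clamp_id// lexx andbT.
have cw2 : clamp w (- w) = - w by rewrite clamp_id// lexx.
have bb i : (i <= N)%N -> clamp w (beta i) = beta i /\ {for beta i, continuous f}.
  move=> iN; have [->|i0] := posnP i; first by rewrite beta0.
  move: iN; rewrite leq_eqVlt => /predU1P[->|iN]; first by rewrite betaN.
  split; last by apply: ws_beta => //; rewrite i0.
  apply: clamp_in; rewrite -beta0 -betaN.
  by rewrite !beta_mono// ltnW.
have gchi := good_chi_ k.
split; [split|].
- split.
  + split.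
    * apply: epilogicM; first by apply: epilogicB => //; exact: epilogic_cst.
        by case: gchi.
      (* At the two breakpoints the first factor is continuous by the choice of [beta]; everywhere
         else [chi_ k] is. *)
      move=> x; have [E1|x1] := pselect (x = beta k).
        by left; rewrite E1; apply: bp; [case: (bb k (ltnW kN))..].
      have [E2|x2] := pselect (x = beta k.+1).
        by left; rewrite E2; apply: bp; [case: (bb k.+1 kN)..].
      by right; apply: chi__continuous; left.
    * apply: (@continuousM _ _ (fun x => f (clamp w x) - f (beta k.+1)) (chi_ k)).
        exact: bp.
      by case: gchi.
    * apply: (@continuousM _ _ (fun x => f (clamp w x) - f (beta k.+1)) (chi_ k)).
        exact: bp.
      by case: gchi.
  + move=> x; rewrite /wcut chi__clamp.
    by rewrite (clamp_id (clamp_itv _ (ltW w0))).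
  + move=> j x pj jk; rewrite /wcut (chi__in pj kN).
    by case: eqVneq => [E|]; [case: jk|rewrite mulr0].
- move=> eta e0; have [d d0 hd] := (continuous_atP _ _).1 (bp _ (bb _ kN).1 (bb _ kN).2) _ e0.
  exists (Num.min d (beta k.+1 - beta k)).
    by rewrite lt_min d0 subr_gt0 beta_lt.
  move=> x /andP[x1 x2]; move: x1; rewrite ltrBlDr -ltrBlDl lt_min => /andP[y1 y2].
  have px : piece k x by split => //; rewrite x2 andbT; lra.
  rewrite /wcut (chi__in px kN) eqxx mulr1.
  have := hd x; rewrite (bb _ kN).1 subrr subr0; apply.
  by rewrite ltr_norml; apply/andP; split; lra.
- move=> x [[j pj] nd].
  apply: (@continuousM _ _ (fun x => f (clamp w x) - f (beta k.+1)) (chi_ k)).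
    apply: bp; first exact/clamp_in/(piece_itv pj).
    by apply: contrapT => h; apply: nd; exists f.
  exact: piece_chi__continuous kN pj.
Qed.

Definition gens := [seq (k, wcut k f) | k <- iota 0 N, f <- ws].

Lemma nodal_cut : exists (s : seq R) (e : R -> R -> R),
  [/\ uniq s, forall a, a \in s -> exists j, piece j a,
      forall a, a \in s -> cutspace (kap a) (e a),
      forall a b, a \in s -> b \in s -> e a b = (a == b)%:R &
      forall f k, f \in ws -> (k < N)%N -> forall x,
        wcut k f x = \sum_(a <- s) wcut k f a * e a x].
Proof.
have [| | | |s [e [us sD sL nod sE]]] :=
    @nodal_basis R nat [set x | exists j, piece j x] kap cutspace gens.
- exact: cutspace_lin.
- by move=> k f x [[pf _] _] [j pj] fx; apply: (on_piece_kap pf pj).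
- move=> k f [[pf _] _] h; apply: (@on_piece_eq0 k f set0) => //.
  by move=> x jx _; exact: h.
- move=> i iN d; have /allpairsP[[k f] [/= kN fw ->]] := mem_nth d iN.
  by apply: wcutP => //; rewrite mem_iota in kN.
exists s, e; split => // f k fw kN x.
have /(nthP (0%N, fun=> 0))[i iN iE] : (k, wcut k f) \in gens.
  by apply/allpairsP; exists (k, f); rewrite mem_iota.
have := sE i iN (0%N, fun=> 0) x; by rewrite iE.
Qed.

(* For nodes t < t' of one piece the interval ]t', qpt t'[ lies inside ]t, qpt t[, which makes the step functions on these intervals isotropic. *)
Variable delta : R.
Hypothesis delta0 : 0 < delta.

Definition qpt (t : R) : R := beta (kap t).+1 - delta * (t + w).
Definition xstep (t x : R) : R := hside t x - hside (qpt t) x.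

Variable Theta : seq R.
Hypothesis Theta_piece : forall t, t \in Theta -> piece (kap t) t.
Hypothesis Theta_q : forall t, t \in Theta -> t < qpt t.

Lemma piece_qpt t : t \in Theta -> piece (kap t) (qpt t).
Proof.
move=> tT; have pt := Theta_piece tT; have /andP[wt tw] := piece_itv pt.
case: pt => kN /andP[k1 k2]; split => //; have qt := Theta_q tT.
rewrite (lt_trans k1 qt)/= /qpt gtrBl mulr_gt0//; lra.
Qed.

Lemma xstep_out t x : t \in Theta -> ~ (t <= x <= qpt t) -> xstep t x = 0.
Proof.
move=> tT h; have qt := Theta_q tT; rewrite /xstep.
have [xt|tx] := ltP x t; first by rewrite !hside_lt ?subrr// (lt_trans xt).
have qx : qpt t < x by rewrite ltNge; apply/negP => xq; apply: h; rewrite tx.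
by rewrite !hside_gt ?subrr//; lra.
Qed.

Lemma good_xstep t : t \in Theta -> good w (xstep t).
Proof.
move=> tT; apply: goodB; apply: good_hside_itv; apply: piece_itv.
  exact: Theta_piece.
exact: piece_qpt.
Qed.

Lemma on_piece_xstep t : t \in Theta -> on_piece (kap t) (xstep t).
Proof.
move=> tT; have pt := Theta_piece tT; have pq := piece_qpt tT.
have /andP[t1 t2] := piece_itv pt; have /andP[q1 q2] := piece_itv pq.
split; first exact: good_xstep.
  move=> x; have [xw|wx] := ltP x (- w).
    rewrite clamp_le ?(ltW w0) ?(ltW xw)// !xstep_out// => /andP[? ?]; lra.
  have [xw|xw] := leP x w; first by rewrite clamp_id// wx.
  rewrite clamp_ge ?(ltW w0) ?(ltW xw)// !xstep_out// => /andP[? ?]; lra.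
move=> j x pj jk; apply: xstep_out => // /andP[tx xq]; apply: jk.
apply: (piece_uniq pj); case: pt => kN /andP[? ?]; case: pq => _ /andP[? ?].
by split => //; apply/andP; split; lra.
Qed.

Lemma bder_xstepr u t : good w u -> t \in Theta -> B u (xstep t) = u (qpt t) - u t.
Proof.
move=> gu tT; have wt := piece_itv (Theta_piece tT); have wq := piece_itv (piece_qpt tT).
have [/andP[? ?] /andP[? ?]] := (wt, wq); have [eu cu _] := gu.
have g1 := good_hside_itv wt.
have g2 := good_hside_itv wq.
have -> : xstep t = fun x => hside t x + (-1) * hside (qpt t) x.
  by apply/funext => x; rewrite mulN1r.
rewrite goodBDr ?goodBZr//; last exact: goodZ.
by rewrite !bder_hsider//; lra.
Qed.

Lemma bder_xstepl v t : good w v -> t \in Theta -> B (xstep t) v = v t - v (qpt t).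
Proof.
move=> gv tT; have wt := piece_itv (Theta_piece tT); have wq := piece_itv (piece_qpt tT).
have [/andP[? ?] /andP[? ?]] := (wt, wq).
have g1 := good_hside_itv wt.
have g2 := good_hside_itv wq.
have -> : xstep t = fun x => hside t x + (-1) * hside (qpt t) x.
  by apply/funext => x; rewrite mulN1r.
rewrite goodBDl ?goodBZl//; last exact: goodZ.
by rewrite !bder_hsidel//; [lra|exact: good_BV gv..].
Qed.

(** By nesting, both ends of one interval lie inside the other or both lie outside; for equal
    intervals both values are 1/2. Through [bder_xstepr] this makes all pairings among the steps
    vanish. *)
Lemma xstep_isotropic t t' : t \in Theta -> t' \in Theta ->
  xstep t' (qpt t) = xstep t' t.
Proof.
move=> tT t'T; have qt := Theta_q tT; have qt' := Theta_q t'T.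
have [kk|kk] := eqVneq (kap t) (kap t'); last first.
  have [_ _ h] := on_piece_xstep t'T.
  rewrite (h _ _ (piece_qpt tT)) ?(h _ _ (Theta_piece tT))//; exact/eqP.
have qq : qpt t - qpt t' = delta * (t' - t).
  by rewrite /qpt kk; ring.
have [tt'|tt'|->] := ltgtP t t'.
- have : qpt t' < qpt t by rewrite -subr_gt0 qq mulr_gt0// subr_gt0.
  move=> qlt; rewrite !xstep_out//; last by move=> /andP[? ?]; lra.
  by move=> /andP[? ?]; lra.
- have : qpt t < qpt t'.
    by rewrite -subr_gt0 -opprB oppr_gt0 qq pmulr_rlt0// subr_lt0.
  move=> qlt; rewrite /xstep (hside_gt tt') (hside_lt qlt).
  by rewrite (hside_gt (lt_trans tt' qt)) (hside_lt (lt_trans qt qlt)).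
- rewrite /xstep (hside_gt qt') (hside_lt qt') !hside_eq; lra.
Qed.

Lemma sum_nodal (I : eqType) (s : seq I) (c : I -> R) j : uniq s -> j \in s ->
  \sum_(i <- s) c i * (i == j)%:R = c j.
Proof.
move=> us js; rewrite (bigD1_seq j)//= eqxx mulr1 big1 ?addr0// => i /negbTE ->.
by rewrite mulr0.
Qed.

Lemma xstep_beta t k : t \in Theta -> (k <= N)%N -> xstep t (beta k) = 0.
Proof.
move=> tT kN; have [jN /andP[t1 t2]] := Theta_piece tT.
have [_ /andP[q1 q2]] := piece_qpt tT; apply: xstep_out => //.
have [kj|jk] := leqP k (kap t).
  have h := beta_le kj (ltnW jN).
  by move=> /andP[tb _]; have := lt_le_trans t1 (le_trans tb h); rewrite ltxx.
have h := beta_le jk kN.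
by move=> /andP[_ bq]; have := lt_le_trans q2 (le_trans h bq); rewrite ltxx.
Qed.

Lemma Hb_beta0 j : (j <= N)%N -> Hb j (beta 0%N) = (j == 0%N)%:R.
Proof.
move=> jN; rewrite /Hb; case: (eqVneq j 0%N) => // j0.
by case: (ltnP j N) => // jN'; rewrite hside_lt// beta_mono// lt0n.
Qed.

Lemma Hb_beta j k : (j <= N)%N -> (0 < k < N)%N ->
  Hb j (beta k) = 2^-1 * ((j < k)%N%:R + (j <= k)%N%:R).
Proof.
move=> jN /andP[k0 kN]; rewrite /Hb; case: (eqVneq j 0%N) => [->|j0].
  by rewrite k0 /=; field.
case: (ltnP j N) => jN'; last first.
  have kj := leq_trans kN jN'.
  by rewrite (ltnNge j k) (ltnW kj) (leqNgt j k) kj/= addr0 mulr0.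
case: (ltngtP j k) => jk /=.
- by rewrite hside_gt ?beta_mono ?(ltnW kN)//; field.
- by rewrite hside_lt ?beta_mono ?(ltnW jN')//; ring.
- by rewrite jk hside_eq; ring.
Qed.

Lemma chi__beta j k : (j < N)%N -> (0 < k < N)%N ->
  chi_ j (beta k) = 2^-1 * ((j == k)%:R + (j.+1 == k)%:R).
Proof.
move=> jN kN; rewrite /chi_ !Hb_beta//; last exact: ltnW.
by do ![case: ltngtP => ? /=]; try lia; field.
Qed.

Lemma chi__beta0 j : (j < N)%N -> chi_ j (beta 0%N) = (j == 0%N)%:R.
Proof. by move=> jN; rewrite /chi_ !Hb_beta0 ?subr0// ltnW. Qed.

Variable f : R -> R -> R.
Hypothesis uTheta : uniq Theta.
Hypothesis f_cut : forall t, t \in Theta -> cutspace (kap t) (f t).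
Hypothesis f_nodal : forall t s, t \in Theta -> s \in Theta -> f t s = (t == s)%:R.
Hypothesis f_small : forall t s, t \in Theta -> s \in Theta ->
  `|f t (qpt s)| * (size Theta).+1%:R <= 2^-1.

Definition step_comb (c : nat -> R) (phi xi : R -> R) (x : R) :=
  \sum_(k <- iota 0 N) c k * chi_ k x + \sum_(t <- Theta) phi t * f t x +
  \sum_(t <- Theta) xi t * xstep t x.

Definition stepspace u := exists c phi xi, forall x, u x = step_comb c phi xi x.

Lemma stepspace_lin : lin_closed stepspace.
Proof.
split.
  exists (fun=> 0), (fun=> 0), (fun=> 0) => x; rewrite /step_comb.
  by rewrite !big1 ?addr0// => i _; rewrite mul0r.
move=> a u v [c [phi [xi hu]]] [c' [phi' [xi' hv]]].
exists (fun k => c k + a * c' k), (fun k => phi k + a * phi' k),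
  (fun k => xi k + a * xi' k) => x.
rewrite hu hv /step_comb !mulrDr !mulr_sumr.
rewrite (_ : forall p q r p' q' r' : R, p + q + r + (p' + q' + r') =
  (p + p') + (q + q') + (r + r')); last by move=> *; ring.
rewrite -!big_split/=.
by congr (_ + _ + _); apply: eq_bigr => i _; rewrite mulrDl mulrA.
Qed.

Lemma good_f t : t \in Theta -> good w (f t).
Proof. by case/f_cut => -[[]]. Qed.

Lemma good_stepspace u : stepspace u -> good w u.
Proof.
move=> [c [phi [xi hu]]].
have -> : u = step_comb c phi xi by exact/funext.
apply: goodD; [apply: goodD|]; apply: good_sum => i.
- by move=> _; exact: good_chi_.
- exact: good_f.
- exact: good_xstep.
Qed.

(** The system is triangular up to a contraction: testing against the steps isolates [phi], testing
    against [chi_] then determines [c], and testing against the cut functions finally determines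
    [xi]. *)
Lemma stepspace_kernel u : stepspace u ->
  (forall k, (k < N)%N -> B u (chi_ k) = 0) ->
  (forall t, t \in Theta -> B u (f t) = 0) ->
  (forall t, t \in Theta -> B u (xstep t) = 0) ->
  exists C, forall x, u x = C.
Proof.
move=> su; have gu := good_stepspace su; case: su => c [phi [xi hu]] h1 h2 h3.
(* Testing against [xstep s] compares [u] at [s] and at [qpt s]. The [chi_] and step terms agree at
   both points, which leaves [phi s] equal to the sum of the [phi t * f t (qpt s)], a
   contraction. *)
have phi0 : forall t, t \in Theta -> phi t = 0.
  apply: (@small_combination _ Theta phi (fun a b => f a (qpt b)) uTheta f_small).
  move=> s sT; have := h3 s sT; rewrite bder_xstepr// => /eqP; rewrite subr_eq0 => /eqP.
  rewrite !hu /step_comb.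
  have -> : \sum_(k <- iota 0 N) c k * chi_ k (qpt s) =
      \sum_(k <- iota 0 N) c k * chi_ k s.
    apply: eq_big_seq => k; rewrite mem_iota add0n => /= kN.
    by rewrite !(chi__in (piece_qpt sT), chi__in (Theta_piece sT)).
  have -> : \sum_(t <- Theta) xi t * xstep t (qpt s) =
      \sum_(t <- Theta) xi t * xstep t s.
    by apply: eq_big_seq => k kT; rewrite xstep_isotropic.
  move=> /addIr /addrI ->; rewrite -[LHS](sum_nodal phi uTheta sT).
  by apply: eq_big_seq => t tT; rewrite f_nodal.
have hu' x : u x = \sum_(k <- iota 0 N) c k * chi_ k x +
    \sum_(t <- Theta) xi t * xstep t x.
  rewrite hu /step_comb [X in _ + X + _]big_seq [X in _ + X + _]big1 ?addr0// => t tT.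
  by rewrite phi0 ?mul0r.
have ub k : (k < N)%N -> u (beta k.+1) = u (beta k).
  by move=> kN; apply/eqP; rewrite -subr_eq0 -bder_chi_r// h1.
(* Steps vanish at the breakpoints, so only the [chi_] part is seen there. *)
have ub' k : (k <= N)%N -> \sum_(j <- iota 0 N) c j * chi_ j (beta k) = u (beta k).
  move=> kN; rewrite hu' [X in _ = _ + X]big_seq [X in _ = _ + X]big1 ?addr0//.
  by move=> t tT; rewrite xstep_beta ?mulr0.
have uN : uniq (iota 0 N) by exact: iota_uniq.
have c0 : c 0%N = u (beta 0%N).
  have i0 : 0%N \in iota 0 N by rewrite mem_iota.
  rewrite -ub'// -[LHS](sum_nodal c uN i0); apply: eq_big_seq => j.
  by rewrite mem_iota add0n => /= jN; rewrite chi__beta0.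
have uc k : (k <= N)%N -> u (beta k) = c 0%N.
  by elim: k => [//|k IH kN]; rewrite ub// IH// ltnW.
(* At an inner breakpoint one sees the mean of two adjacent coefficients, which alone would allow
   oscillation around a constant; the value [c 0] read off at the left end excludes it. *)
have cc k : (k < N)%N -> c k = c 0%N.
  elim: k => // k IH kN; have := ub' k.+1 (ltnW kN); rewrite uc ?(ltnW kN)//.
  have -> : \sum_(j <- iota 0 N) c j * chi_ j (beta k.+1) =
      2^-1 * (c k.+1 + c k).
    have i1 : k.+1 \in iota 0 N by rewrite mem_iota.
    have i2 : k \in iota 0 N by rewrite mem_iota add0n /= ltnW.
    rewrite -[c k.+1 in RHS](sum_nodal c uN i1) -[c k in RHS](sum_nodal c uN i2).
    rewrite -big_split mulr_sumr; apply: eq_big_seq => j.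
    by rewrite mem_iota add0n => /= jN; rewrite chi__beta// eqSS; ring.
  by rewrite (IH (ltnW kN)) => ?; lra.
have hu2 x : u x = c 0%N + \sum_(t <- Theta) xi t * xstep t x.
  rewrite hu'; congr (_ + _); rewrite -[RHS]mulr1 -(sum_chi_ x) mulr_sumr.
  rewrite -(big_mkord xpredT (fun k => c 0%N * chi_ k x)) /index_iota subn0.
  by apply: eq_big_seq => j; rewrite mem_iota add0n => /= jN; rewrite cc.
(* Now [u] is a constant plus steps. Testing against [f s] gives the transposed contraction, with
   [f s (qpt t)] in place of [f t (qpt s)]. *)
have xi0 : forall t, t \in Theta -> xi t = 0.
  apply: (@small_combination _ Theta xi (fun a b => f b (qpt a)) uTheta).
    by move=> a b aT bT; exact: f_small.
  move=> s sT; have := h2 s sT.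
  have -> : u = fun x => c 0%N + \sum_(t <- Theta) xi t * xstep t x by exact/funext.
  rewrite (@goodBDl _ w (fun=> c 0%N)); [|exact: good_cst| |exact: good_f]; last first.
    by apply: good_sum => t; exact: good_xstep.
  rewrite bder_cstl ?add0r; last exact: good_BV (good_f sT).
  rewrite goodB_suml; [|exact: good_f|exact: good_xstep].
  rewrite (eq_big_seq (fun t => xi t * (t == s)%:R - xi t * f s (qpt t))); last first.
    move=> t tT; rewrite bder_xstepl//; last exact: good_f.
    by rewrite f_nodal// eq_sym mulrBr.
  rewrite sumrB sum_nodal// => /eqP; rewrite subr_eq0 => /eqP ->.
  by [].
exists (c 0%N) => x; rewrite hu2 big_seq big1 ?addr0// => t tT.
by rewrite xi0 ?mul0r.
Qed.

(** All functions of the span are continuous at the admissible nodes, which the quadrature needs in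
    order to control nodal functions near the nodes. *)
Definition grid_dom := [set x | (exists j, piece j x) /\
  ~ (disc ws `|` [set` Theta] `|` qpt @` [set` Theta]) x].

Definition gridspace k :=
  stepspace `&` on_piece k `&` [set g | forall x, grid_dom x -> {for x, continuous g}].

Definition gens2 := [seq (k, chi_ k) | k <- iota 0 N] ++
  [seq (kap t, f t) | t <- Theta] ++ [seq (kap t, xstep t) | t <- Theta].

Lemma step_comb_chi k : (k < N)%N -> stepspace (chi_ k).
Proof.
move=> kN; exists (fun j => (j == k)%:R), (fun=> 0), (fun=> 0) => x; rewrite /step_comb.
rewrite [X in _ + X + _]big1 ?addr0; last by move=> i _; rewrite mul0r.
rewrite [X in _ + X]big1 ?addr0; last by move=> i _; rewrite mul0r.
under eq_bigr do rewrite mulrC; rewrite sum_nodal ?iota_uniq//.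
by rewrite mem_iota.
Qed.

Lemma step_comb_f t : t \in Theta -> stepspace (f t).
Proof.
move=> tT; exists (fun=> 0), (fun j => (j == t)%:R), (fun=> 0) => x; rewrite /step_comb.
rewrite [X in X + _ + _]big1 ?add0r; last by move=> i _; rewrite mul0r.
rewrite [X in _ + X]big1 ?addr0; last by move=> i _; rewrite mul0r.
by under eq_bigr do rewrite mulrC; rewrite (sum_nodal (fun t => f t x)).
Qed.

Lemma step_comb_xstep t : t \in Theta -> stepspace (xstep t).
Proof.
move=> tT; exists (fun=> 0), (fun=> 0), (fun j => (j == t)%:R) => x; rewrite /step_comb.
rewrite [X in X + _ + _]big1 ?add0r; last by move=> i _; rewrite mul0r.
rewrite [X in X + _]big1 ?add0r; last by move=> i _; rewrite mul0r.
by under eq_bigr do rewrite mulrC; rewrite (sum_nodal (fun t => xstep t x)).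
Qed.

Lemma gens2P k g : (k, g) \in gens2 -> gridspace k g.
Proof.
rewrite !mem_cat => /or3P[] /mapP[t tT [-> ->]].
- move: tT; rewrite mem_iota => /= tN; split.
    by split; [exact: step_comb_chi|exact: on_piece_chi_].
  by move=> x [[j pj] _]; exact: piece_chi__continuous pj.
- have [[? _] hc] := f_cut tT; split; first by split=> //; exact: step_comb_f.
  by move=> x [xp nd]; apply: hc; split=> // d; apply: nd; left; left.
- split; first by split; [exact: step_comb_xstep|exact: on_piece_xstep].
  move=> x [_ nd]; apply: continuousB; apply: hside_continuous; apply/eqP => E; apply: nd.
    by left; right; rewrite /= E.
  by right; exists t.
Qed.

Lemma grid_excluded_countable :
  countable (disc ws `|` [set` Theta] `|` qpt @` [set` Theta]).
Proof.
have cT : countable [set` Theta] by exact/finite_set_countable/finite_seq.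
rewrite -!bigcup2E; apply: bigcup_countable => // -[|[|n]] _ /=.
- apply: bigcup_countable => // -[|[|n]] _ /=.
  + exact: ws_disc_countable.
  + exact: cT.
  + exact: countable0.
- by apply: sub_countable cT; exact: card_image_le.
- exact: countable0.
Qed.

(** A second interpolation: the nodes [Theta] of the first one only served to define the steps, and
    the enlarged family [gens2] now gets nodes of its own at points of continuity. *)
Lemma nodal_grid eps : (forall k, (k < N)%N -> beta k.+1 - beta k <= eps) ->
  (forall g k, g \in ws -> (k < N)%N -> forall x,
    wcut k g x = \sum_(a <- Theta) wcut k g a * f a x) ->
  exists (s : seq R) (e : R -> R -> R),
  [/\ uniq s /\ (forall a, a \in s -> - w < a < w),
      forall a, a \in s -> good w (e a) /\ forall b, b \in s ->
        {for b, continuous (e a)} /\ e a b = (a == b)%:R,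
      forall a x, a \in s -> - w <= x <= w -> e a x != 0 -> `|x - a| <= eps,
      (forall g x, g \in ws -> g (clamp w x) = \sum_(a <- s) g (clamp w a) * e a x) /\
      (forall x, 1 = \sum_(a <- s) e a x) &
      forall c, (forall b, b \in s -> B (fun x => \sum_(a <- s) c a * e a x) (e b) = 0) ->
        exists C, forall a, a \in s -> c a = C].
Proof.
move=> heps hws.
have [| | | |s [e [us sD sL nod sE]]] :=
    @nodal_basis R nat grid_dom kap gridspace gens2.
- move=> k; apply: lin_closedI; last exact: continuous_on_lin.
  by apply: lin_closedI; [exact: stepspace_lin|exact: on_piece_lin].
- by move=> k g x [[_ pg] _] [[j pj] _] gx; exact: (on_piece_kap pg pj).
- move=> k g [[_ pg] _] h; apply: (on_piece_eq0 grid_excluded_countable pg) => x jx Ex.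
  exact: h.
- move=> i iN d; apply: gens2P; rewrite -surjective_pairing; exact: mem_nth.
have spn k g : (k, g) \in gens2 -> forall x, g x = \sum_(a <- s) g a * e a x.
  move=> /(nthP (0%N, fun=> 0))[i iN iE] x.
  by have := sE i iN (0%N, fun=> 0) x; rewrite iE.
have spchi k : (k < N)%N -> forall x, chi_ k x = \sum_(a <- s) chi_ k a * e a x.
  move=> kN; apply: (spn k); rewrite mem_cat; apply/orP; left.
  by apply/mapP; exists k => //; rewrite mem_iota.
have spf t : t \in Theta -> forall x, f t x = \sum_(a <- s) f t a * e a x.
  move=> tT; apply: (spn (kap t)); rewrite !mem_cat; apply/or3P/Or32.
  by apply/mapP; exists t.
have spx t : t \in Theta -> forall x, xstep t x = \sum_(a <- s) xstep t a * e a x.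
  move=> tT; apply: (spn (kap t)); rewrite !mem_cat; apply/or3P/Or33.
  by apply/mapP; exists t.
have sp := spanned_lin s e.
have sP a : a \in s -> piece (kap a) a.
  by move=> /sD[[j pj] _]; rewrite (kapE pj).
have ge a : a \in s -> good w (e a) by move=> /sL[[_ []]].
exists s, e; split.
- by split=> // a /sP/piece_itv.
- move=> a asn; split; first exact: ge.
  move=> b bs; split; last exact: nod.
  by have [_ ] := sL a asn; apply; exact: sD.
- move=> a x asn xw ex; have [[_ pe] _] := sL a asn.
  by apply: (on_piece_local pe (sP a asn) _ xw ex); apply: heps; case: (sP a asn).
- split=> [g x gw|x].
    have E y : g (clamp w y) =
        \sum_(k <- iota 0 N) 1 * (wcut k g y + g (beta k.+1) * chi_ k y).
      rewrite -[LHS]mulr1 -[X in _ * X = _](sum_chi_ y) mulr_sumr.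
      rewrite -(big_mkord xpredT (fun k => g (clamp w y) * chi_ k y)) /index_iota subn0.
      by apply: eq_bigr => k _; rewrite /wcut mul1r mulrBl subrK.
    have : [set h | forall x, h x = \sum_(a <- s) h a * e a x]
        (fun y => \sum_(k <- iota 0 N) 1 * (wcut k g y + g (beta k.+1) * chi_ k y)).
      apply: (lin_closed_sum (F := fun k y => wcut k g y + g (beta k.+1) * chi_ k y)
        (c := fun=> 1) sp) => k; rewrite mem_iota => /= kN _.
      apply: sp.2; last exact: spchi.
      have -> : wcut k g = fun x => \sum_(a <- Theta) wcut k g a * f a x.
        by apply/funext => y; exact: hws.
      by apply: (lin_closed_sum (F := f) sp) => t tT _; exact: spf.
    by move=> /(_ x); rewrite -E => ->; apply: eq_bigr => a _; rewrite -E.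
  have : [set h | forall x, h x = \sum_(a <- s) h a * e a x]
      (fun y => \sum_(k <- iota 0 N) 1 * chi_ k y).
    apply: (lin_closed_sum (F := chi_) (c := fun=> 1) sp) => k.
    by rewrite mem_iota => /= kN _; exact: spchi.
  have E y : \sum_(k <- iota 0 N) 1 * chi_ k y = 1.
    rewrite -[RHS](sum_chi_ y) -(big_mkord xpredT (fun k => chi_ k y)) /index_iota subn0.
    by apply: eq_bigr => k _; rewrite mul1r.
  move=> /(_ x); rewrite E => {1}->; apply: eq_bigr => a _.
  by rewrite E mul1r.
- move=> c hc; pose u x := \sum_(a <- s) c a * e a x.
  have su : stepspace u.
    by apply: (lin_closed_sum (F := e) stepspace_lin) => a /sL[[]].
  (* Every test function of [stepspace_kernel] is a combination of the nodal functions, against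
     which the pairing vanishes by assumption. *)
  have Bu (g : R -> R) : (forall x, g x = \sum_(a <- s) g a * e a x) -> B u g = 0.
    move=> gE; have -> : g = fun x => \sum_(a <- s) g a * e a x by exact/funext.
    rewrite goodB_sumr// big_seq big1// => a asn.
    by rewrite [X in _ * X]hc// mulr0.
  have [|||C uC] := stepspace_kernel su.
  + by move=> k kN; apply: Bu; exact: spchi.
  + by move=> t tT; apply: Bu; exact: spf.
  + by move=> t tT; apply: Bu; exact: spx.
  exists C => a asn; rewrite -(uC a) /u -[LHS](sum_nodal c us asn).
  by apply: eq_big_seq => b bs; rewrite nod.
Qed.

End Pieces.

Lemma grid_points (R : realType) (w eps : R) (ws : seq (R -> R)) : 0 < w -> 0 < eps ->
  (forall f, f \in ws -> good w f) ->
  exists (N : nat) (beta : nat -> R),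
  [/\ (0 < N)%N, beta 0%N = - w /\ beta N = w,
      forall k, (k < N)%N -> beta k < beta k.+1,
      forall k, (k < N)%N -> beta k.+1 - beta k <= eps &
      forall f k, f \in ws -> (0 < k < N)%N -> {for beta k, continuous f}].
Proof.
(* This [N] makes the regular spacing [tau] smaller than [eps / 2]. Shifting inner points by less
   than [tau / 3], to avoid discontinuities, keeps them ordered with gaps below [5 / 3 * tau]. *)
move=> w0 e0 wsg; set N := Num.bound (4 * w / eps).
have x0 : 0 <= 4 * w / eps by rewrite divr_ge0 ?mulr_ge0// ltW.
have hN : 4 * w / eps < N%:R by exact: archi_boundP.
have N0 : (0 < N)%N by rewrite -(ltr0n R) (le_lt_trans x0).
pose tau := 2 * w / N%:R.
have tau0 : 0 < tau by rewrite divr_gt0 ?ltr0n// mulr_gt0.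
have tauN : N%:R * tau = 2 * w by rewrite /tau mulrC mulfVK// pnatr_eq0 -lt0n.
have taue : 2 * tau < eps.
  rewrite -(ltr_pM2l (_ : 0 < N%:R)) ?ltr0n// mulrCA tauN.
  by move: hN; rewrite ltr_pdivrMr// => hN'; lra.
have h k : exists x, - w + k%:R * tau - tau / 3 < x < - w + k%:R * tau + tau / 3 /\
    ~ disc ws x.
  by apply: countable_avoid; [lra|by apply: disc_countable => f /wsg/good_BV].
have [b bP] := choice h.
pose beta k := if k == 0%N then - w else if k == N then w else b k.
have bE k : (k <= N)%N -> - w + k%:R * tau - tau / 3 < beta k < - w + k%:R * tau + tau / 3.
  rewrite /beta => kN; case: eqVneq => [->|k0]; first by rewrite mul0r; apply/andP; split; lra.
  case: eqVneq => [->|kN']; last by case: (bP k).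
  by rewrite tauN; apply/andP; split; lra.
have bS k : (k < N)%N -> - w + k%:R * tau + (2 / 3) * tau < beta k.+1 < - w + k%:R * tau + (4 / 3) * tau.
  by move=> /bE; rewrite -natr1 mulrDl => /andP[? ?]; apply/andP; split; lra.
exists N, beta; split => //.
- by split; rewrite /beta ?eqxx//; case: eqVneq N0 => // ->.
- by move=> k kN; have /andP[? ?] := bS k kN; have /andP[? ?] := bE k (ltnW kN); lra.
- by move=> k kN; have /andP[? ?] := bS k kN; have /andP[? ?] := bE k (ltnW kN); lra.
- move=> f k fw /andP[k0 kN]; rewrite /beta gtn_eqF// ltn_eqF//.
  have [_ nd] := bP k; apply: contrapT => nc; apply: nd; by exists f.
Qed.

Lemma grid_stage (R : realType) (w eps : R) (ws : seq (R -> R)) : 0 < w -> 0 < eps ->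
  (forall f, f \in ws -> good w f) ->
  exists (s : seq R) (e : R -> R -> R),
  [/\ uniq s /\ (forall a, a \in s -> - w < a < w),
      forall a, a \in s -> good w (e a) /\ forall b, b \in s ->
        {for b, continuous (e a)} /\ e a b = (a == b)%:R,
      forall a x, a \in s -> - w <= x <= w -> e a x != 0 -> `|x - a| <= eps,
      (forall g x, g \in ws -> g (clamp w x) = \sum_(a <- s) g (clamp w a) * e a x) /\
      (forall x, 1 = \sum_(a <- s) e a x) &
      forall c, (forall b, b \in s ->
          bder w (fun x => \sum_(a <- s) c a * e a x) (e b) = 0) ->
        exists C, forall a, a \in s -> c a = C].
Proof.
move=> w0 e0 wsg; have [N [beta [N0 [b0 bN] blt beps bws]]] := grid_points w0 e0 wsg.
have [Ts [f [uT TD fcut fnod fE]]] := nodal_cut w0 N0 b0 bN blt wsg bws.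
have Tp t : t \in Ts -> piece N beta (kap N beta t) t.
  by move=> /TD[j pj]; rewrite (kapE blt pj).
pose n := (size Ts).+1.
have n0 : (0 : R) < 2 * n%:R by rewrite mulr_gt0// ltr0n.
(* Finitely many conditions on [delta], one for each pair of nodes: [qpt] stays to the right of its
   node, yet so close to the right end that every cut basis function is small there. *)
have [|d d0 hd] := @eventually_all R _ [seq (t, s) | t <- Ts, s <- Ts]
    (fun ts delta => ts.2 < qpt w N beta delta ts.2 /\
      `|f ts.1 (qpt w N beta delta ts.2)| * n%:R <= 2^-1).
  move=> _ /allpairsP[[t s] [/= tT sT ->]] /=.
  have ps := Tp s sT; have [kN /andP[s1 s2]] := ps.
  have /andP[ws1 ws2] := piece_itv b0 bN blt ps.
  have [[_ lv] _] := fcut _ tT.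
  have n2 : 0 < (2 * n%:R)^-1 :> R by rewrite invr_gt0.
  have [d' d'0 hd'] := lv _ n2.
  pose m := Num.min (beta (kap N beta s).+1 - s) d'.
  have m0 : 0 < m by rewrite lt_min d'0 subr_gt0 s2.
  have w2 : 0 < 2 * w by rewrite mulr_gt0.
  (* Since [s + w <= 2 * w], this bound on [delta] puts [qpt] within [m] of the right end of the
     piece. *)
  exists (m / (2 * w)); first by rewrite divr_gt0.
  move=> delta /andP[delta0]; rewrite ltr_pdivlMr// => dm.
  have dm' : delta * (s + w) < m.
    by apply: le_lt_trans dm; rewrite ler_pM2l//; lra.
  have dp : 0 < delta * (s + w) by rewrite mulr_gt0//; lra.
  move: dm'; rewrite lt_min => /andP[m1 m2].
  have q1 : s < qpt w N beta delta s by rewrite /qpt; lra.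
  (* On a common piece the left limit zero of [f t] gives smallness; on different pieces [f t]
     vanishes at this point. *)
  split => //; have [E|kk] := eqVneq (kap N beta t) (kap N beta s).
    rewrite -ler_pdivlMr ?ltr0n// -invfM ltW// hd'//.
    by rewrite E /qpt; apply/andP; split; lra.
  have pq : piece N beta (kap N beta s) (qpt w N beta delta s).
    by split => //; rewrite (lt_trans s1 q1)/= /qpt; lra.
  have [[[_ _ h] _] _] := fcut _ tT.
  rewrite (h _ _ pq); first by rewrite normr0 mul0r.
  by apply/eqP; rewrite eq_sym.
pose delta := d / 2.
have dd : 0 < delta < d by rewrite /delta; apply/andP; split; lra.
have delta0 : 0 < delta by case/andP: dd.
have hd2 t s : t \in Ts -> s \in Ts -> s < qpt w N beta delta s /\
    `|f t (qpt w N beta delta s)| * n%:R <= 2^-1.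
  move=> tT sT; apply: (hd (t, s)) => //; apply/allpairsP; by exists (t, s).
have Tq t : t \in Ts -> t < qpt w N beta delta t.
  by move=> tT; case: (hd2 t t tT tT).
apply: (nodal_grid w0 N0 b0 bN blt wsg delta0 Tp Tq uT fcut fnod _ beps) => //.
  by move=> t s tT sT; case: (hd2 t s tT sT).
Qed.

(** * Quadrature *)

Section IntervalIntegral.
Variable R : realType.
Implicit Types (f g : R -> R) (a b c : R).

Definition itv_int a b f : R := \int[lebesgue_measure]_(x in `[a, b]) f x.

Lemma BV_integrable a b f : locally_BV f ->
  (@lebesgue_measure R).-integrable `[a, b] (EFin \o f).
Proof.
move=> bf; apply: (@locally_BV_integrable R _ a b f _ bf).
exact: lebesgue_locally_finite.
Qed.

Lemma itv_int_cst a b c : a <= b -> itv_int a b (fun=> c) = c * (b - a).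
Proof.
move=> ab; rewrite /itv_int Rintegral_cst//= lebesgue_measure_itv/= lte_fin.
by move: ab; rewrite le_eqVlt => /predU1P[->|ab]; rewrite ?ltxx ?subrr// ab.
Qed.

Lemma itv_intD a b f g : locally_BV f -> locally_BV g ->
  itv_int a b (fun x => f x + g x) = itv_int a b f + itv_int a b g.
Proof. by move=> bf bg; apply: RintegralD => //; exact: BV_integrable. Qed.

Lemma itv_intZ a b c f : locally_BV f ->
  itv_int a b (fun x => c * f x) = c * itv_int a b f.
Proof. by move=> bf; apply: RintegralZl => //; exact: BV_integrable. Qed.

Lemma itv_int_sum a b (I : eqType) (s : seq I) (c : I -> R) (F : I -> R -> R) :
  (forall i, i \in s -> locally_BV (F i)) ->
  itv_int a b (fun x => \sum_(i <- s) c i * F i x) = \sum_(i <- s) c i * itv_int a b (F i).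
Proof.
elim: s => [|i s IH] h.
  under eq_fun do rewrite big_nil.
  by rewrite big_nil /itv_int /Rintegral integral0.
have bs j : j \in s -> locally_BV (F j) by move=> js; apply: h; rewrite in_cons js orbT.
have bi : locally_BV (F i) by apply: h; rewrite mem_head.
under eq_fun do rewrite big_cons.
rewrite big_cons itv_intD ?itv_intZ ?IH//.
  exact: locally_BVZ.
elim: (s) bs => [|j t IHt] bs.
  by under eq_fun do rewrite big_nil; exact: locally_BV_cst.
under eq_fun do rewrite big_cons; apply: (@locally_BVD _ (fun x => c j * F j x)).
  by apply: locally_BVZ; apply: bs; rewrite mem_head.
by apply: IHt => k kt; apply: bs; rewrite in_cons kt orbT.
Qed.

Lemma itv_int_le a b f g : locally_BV f -> locally_BV g ->
  (forall x, a <= x <= b -> f x <= g x) -> itv_int a b f <= itv_int a b g.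
Proof.
move=> bf bg h; apply: le_Rintegral => //; try exact: BV_integrable.
Qed.

Lemma eq_itv_int a b f g : (forall x, a <= x <= b -> f x = g x) ->
  itv_int a b f = itv_int a b g.
Proof.
by move=> h; apply: eq_Rintegral => x; rewrite inE/= in_itv/= => /h.
Qed.

Lemma itv_int_split a b c f : locally_BV f -> a <= c -> c <= b ->
  itv_int a b f = itv_int a c f + itv_int c b f.
Proof.
move=> bf ac cb.
have E := @Rintegral_itvB R f (BLeft a) (BRight b) c (BV_integrable a b bf) _ _.
rewrite -(subrK (itv_int a c f) (itv_int a b f)) addrC; congr (_ + _).
rewrite [LHS]E ?bnd_simp//; apply: Rintegral_itv_obnd_cbnd.
apply: integrableS (BV_integrable c b bf) => //; exact: subset_itv_oc_cc.
Qed.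

Lemma itv_int_hside a b p : a <= p -> p <= b -> itv_int a b (hside p) = b - p.
Proof.
move=> ap pb; have bh : locally_BV (hside p) by case: (epilogic_hside p).
rewrite (itv_int_split bh ap pb).
have -> : itv_int a p (hside p) = 0.
  rewrite /itv_int -Rintegral_itv_bndo_bndc.
    rewrite (@eq_Rintegral _ _ _ _ _ (fun=> 0)) ?/Rintegral ?integral0// => x; rewrite inE/= in_itv/= => /andP[_ xp].
    by rewrite hside_lt.
  apply: integrableS (BV_integrable a p bh) => //; exact: subset_itv_co_cc.
have -> : itv_int p b (hside p) = itv_int p b (fun=> 1).
  have h f : locally_BV f -> itv_int p b f = \int[lebesgue_measure]_(x in `]p, b]) f x.
    move=> bf; rewrite Rintegral_itv_obnd_cbnd//.
    apply: integrableS (BV_integrable p b bf) => //; exact: subset_itv_oc_cc.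
  rewrite !h//; last exact: locally_BV_cst.
  by apply: eq_Rintegral => x; rewrite inE/= in_itv/= => /andP[px _]; rewrite hside_gt.
by rewrite itv_int_cst// mul1r add0r.
Qed.

(** On each cell the error of the left sum lies between 0 and [tau] times the increment of [g], and
    the increments telescope. *)
Lemma riemann_nondecreasing w g (n : nat) (tau : R) : 0 < w -> (0 < n)%N ->
  {homo g : x y / x <= y} -> tau = 2 * w / n%:R ->
  `|\sum_(j <- iota 0 n) tau * g (- w + j%:R * tau) - itv_int (- w) w g| <=
  tau * (g w - g (- w)).
Proof.
move=> w0 n0 gnd tauE; pose x j := - w + j%:R * tau.
have tau0 : 0 < tau by rewrite tauE divr_gt0 ?ltr0n// mulr_gt0.
have xS j : x j.+1 = x j + tau by rewrite /x -natr1 mulrDl mul1r addrA.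
have x0 : x 0%N = - w by rewrite /x mul0r addr0.
have xn : x n = w by rewrite /x tauE mulrC mulfVK ?pnatr_eq0 -?lt0n//; lra.
have bg : locally_BV g by exact: locally_BV_nondecreasing.
have x0x j : x 0%N <= x j by rewrite /x lerD2l ler_wpM2r ?ler_nat// ltW.
have key m : 0 <= itv_int (x 0%N) (x m) g - \sum_(j <- iota 0 m) tau * g (x j) <=
    tau * (g (x m) - g (x 0%N)).
  elim: m => [|m /andP[IH1 IH2]].
    rewrite big_nil subr0 subrr mulr0.
    rewrite (_ : itv_int _ _ _ = 0) ?lexx//.
    by rewrite /itv_int set_itv1 Rintegral_set1.
  have xx : x m <= x m.+1 by rewrite xS lerDl ltW.
  rewrite -addn1 iotaD add0n big_cat/= big_seq1 addn1.
  rewrite (itv_int_split bg (x0x m) xx).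
  have l1 : tau * g (x m) <= itv_int (x m) (x m.+1) g.
    rewrite (_ : tau * _ = itv_int (x m) (x m.+1) (fun=> g (x m))); last first.
      by rewrite itv_int_cst// xS; ring.
    by apply: itv_int_le => //; [exact: locally_BV_cst|move=> y /andP[/gnd]].
  have l2 : itv_int (x m) (x m.+1) g <= tau * g (x m.+1).
    rewrite (_ : tau * _ = itv_int (x m) (x m.+1) (fun=> g (x m.+1))); last first.
      by rewrite itv_int_cst// xS; ring.
    by apply: itv_int_le => //; [exact: locally_BV_cst|move=> y /andP[_ /gnd]].
  have -> : tau * (g (x m.+1) - g (x 0%N)) =
    tau * g (x m.+1) - tau * g (x m) + tau * (g (x m) - g (x 0%N)) by ring.
  by apply/andP; split; lra.
have := key n; rewrite x0 xn => /andP[k1 k2].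
by rewrite ler_norml; apply/andP; split; lra.
Qed.

Lemma riemann_sums w (fs : seq (R -> R)) (eta : R) : 0 < w -> 0 < eta ->
  (forall f, f \in fs -> locally_BV f) ->
  exists (ps : seq R) (d : R), [/\ 0 < d, uniq ps, forall p, p \in ps -> - w <= p <= w &
    forall f, f \in fs -> `|\sum_(p <- ps) d * f p - itv_int (- w) w f| <= eta].
Proof.
move=> w0 e0 bfs.
have [|d0 d00 hd] := @eventually_all R _ fs (fun f tau => forall n : nat, (0 < n)%N ->
    tau = 2 * w / n%:R ->
    `|\sum_(j <- iota 0 n) tau * f (- w + j%:R * tau) - itv_int (- w) w f| <= eta).
  move=> f /bfs /locally_BVP[g [h [gnd hnd ->]]].
  pose M := (g w - g (- w)) + (h w - h (- w)) + 1.
  have ww : - w <= w by rewrite (le_trans _ (ltW w0))// oppr_le0 ltW.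
  have M0 : 0 < M by rewrite /M; have := gnd _ _ ww; have := hnd _ _ ww; clear; lra.
  exists (eta / M); first by rewrite divr_gt0.
  move=> tau /andP[t0]; rewrite ltr_pdivlMr// => tM n n0 tE.
  have bg : locally_BV g by exact: locally_BV_nondecreasing.
  have bh : locally_BV h by exact: locally_BV_nondecreasing.
  have r1 := riemann_nondecreasing w0 n0 gnd tE.
  have r2 := riemann_nondecreasing w0 n0 hnd tE.
  have E1 : itv_int (- w) w (g \- h) = itv_int (- w) w g - itv_int (- w) w h.
    by apply: RintegralB => //; exact: BV_integrable.
  have E2 : \sum_(j <- iota 0 n) tau * (g \- h) (- w + j%:R * tau) =
    \sum_(j <- iota 0 n) tau * g (- w + j%:R * tau) -
    \sum_(j <- iota 0 n) tau * h (- w + j%:R * tau).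
    by rewrite -sumrB; apply: eq_bigr => j _; rewrite /= mulrBr.
  rewrite E1 E2; move: r1 r2 tM; rewrite /M.
  move: (\sum_(j <- _) _) (\sum_(j <- _) _) (itv_int _ _ _) (itv_int _ _ _).
  move=> A B C D; rewrite !ler_norml => /andP[? ?] /andP[? ?] ?.
  by apply/andP; split; lra.
pose n := (Num.bound (2 * w / d0)).+1.
have nb : 2 * w / d0 < n%:R.
  rewrite (lt_trans (archi_boundP _))// ?ltr_nat//.
  by rewrite divr_ge0 ?mulr_ge0// ltW.
pose tau := 2 * w / n%:R.
have tau0 : 0 < tau by rewrite divr_gt0// mulr_gt0.
have taud : tau < d0.
  by move: nb; rewrite ltr_pdivrMr// /tau ltr_pdivrMr// ?ltr0n// [d0 * _]mulrC.
exists [seq - w + j%:R * tau | j <- iota 0 n], tau; split => //.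
- rewrite map_inj_uniq ?iota_uniq// => i j /addrI/(mulIf (lt0r_neq0 tau0))/eqP.
  by rewrite eqr_nat => /eqP.
- move=> p /mapP[j]; rewrite mem_iota => /= jn ->.
  have : j%:R * tau <= n%:R * tau by apply: ler_wpM2r; [exact: ltW|rewrite ler_nat ltnW].
  rewrite {2}/tau [n%:R * _]mulrC mulfVK ?pnatr_eq0// => ?.
  have : 0 <= j%:R * tau by rewrite mulr_ge0// ltW.
  by move=> ?; apply/andP; split; lra.
- move=> f ff; rewrite big_map; apply: (hd f ff tau _ n) => //.
  by rewrite tau0.
Qed.

End IntervalIntegral.

(** * Symmetric step functions *)

Section Boxes.
Variable R : realType.
Implicit Types (b r x w : R).

Definition box b r x : R := hside (b - r) x - hside (b + r) x.

Lemma box_in b r x : `|x - b| < r -> box b r x = 1.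
Proof.
rewrite ltr_norml => /andP[h1 h2]; rewrite /box hside_gt ?hside_lt ?subr0//; lra.
Qed.

Lemma box_out b r x : 0 < r -> r < `|x - b| -> box b r x = 0.
Proof.
move=> r0; rewrite ltr_normr => /orP[h|h]; rewrite /box.
  by rewrite !hside_gt ?subrr//; lra.
by rewrite !hside_lt ?subrr//; lra.
Qed.

Lemma box_supp b r x : 0 < r -> box b r x != 0 -> `|x - b| <= r.
Proof. by move=> r0; apply: contraNT; rewrite -ltNge => /(box_out r0) ->. Qed.

Lemma box_itv b r x : 0 < r -> 0 <= box b r x <= 1.
Proof.
move=> r0; have h1 := hside_ge0 (b - r) x; have h2 := hside_le1 (b - r) x.
have h3 := hside_ge0 (b + r) x; have h4 := hside_le1 (b + r) x.
rewrite /box; apply/andP; split; last by lra.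
have [xr|rx] := ltP x (b + r); first by rewrite (hside_lt xr) subr0.
by rewrite (@hside_gt _ (b - r) x) ?subr_ge0//; lra.
Qed.

Lemma good_box w b r : 0 < r -> - w < b - r -> b + r < w -> good w (box b r).
Proof.
by move=> r0 h1 h2; apply: goodB; apply: good_hside_itv; apply/andP; split; lra.
Qed.

Lemma BV_box b r : locally_BV (box b r).
Proof.
have h p : locally_BV (@hside R p) by case: (epilogic_hside p).
exact: (locally_BVD (h (b - r)) (locally_BVN (h (b + r)))).
Qed.

Lemma itv_int_box w b r : 0 < r -> - w <= b - r -> b + r <= w ->
  itv_int (- w) w (box b r) = 2 * r.
Proof.
move=> r0 h1 h2; have h p : locally_BV (@hside R p) by case: (epilogic_hside p).
transitivity (itv_int (- w) w (hside (b - r)) - itv_int (- w) w (hside (b + r))).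
  by apply: RintegralB => //; exact: BV_integrable.
by rewrite !itv_int_hside; lra.
Qed.

End Boxes.

(** Near the nodes [e a] is almost its nodal value, so small boxes around the nodes contribute a
    definite positive amount to its integral. Only the rest is approximated by a Riemann sum, with a
    smaller error. The resulting gap will be the integral of the final nodal function at [a]. *)
Lemma quadrature (R : realType) (w : R) (s : seq R) (e : R -> R -> R) : 0 < w -> uniq s ->
  (forall a, a \in s -> - w < a < w) -> (forall a, a \in s -> locally_BV (e a)) ->
  (forall a b, a \in s -> b \in s -> {for b, continuous (e a)} /\ e a b = (a == b)%:R) ->
  exists (ps : seq R) (d : R -> R),
  [/\ uniq ps, forall p, p \in ps -> [/\ - w <= p <= w, p \notin s & 0 <= d p] &
    forall a, a \in s -> \sum_(p <- ps) d p * e a p < itv_int (- w) w (e a)].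
Proof.
move=> w0 us sw be ce; set n := size s.
(* Errors of [kap] on [n] boxes of width [2 * rho] lose at most [rho] altogether, while the box at
   [a] contributes [2 * rho]. *)
pose kap := (2 * n.+1%:R)^-1 : R.
have kap0 : 0 < kap by rewrite invr_gt0 mulr_gt0.
have nkap : n%:R * kap <= 2^-1.
  rewrite /kap invfM mulrCA -[leRHS]mulr1 ler_wpM2l//.
  by rewrite ler_pdivrMr// mul1r ler_nat.
clearbody kap.
have [|d0 d00 hd] := @eventually_all R _ [seq (a, b) | a <- s, b <- s]
    (fun ab rho => [/\ ab.1 != ab.2 -> 2 * rho < `|ab.1 - ab.2|,
      forall x, `|x - ab.2| <= rho -> `|e ab.1 x - (ab.1 == ab.2)%:R| <= kap &
      - w < ab.2 - rho /\ ab.2 + rho < w]).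
  move=> _ /allpairsP[[a b] [/= aS bS ->]] /=.
  have [cab nab] := ce a b aS bS.
  have [d d0 hd] := (continuous_atP (e a) b).1 cab _ kap0.
  have /andP[b1 b2] := sw b bS.
  pose m := Num.min (if a == b then 1 else `|a - b| / 2) (Num.min d (Num.min (w - b) (b + w))).
  exists m.
    rewrite !lt_min d0; case: eqVneq => [_|ab].
      by rewrite ltr01/=; apply/andP; split; lra.
    have ab0 : 0 < `|a - b| by rewrite normr_gt0 subr_eq0.
    by apply/and3P; split=> //; last apply/andP; try split; lra.
  move=> rho /andP[r0]; rewrite !lt_min => /and4P[r1 r2 r3 r4]; split.
  - by move=> ab; move: r1; rewrite (negbTE ab) => ?; lra.
  - by move=> x xr; rewrite -nab; apply/ltW/hd; exact: le_lt_trans r2.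
  - by split; lra.
pose rho := d0 / 2.
have rd : 0 < rho < d0 by rewrite /rho; apply/andP; split; lra.
clearbody rho.
have rho0 : 0 < rho by case/andP: rd.
have hr a b : a \in s -> b \in s -> [/\ a != b -> 2 * rho < `|a - b|,
      forall x, `|x - b| <= rho -> `|e a x - (a == b)%:R| <= kap &
      - w < b - rho /\ b + rho < w].
  by move=> aS bS; apply: (hd (a, b)) => //; apply/allpairsP; exists (a, b).
(* The boxes are disjoint, so [1 - Y] is nonnegative. It vanishes at the nodes, and hence sample
   points that are nodes carry no weight and can be discarded. *)
pose Y x := \sum_(b <- s) box b rho x.
have Ysep b x : b \in s -> box b rho x != 0 -> Y x = box b rho x.
  move=> bS bx; rewrite /Y (bigD1_seq b)//= big_seq_cond big1 ?addr0// => c /andP[cS cb].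
  apply/eqP/negPn/negP => cx; have [h _ _] := hr c b cS bS.
  have := h cb; have := box_supp rho0 cx; have := box_supp rho0 bx.
  have := ler_distD x c b; rewrite (distrC c x) => ? ? ? ?; lra.
have Y1 x : 0 <= 1 - Y x.
  rewrite subr_ge0; have [/hasP[b bS bx]|/hasPn h] := boolP (has (fun b => box b rho x != 0) s).
    by rewrite (Ysep b x bS bx); case/andP: (box_itv b x rho0).
  by rewrite /Y big_seq big1 ?ler01// => b /h /negPn/eqP.
have Ys b : b \in s -> Y b = 1.
  move=> bS; have b1 : box b rho b = 1 by rewrite box_in// subrr normr0.
  by rewrite (Ysep b b bS) b1 ?oner_neq0.
pose g a x := e a x * (1 - Y x).
have bY : locally_BV Y.
  rewrite /Y; elim: (s) => [|b t IH].
    by under eq_fun do rewrite big_nil; exact: locally_BV_cst.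
  by under eq_fun do rewrite big_cons; exact: (locally_BVD (BV_box b rho) IH).
have bY1 : locally_BV (fun x => 1 - Y x).
  by apply: (@locally_BVD _ (fun=> 1) (\- Y)); [exact: locally_BV_cst|exact: locally_BVN].
have bg a : a \in s -> locally_BV (g a) by move=> aS; apply: locally_BVM => //; exact: be.
(* The tolerance is half of the amount [rho] that the boxes guarantee. *)
have [|ps [tau [tau0 ups psw hps]]] := @riemann_sums R w (map g s) (rho / 2) w0 (divr_gt0 rho0 (ltr0n _ 2)).
  by move=> f /mapP[a aS ->]; exact: bg.
exists [seq p <- ps | p \notin s], (fun p => tau * (1 - Y p)); split.
- exact: filter_uniq.
- move=> p; rewrite mem_filter => /andP[ps' pp]; split => //; first exact: psw.
  by rewrite mulr_ge0// ltW.
move=> a aS; have -> : \sum_(p <- [seq p <- ps | p \notin s]) tau * (1 - Y p) * e a p =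
    \sum_(p <- ps) tau * g a p.
  rewrite big_filter big_mkcond/=; apply: eq_bigr => p _.
  case: ifPn => [_|/negPn pS]; first by rewrite /g mulrA mulrAC.
  by rewrite /g Ys// subrr !mulr0.
have := hps (g a) (map_f g aS); rewrite ler_norml => /andP[_ h].
(* On each box [e a] is bounded below by its nodal value minus [kap]; the sum [k] of these bounds
   has integral at least [rho]. *)
have key : itv_int (- w) w (g a) <= itv_int (- w) w (e a) - rho.
  pose k x := \sum_(b <- s) ((a == b)%:R - kap) * box b rho x.
  have bk : locally_BV k.
    rewrite /k; elim: (s) => [|b t IH].
      by under eq_fun do rewrite big_nil; exact: locally_BV_cst.
    under eq_fun do rewrite big_cons.
    exact: (locally_BVD (locally_BVZ _ (BV_box b rho)) IH).
  have intk : itv_int (- w) w k >= rho.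
    rewrite /k itv_int_sum; last by move=> b _; exact: BV_box.
    rewrite (eq_big_seq (fun b => 2 * rho * (b == a)%:R - kap * (2 * rho))); last first.
      move=> b bS; have [_ _ [h1 h2]] := hr a b aS bS.
      by rewrite itv_int_box ?ltW// eq_sym mulrBl mulrC.
    rewrite sumrB (sum_nodal (fun=> 2 * rho))// big_const_seq count_predT -/n.
    rewrite iter_addr addr0 -[X in _ - X]mulr_natl mulrA.
    have : n%:R * kap * (2 * rho) <= 2^-1 * (2 * rho) by rewrite ler_pM2r// mulr_gt0.
    by move: (n%:R * kap) => z hz; lra.
  apply: (@le_trans _ _ (itv_int (- w) w (fun x => e a x + (-1) * k x))).
    apply: itv_int_le; [exact: bg| |].
      by apply: (@locally_BVD _ (e a)); [exact: be|exact: locally_BVZ].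
    move=> x _; rewrite /g mulrBr mulr1 mulN1r lerD2l lerN2 /k /Y mulr_sumr.
    rewrite !big_seq; apply: ler_sum => b bS.
    have [->|bx] := eqVneq (box b rho x) 0; first by rewrite !mulr0.
    have /andP[b0 _] := box_itv b x rho0; rewrite ler_wpM2r//.
    have [_ h2 _] := hr a b aS bS.
    by have := h2 x (box_supp rho0 bx); rewrite ler_norml => /andP[? ?]; lra.
  rewrite itv_intD ?itv_intZ//; last 2 first.
  - exact: be.
  - exact: locally_BVZ.
  by rewrite mulN1r lerD2l lerN2.
by apply: le_lt_trans (_ : _ <= itv_int (- w) w (g a) + rho / 2) _; lra.
Qed.

(** * Isotropic pairs *)

Section Localisation.
Variable R : realType.
Variable w : R.
Hypothesis w0 : 0 < w.
Notation B := (bder w).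

Lemma opp_le_self : - w <= w.
Proof. by rewrite (le_trans _ (ltW w0))// oppr_le0 ltW. Qed.

Lemma good_clamp u : good w u -> good w (u \o clamp w).
Proof.
move=> [eu cu cu']; split; first exact: epilogic_clamp.
  by apply: clamp_continuous; rewrite clamp_id// lexx opp_le_self.
by apply: clamp_continuous; rewrite clamp_id// lexx opp_le_self.
Qed.

Lemma good_bder_eql u v : good w u -> good w v ->
  (forall x, - w <= x <= w -> u x = 0) -> B u v = 0.
Proof. by move=> gu gv h; have [_ cu cu'] := gu; apply: bder_eql => //; [exact: good_BV gu|exact: good_BV gv]. Qed.

Lemma bder_clamp u v : good w u -> good w v -> B (u \o clamp w) v = B u v.
Proof.
move=> gu gv; have gc := good_clamp gu; have gd := goodB gu gc.
have -> : B u v = B (fun x => (u \o clamp w) x + (u x - (u \o clamp w) x)) v.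
  by congr (B _ v); apply/funext => x; rewrite addrC subrK.
rewrite goodBDl// (@good_bder_eql (fun x => u x - (u \o clamp w) x)) ?addr0// => x xw.
by rewrite /= clamp_id// subrr.
Qed.

(** Supports are controlled inside [[- w, w]] only. Freezing [u] outside makes it vanish on a full
    neighbourhood of the support of [v], even beyond an end of the interval, and locality
    applies. *)
Lemma bder_far u v a x L : good w u -> good w v -> - w <= x <= w ->
  (forall y, - w <= y <= w -> u y != 0 -> `|y - a| <= L) ->
  (forall y, - w <= y <= w -> v y != 0 -> `|y - x| <= L) ->
  2 * L < `|a - x| -> B u v = 0.
Proof.
move=> gu gv xw hu hv hL; rewrite -bder_clamp//.
pose m := `|a - x| / 2.
have Lm : L < m by rewrite /m; lra.
have m2 : `|a - x| = m + m by rewrite /m; lra.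
rewrite (@bder_local _ w (u \o clamp w) (fun=> 0) v (x - m) (x + m)).
- by apply: bder_cstl; exact: good_BV gv.
- by apply: good_BV; exact: good_clamp.
- exact: locally_BV_cst.
- exact: good_BV gv.
- move=> y /andP[y1 y2]; apply/eqP/negPn/negP => /= uy.
  have h1 := hu _ (clamp_itv y (ltW w0)) uy.
  have h2 : `|clamp w y - x| < m.
    rewrite -[x in X in X < _](clamp_id xw) (le_lt_trans (clamp_dist _ _ _))//.
    by rewrite ltr_norml; apply/andP; split; lra.
  have := ler_distD (clamp w y) a x; rewrite (distrC a (clamp w y)) m2; by move=> ?; lra.
- move=> y yw yx; apply/eqP/negPn/negP => vy; move/negP: yx; apply.
  have := hv y yw vy; rewrite ler_norml => /andP[? ?]; apply/andP; split; lra.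
Qed.

Lemma bder_boxl b r v : good w v -> 0 < r -> - w < b - r -> b + r < w ->
  B (box b r) v = v (b - r) - v (b + r).
Proof.
move=> gv r0 h1 h2.
have g1 : good w (hside (b - r)) by apply: good_hside_itv; apply/andP; split; lra.
have g2 : good w (hside (b + r)) by apply: good_hside_itv; apply/andP; split; lra.
have -> : box b r = fun x => hside (b - r) x + (-1) * hside (b + r) x.
  by apply/funext => x; rewrite mulN1r.
rewrite goodBDl ?goodBZl//; last exact: goodZ.
have bv := good_BV gv.
by rewrite !bder_hsidel ?mulN1r//; apply/andP; split; lra.
Qed.

Lemma bder_boxr b r u : good w u -> 0 < r -> - w < b - r -> b + r < w ->
  B u (box b r) = u (b + r) - u (b - r).
Proof.
move=> gu r0 h1 h2; have [eu cu _] := gu.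
have g1 : good w (hside (b - r)) by apply: good_hside_itv; apply/andP; split; lra.
have g2 : good w (hside (b + r)) by apply: good_hside_itv; apply/andP; split; lra.
have -> : box b r = fun x => hside (b - r) x + (-1) * hside (b + r) x.
  by apply/funext => x; rewrite mulN1r.
rewrite goodBDr ?goodBZr//; last exact: goodZ.
rewrite !bder_hsider//; [lra|by apply/andP; split; lra..].
Qed.

Lemma box_grid (o h : R) (i j : nat) : 0 < h ->
  box (o + i%:R * h) h (o + j%:R * h) =
  if i == j then 1 else if (i == j.+1) || (j == i.+1) then 2^-1 else 0.
Proof.
move=> h0; case: (ltngtP i j) => ij.
- case: (eqVneq j i.+1) => [->|ji].
    rewrite orbT /box (_ : o + i.+1%:R * h = o + i%:R * h + h); last first.
      by rewrite -natr1; ring.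
    by rewrite hside_eq hside_gt; lra.
  rewrite (_ : (i == j.+1) = false) /=; last by lia.
  apply: box_out => //; rewrite (_ : o + _ - _ = (j%:R - i%:R) * h); last by ring.
  have : (i.+2%:R : R) <= j%:R by rewrite ler_nat; lia.
  rewrite -!natr1 => ij'; rewrite gtr0_norm ?mulr_gt0//; last lra.
  by rewrite ltr_pMl//; lra.
- case: (eqVneq i j.+1) => [->|ji].
    rewrite /box (_ : o + j.+1%:R * h = o + j%:R * h + h); last first.
      by rewrite -natr1; ring.
    by rewrite addrK hside_eq hside_lt ?subr0//; lra.
  rewrite (_ : (j == i.+1) = false) /=; last by lia.
  apply: box_out => //; rewrite distrC (_ : o + _ - _ = (i%:R - j%:R) * h); last by ring.
  have : (j.+2%:R : R) <= i%:R by rewrite ler_nat; lia.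
  rewrite -!natr1 => ij'; rewrite gtr0_norm ?mulr_gt0//; last lra.
  by rewrite ltr_pMl//; lra.
- by rewrite ij box_in// subrr normr0.
Qed.

(** Two families of boxes are each isotropic and dual to one another. With enough boxes,
    combinations of each family satisfy the linear conditions while their mutual pairing survives,
    by [kernel_pairing]. *)
Lemma isotropic_pair (us : seq (R -> R)) (o len : R) : 0 < len -> - w < o -> o + len < w ->
  (forall u, u \in us -> good w u) ->
  exists z z' : R -> R,
  [/\ good w z /\ good w z',
      forall x, (z x != 0) || (z' x != 0) -> o < x < o + len,
      itv_int (- w) w z = 0 /\ itv_int (- w) w z' = 0,
      forall u, u \in us -> [/\ B z u = 0, B u z = 0, B z' u = 0 & B u z' = 0] &
      [/\ B z z = 0, B z' z' = 0, B z z' = 1 & B z' z = -1]].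
Proof.
(* [n] counts the conditions on each of the two functions, namely the pairings with [us] and the
   integral; [N] is the number of coefficients that [kernel_pairing] asks for. *)
move=> len0 wo olw gus; pose n := (size us).+1; pose N := n.*2.+1.
pose h := len / (4 * N + 5)%:R.
have h0 : 0 < h by rewrite divr_gt0// ltr0n addnS.
pose pt j := o + j%:R * h.
have hN : (4 * N + 5)%:R * h = len by rewrite /h mulrC divfK// pnatr_eq0 addnS.
clearbody h.
have pt_lt j : (0 < j <= 4 * N + 3)%N -> o < pt j /\ pt j + h < o + len.
  move=> /andP[j0 jN]; split; first by rewrite ltrDl mulr_gt0// ltr0n.
  have : (j.+1%:R : R) * h < (4 * N + 5)%:R * h by rewrite ltr_pM2r// ltr_nat; lia.
  by rewrite hN -natr1 /pt; lra.
have ptS j : pt j.+1 - h = pt j by rewrite /pt -natr1; ring.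
have ptS' j : pt j + h = pt j.+1 by rewrite /pt -natr1; ring.
have pt_w j : (1 < j <= 4 * N + 3)%N -> - w < pt j - h /\ pt j + h < w.
  case: j => // j jN; have [h1 _] := @pt_lt j (ltac:(lia)).
  by have [_ h2] := @pt_lt j.+1 (ltac:(lia)); rewrite ptS; split; lra.
pose bx j := box (pt j) h.
have gbx j : (1 < j <= 4 * N + 3)%N -> good w (bx j).
  by move=> /pt_w[? ?]; exact: good_box.
have Bl j v : (1 < j.+1 <= 4 * N + 3)%N -> good w v -> B (bx j.+1) v = v (pt j) - v (pt j.+2).
  by move=> jN gv; have [? ?] := pt_w _ jN; rewrite bder_boxl// ptS ptS'.
have Br j v : (1 < j.+1 <= 4 * N + 3)%N -> good w v -> B v (bx j.+1) = - B (bx j.+1) v.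
  move=> jN gv; have [? ?] := pt_w _ jN; rewrite Bl// bder_boxr// ptS ptS'; by rewrite opprB.
have Bb i j : (1 < i.+1 <= 4 * N + 3)%N -> (1 < j <= 4 * N + 3)%N ->
    B (bx i.+1) (bx j) = (if j == i then 1 else if (j == i.+1) || (i == j.+1) then 2^-1 else 0)
    - (if j == i.+2 then 1 else if (j == i.+3) || (i.+2 == j.+1) then 2^-1 else 0).
  by move=> iN jN; rewrite Bl//; [rewrite /bx !box_grid|exact: gbx].
(* Spacing by 4 separates different [k]. The right end of [a k] is the centre of [b k] and its left
   end lies outside [b k], so they pair to -1; against itself a box takes the value 1/2 at both ends
   and pairs to 0. *)
pose a (k : 'I_N) := bx (4 * k + 2)%N; pose b (k : 'I_N) := bx (4 * k + 3)%N.
have aN (k : 'I_N) : (1 < 4 * k + 2 <= 4 * N + 3)%N by have := ltn_ord k; lia.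
have bN (k : 'I_N) : (1 < 4 * k + 3 <= 4 * N + 3)%N by have := ltn_ord k; lia.
have ga k : good w (a k) by exact: gbx.
have gb k : good w (b k) by exact: gbx.
have Bab k l : B (a k) (b l) = - (l == k)%:R.
  rewrite /a /b (_ : (4 * k + 2 = (4 * k + 1).+1)%N); last by lia.
  rewrite Bb; [|by have := aN k; lia|exact: bN].
  rewrite (_ : (4 * l + 3 == 4 * k + 1)%N = false); last by lia.
  rewrite (_ : (4 * l + 3 == (4 * k + 1).+1)%N = false); last by lia.
  rewrite (_ : (4 * k + 1 == (4 * l + 3).+1)%N = false); last by lia.
  rewrite (_ : (4 * l + 3 == (4 * k + 1).+3)%N = false); last by lia.
  rewrite (_ : ((4 * k + 1).+2 == (4 * l + 3).+1)%N = false); last by lia.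
  rewrite (_ : (4 * l + 3 == (4 * k + 1).+2)%N = (l == k)); last by rewrite -val_eqE/=; lia.
  by case: eqVneq => _ /=; rewrite sub0r.
have Baa k l : B (a k) (a l) = 0.
  rewrite /a (_ : (4 * k + 2 = (4 * k + 1).+1)%N); last by lia.
  rewrite Bb; [|by have := aN k; lia|exact: aN].
  rewrite (_ : (4 * l + 2 == 4 * k + 1)%N = false); last by lia.
  rewrite (_ : (4 * k + 1 == (4 * l + 2).+1)%N = false); last by lia.
  rewrite (_ : (4 * l + 2 == (4 * k + 1).+3)%N = false); last by lia.
  rewrite (_ : (4 * l + 2 == (4 * k + 1).+2)%N = false); last by lia.
  rewrite (_ : ((4 * k + 1).+2 == (4 * l + 2).+1)%N = (4 * l + 2 == (4 * k + 1).+1)%N); last by lia.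
  by rewrite !orbF/= subrr.
have Bbb k l : B (b k) (b l) = 0.
  rewrite /b (_ : (4 * k + 3 = (4 * k + 2).+1)%N); last by lia.
  rewrite Bb; [|by have := bN k; lia|by have := bN l; lia].
  rewrite (_ : (_ == (4 * k + 2))%N = false); last by lia.
  rewrite (_ : (4 * k + 2 == _)%N = false); last by lia.
  rewrite (_ : (_ == (4 * k + 2).+3)%N = false); last by lia.
  rewrite (_ : (_ == (4 * k + 2).+2)%N = false); last by lia.
  rewrite (_ : ((4 * k + 2).+2 == _)%N = (4 * l + 3 == (4 * k + 2).+1)%N); last by lia.
  by rewrite !orbF/= subrr.
(* Boxes lie strictly inside the interval and pair antisymmetrically with everything, so the
   conditions imposed on one side give those on the other. *)
have sk k v : good w v -> B v (a k) = - B (a k) v /\ B v (b k) = - B (b k) v.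
  move=> gv; split.
    by rewrite /a (_ : (4 * k + 2 = (4 * k + 1).+1)%N) ?Br//; have := aN k; lia.
  by rewrite /b (_ : (4 * k + 3 = (4 * k + 2).+1)%N) ?Br//; have := bN k; lia.
pose M (c : 'I_N -> R -> R) : 'M[R]_(N, n) := \matrix_(k, j)
  if (j < size us)%N then B (c k) (nth (fun=> 0) us j) else itv_int (- w) w (c k).
(* [al] and [be] solve the conditions for the two families, and by duality of the boxes their
   product 1 becomes [B z z']. *)
have [al [be [alA beB ab1]]] := kernel_pairing (M a) (M b).
have Mus (c : 'I_N -> R -> R) (v : 'rV_N) u : v *m M c = 0 -> u \in us ->
    \sum_k v 0 k * B (c k) u = 0.
  move=> vM uus; have jn : (index u us < n)%N by rewrite ltnS ltnW// index_mem.
  have := congr1 (fun X : 'rV_n => X 0 (Ordinal jn)) vM; rewrite !mxE => E.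
  rewrite -[RHS]E; apply: eq_bigr => k _.
  by rewrite mxE /= index_mem uus nth_index.
have Mint (c : 'I_N -> R -> R) (v : 'rV_N) : v *m M c = 0 ->
    \sum_k v 0 k * itv_int (- w) w (c k) = 0.
  move=> vM; have := congr1 (fun X : 'rV_n => X 0 ord_max) vM; rewrite !mxE => E.
  by rewrite -[RHS]E; apply: eq_bigr => k _; rewrite mxE /= ltnn.
have [z zE] : exists z, z = fun x => \sum_k al 0 k * a k x by eexists.
have [z' zE'] : exists z, z = fun x => \sum_k (- be 0 k) * b k x by eexists.
have g1 : good w z by rewrite zE; apply: good_sum.
have g2 : good w z' by rewrite zE'; apply: good_sum.
have sa v : good w v -> B z v = \sum_k al 0 k * B (a k) v.
  by move=> gv; rewrite zE; apply: goodB_suml.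
have sb v : good w v -> B z' v = - \sum_k be 0 k * B (b k) v.
  move=> gv; rewrite zE' goodB_suml//; rewrite -sumrN; apply: eq_bigr => k _; exact: mulNr.
have sa' v : good w v -> B v z = - \sum_k al 0 k * B (a k) v.
  move=> gv; rewrite zE (goodB_sumr (F := a) v (fun k => al 0 k) (fun k _ => ga k)).
  by rewrite -sumrN; apply: eq_bigr => k _; rewrite (sk k v gv).1 mulrN.
have sb' v : good w v -> B v z' = \sum_k be 0 k * B (b k) v.
  move=> gv; rewrite zE' (goodB_sumr (F := b) v (fun k => - be 0 k) (fun k _ => gb k)).
  by apply: eq_bigr => k _; rewrite (sk k v gv).2 mulrNN.
exists z, z'.
split.
- by [].
- have supp j x : (1 < j <= 4 * N + 3)%N -> bx j x != 0 -> o < x < o + len.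
    case: j => // j jN /(box_supp h0).
    have [q1 _] := @pt_lt j (ltac:(lia)); have [_ q2] := @pt_lt j.+1 (ltac:(lia)).
    have q3 := ptS j; rewrite ler_norml => /andP[? ?]; apply/andP; split; lra.
  have supps (c : 'I_N -> R -> R) (v : 'I_N -> R) x : (forall k, c k x != 0 -> o < x < o + len) ->
      \sum_k v k * c k x != 0 -> o < x < o + len.
    move=> hc; apply: contraNT => nx; apply/eqP; apply: big1 => k _.
    have [->|/hc] := eqVneq (c k x) 0; first by rewrite mulr0.
    by rewrite (negbTE nx).
  by move=> x; rewrite zE zE' => /orP[]; apply: supps => k; apply: supp.
- split.
    rewrite zE itv_int_sum ?Mint// => k _; exact: good_BV (ga k).
  rewrite zE' itv_int_sum => [|k _]; last exact: good_BV (gb k).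
  have -> : \sum_k (- be 0 k) * itv_int (- w) w (b k) = - \sum_k be 0 k * itv_int (- w) w (b k).
    by rewrite -sumrN; apply: eq_bigr => k _; rewrite mulNr.
  by rewrite Mint// oppr0.
- move=> u uus; have gu := gus u uus.
  have Ea := Mus a al u alA uus; have Eb := Mus b be u beB uus; split.
  + by rewrite (sa u gu) Ea.
  + by rewrite (sa' u gu) Ea oppr0.
  + by rewrite (sb u gu) Eb oppr0.
  + by rewrite (sb' u gu) Eb.
have Baz k : B (a k) z = 0.
  rewrite zE (goodB_sumr (F := a) (a k) (fun k => al 0 k) (fun k _ => ga k)).
  by rewrite big1// => l _; rewrite Baa mulr0.
have Bbz k : B (b k) z' = 0.
  rewrite zE' (goodB_sumr (F := b) (b k) (fun k => - be 0 k) (fun k _ => gb k)).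
  by rewrite big1// => l _; rewrite Bbb mulr0.
have Baz' k : B (a k) z' = be 0 k.
  rewrite zE' (goodB_sumr (F := b) (a k) (fun k => - be 0 k) (fun k _ => gb k)).
  rewrite (eq_bigr (fun i => be 0 i * (i == k)%:R)) => [|i _]; last by rewrite Bab mulrNN.
  by rewrite (sum_nodal (fun i => be 0 i)) ?index_enum_uniq ?mem_index_enum.
have BZ : \sum_k al 0 k * B (a k) z' = 1.
  by rewrite -[RHS]ab1; apply: eq_bigr => k _; rewrite Baz'.
split.
- by rewrite (sa z g1) big1// => k _; rewrite Baz mulr0.
- by rewrite (sb z' g2) big1 ?oppr0// => k _; rewrite Bbz mulr0.
- by rewrite (sa z' g2) BZ.
- by rewrite (sa' z' g2) BZ.
Qed.

End Localisation.

Lemma big_nth_ord (R : realType) (s : seq R) n (F : R -> R) : size s = n ->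
  \sum_(b <- s) F b = \sum_(i < n) F (nth 0 s i).
Proof. by move=> sn; rewrite (big_nth 0) sn big_mkord. Qed.

(** [schur_kernel] for functions on lists; the order of [Xi ++ map g Xi] turns the matrix of [J]
    into [symplectic]. *)
Lemma schur_list (R : realType) (s Xi : seq R) (g : R -> R)
    (G Phi Psi S J : R -> R -> R) : uniq s -> uniq Xi ->
  (forall t, (forall a', a' \in s -> \sum_(a <- s) t a * G a a' = 0) ->
    exists k, forall a, a \in s -> t a = k) ->
  (forall c, c \in Xi ++ map g Xi -> \sum_(a <- s) Psi a c = 0) ->
  (forall x y, x \in Xi -> y \in Xi ->
    [/\ J x y = 0, J (g x) (g y) = 0, J x (g y) = (x == y)%:R &
        J (g x) y = - (x == y)%:R]) ->
  exists S0 : R, forall t c : R -> R,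
    (forall a', a' \in s -> \sum_(a <- s) t a * G a a' +
       \sum_(b <- Xi ++ map g Xi) c b * Phi b a' = 0) ->
    (forall c', c' \in Xi ++ map g Xi -> \sum_(a <- s) t a * Psi a c' +
       \sum_(b <- Xi ++ map g Xi) c b * (S b c' + S0 * J b c') = 0) ->
    (forall b, b \in Xi ++ map g Xi -> c b = 0) /\
    exists k, forall a, a \in s -> t a = k.
Proof.
move=> us uX kerG Psi0 JP; set Y := Xi ++ map g Xi.
pose n := size s; pose m := size Xi.
have sY : size Y = (m + m)%N by rewrite size_cat size_map.
pose mG : 'M[R]_n := \matrix_(i, j) G (nth 0 s i) (nth 0 s j).
pose mPhi : 'M[R]_(m + m, n) := \matrix_(i, j) Phi (nth 0 Y i) (nth 0 s j).
pose mPsi : 'M[R]_(n, m + m) := \matrix_(i, j) Psi (nth 0 s i) (nth 0 Y j).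
pose mS : 'M[R]_(m + m) := \matrix_(i, j) S (nth 0 Y i) (nth 0 Y j).
have JE (i j : 'I_(m + m)) : symplectic R m i j = J (nth 0 Y i) (nth 0 Y j).
  have XiP (k : 'I_m) : nth 0 Xi k \in Xi by rewrite mem_nth.
  have XE (k l : 'I_m) : (nth 0 Xi k == nth 0 Xi l) = (k == l).
    by rewrite nth_uniq.
  rewrite /symplectic; case: (splitP i) => k ik; case: (splitP j) => l jl.
  - have -> : i = lshift m k by apply: val_inj.
    have -> : j = lshift m l by apply: val_inj.
    rewrite block_mxEul mxE /= !nth_cat !ltn_ord.
    by case: (JP _ _ (XiP k) (XiP l)).
  - have -> : i = lshift m k by apply: val_inj.
    have -> : j = rshift m l by apply: val_inj.
    rewrite block_mxEur mxE /= !nth_cat ltn_ord ltnNge leq_addr /= addKn (nth_map 0)//.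
    by case: (JP _ _ (XiP k) (XiP l)) => _ _ -> _; rewrite XE.
  - have -> : i = rshift m k by apply: val_inj.
    have -> : j = lshift m l by apply: val_inj.
    rewrite block_mxEdl !mxE /= !nth_cat ltn_ord ltnNge leq_addr /= addKn (nth_map 0)//.
    by case: (JP _ _ (XiP k) (XiP l)) => _ _ _ ->; rewrite XE.
  - have -> : i = rshift m k by apply: val_inj.
    have -> : j = rshift m l by apply: val_inj.
    rewrite block_mxEdr mxE /= !nth_cat !ltnNge !leq_addr /= !addKn !(nth_map 0)//.
    by case: (JP _ _ (XiP k) (XiP l)).
pose e : 'rV[R]_n := const_mx 1.
have [||S0 HS] := @schur_kernel R n m mG mPhi mPsi mS e.
- move=> t tG; pose t' a := if insub (index a s) is Some i then t 0 i else 0.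
  have t'E (i : 'I_n) : t' (nth 0 s i) = t 0 i.
    by rewrite /t' index_uniq// insubT//= => lt; congr (t 0 _); apply: val_inj.
  have [|k hk] := kerG t'.
    move=> a' a's; have ja : (index a' s < n)%N by rewrite index_mem.
    have := congr1 (fun X : 'rV_n => X 0 (Ordinal ja)) tG; rewrite !mxE => E.
    rewrite -[RHS]E (big_nth_ord _ (erefl n)); apply: eq_bigr => i _.
    by rewrite t'E mxE /= nth_index.
  exists k; apply/rowP => i; rewrite !mxE mulr1 -t'E; apply: hk.
  exact: mem_nth.
- apply/rowP => j; rewrite !mxE -[RHS](Psi0 (nth 0 Y j)); last by rewrite mem_nth ?sY.
  rewrite (big_nth_ord _ (erefl n)); apply: eq_bigr => i _.
  by rewrite !mxE mul1r.
exists S0 => t c h1 h2.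
have [||c0 [k hk]] := HS (\row_i t (nth 0 s i)) (\row_i c (nth 0 Y i)).
- apply/rowP => j; rewrite !mxE -[RHS](h1 (nth 0 s j)); last exact: mem_nth.
  rewrite (big_nth_ord _ (erefl n)) (big_nth_ord _ sY).
  by congr (_ + _); apply: eq_bigr => i _; rewrite !mxE.
- apply/rowP => j; rewrite !mxE -[RHS](h2 (nth 0 Y j)); last by rewrite mem_nth ?sY.
  rewrite (big_nth_ord _ (erefl n)) (big_nth_ord _ sY).
  congr (_ + _); apply: eq_bigr => i _; first by rewrite !mxE.
  by rewrite [X in _ * X]mxE [X in _ * (_ + X)]mxE JE !mxE.
split.
- move=> b bY; have ib : (index b Y < m + m)%N by rewrite -sY index_mem.
  have := congr1 (fun X : 'rV_(m + m) => X 0 (Ordinal ib)) c0.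
  by rewrite !mxE /= nth_index.
- exists k => a aS; have ia : (index a s < n)%N by rewrite index_mem.
  have := congr1 (fun X : 'rV_n => X 0 (Ordinal ia)) hk.
  by rewrite !mxE /= nth_index// mulr1.
Qed.

(** * Step functions of prescribed integral and companion nodes *)

Section NodeSteps.
Variable R : realType.
Variable w : R.
Hypothesis w0 : 0 < w.

(** A box centred at an end of the interval has only half of its width inside. *)
Lemma itv_int_node_box (b rho : R) : 0 < rho -> rho < 2 * w ->
  [\/ b = w, b = - w | - w < b - rho /\ b + rho < w] ->
  good w (box b rho) /\
  itv_int (- w) w (box b rho) = (if (b == w) || (b == - w) then 1 else 2) * rho.
Proof.
move=> rho0 rhow [->|->|[h1 h2]].
- rewrite eqxx /= mul1r; split.
    by apply: goodB; apply: good_hside; apply/eqP => ?; lra.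
  rewrite (@eq_itv_int _ _ _ _ (hside (w - rho))).
    by rewrite itv_int_hside; lra.
  by move=> x /andP[_ xw]; rewrite /box (@hside_lt _ (w + rho)) ?subr0//; lra.
- rewrite eqxx orbT mul1r; split.
    by apply: goodB; apply: good_hside; apply/eqP => ?; lra.
  rewrite (@eq_itv_int _ _ _ _ (fun x => 1 + (-1) * hside (- w + rho) x)).
    have bh : locally_BV (@hside R (- w + rho)) by case: (epilogic_hside (- w + rho)).
    rewrite (@itv_intD _ _ _ (fun=> 1)); [|exact: locally_BV_cst|exact: locally_BVZ].
    rewrite itv_intZ// itv_int_cst; last exact: opp_le_self.
    by rewrite itv_int_hside; lra.
  by move=> x /andP[wx _]; rewrite /box (@hside_gt _ (- w - rho)) ?mulN1r//; lra.
- rewrite itv_int_box ?ltW//.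
  rewrite (_ : b == w = false); last by apply/eqP => ?; lra.
  rewrite (_ : b == - w = false); last by apply/eqP => ?; lra.
  split=> //.
  by apply: goodB; apply: good_hside; apply/eqP => ?; lra.
Qed.

(** The inner box fixes the value at [b]. The ring between radii [2 * r] and [3 * r] vanishes at [b]
    and has the same integral [m * r], so its coefficient [C] tunes the total to [d]. *)
Lemma node_step (b r d : R) : 0 < r -> 3 * r < 2 * w ->
  [\/ b = w, b = - w | - w < b - 3 * r /\ b + 3 * r < w] ->
  exists y : R -> R, [/\ good w y, y b = 1, forall x, y x != 0 -> `|x - b| <= 3 * r &
    itv_int (- w) w y = d].
Proof.
move=> r0 rw hb.
have hb' rho : 0 < rho -> rho <= 3 * r -> good w (box b rho) /\
    itv_int (- w) w (box b rho) = (if (b == w) || (b == - w) then 1 else 2) * rho.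
  move=> rho0 rr; apply: itv_int_node_box => //; first by lra.
  by case: hb => [->|->|[? ?]]; [constructor 1|constructor 2|constructor 3; split; lra].
set m := (if _ then _ else _) in hb'.
have m0 : 0 < m by rewrite /m; case: ifP.
clearbody m; have [g1 i1] := hb' r r0 ltac:(lra).
have [g2 i2] := hb' (2 * r) ltac:(lra) ltac:(lra).
have [g3 i3] := hb' (3 * r) ltac:(lra) ltac:(lra).
pose C := d / (m * r) - 1.
have b2 := good_BV g2; have b3 := good_BV g3; have b1 := good_BV g1.
have gd : good w (fun x => C * (box b (3 * r) x - box b (2 * r) x)).
  by apply: goodZ; exact: goodB.
exists (fun x => box b r x + C * (box b (3 * r) x - box b (2 * r) x)); split.
- exact: goodD.
- by rewrite !box_in ?subrr ?normr0 ?mulr0 ?addr0//; lra.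
- move=> x; apply: contraNT; rewrite -ltNge => xb.
  rewrite !box_out ?subrr ?mulr0 ?addr0//; lra.
- rewrite itv_intD//; last exact: good_BV gd.
  have E : itv_int (- w) w (fun x => box b (3 * r) x - box b (2 * r) x) = m * r.
    transitivity (itv_int (- w) w (box b (3 * r)) - itv_int (- w) w (box b (2 * r))).
      by apply: RintegralB => //; exact: BV_integrable.
    by rewrite i2 i3; ring.
  rewrite itv_intZ; last by apply: (good_BV (w := w)); exact: goodB.
  rewrite i1 E /C; field.
  by rewrite !gt_eqF.
Qed.

End NodeSteps.

(* g is a slight contraction towards a point off the list. *)
Lemma companions (R : realType) (w eps : R) (s Xi : seq R) : 0 < w -> 0 < eps ->
  (forall x, x \in Xi -> - w <= x <= w) ->
  exists g : R -> R, [/\ injective g, forall x, x \in Xi -> g x \notin s ++ Xi,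
    forall x, x \in Xi -> - w <= g x <= w & forall x, x \in Xi -> `|g x - x| <= eps].
Proof.
move=> w0 e0 Xw.
have [eta [/andP[eta1 eta2] etaX]] : exists x, - w < x < w /\ ~ [set` Xi] x.
  by apply: countable_avoid; [lra|exact/finite_set_countable/finite_seq].
pose g k x : R := x + k * (eta - x).
have dist k x : 0 < k -> x \in Xi -> `|g k x - x| <= k * (2 * w).
  move=> k0 /Xw/andP[x1 x2]; rewrite /g addrAC subrr add0r normrM gtr0_norm//.
  by rewrite ler_pM2l// ler_norml; apply/andP; split; lra.
have [|d d0 hd] := @eventually_all R _ [seq (x, y) | x <- Xi, y <- s ++ Xi]
    (fun xy k => g k xy.1 != xy.2).
  move=> _ /allpairsP[[x y] [/= xX yS ->]] /=.
  have [<-|xy] := eqVneq x y.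
    exists 1 => // k /andP[k0 _]; rewrite -subr_eq0 /g addrAC subrr add0r.
    apply: mulf_neq0; first by rewrite gt_eqF.
    rewrite subr_eq0; apply/eqP => E; apply: etaX.
    by rewrite /= E.
  have xy0 : 0 < `|x - y| by rewrite normr_gt0 subr_eq0.
  exists (`|x - y| / (2 * w)); first by rewrite divr_gt0// mulr_gt0.
  move=> k /andP[k0]; rewrite ltr_pdivlMr ?mulr_gt0// => kd.
  apply/eqP => E; have := dist k x k0 xX; rewrite E distrC => ?; lra.
(* In this order: the list is avoided, the map is injective and keeps points in the interval, and
   points move by at most [eps]. *)
pose k := Num.min (d / 2) (Num.min 2^-1 (eps / (2 * w))).
have k0 : 0 < k by rewrite !lt_min !divr_gt0 ?mulr_gt0//= invr_gt0 ltr0n.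
have kd : k < d by apply: (@le_lt_trans _ _ (d / 2)); [rewrite ge_min lexx|lra].
have k1 : k <= 2^-1 by rewrite ge_min ge_min lexx orbT.
have ke : k * (2 * w) <= eps.
  by rewrite -ler_pdivlMr ?mulr_gt0// ge_min ge_min lexx !orbT.
clearbody k; exists (g k); split.
- move=> x y E; have : (1 - k) * (x - y) = 0 by move: E; rewrite /g => E; lra.
  by move=> /eqP; rewrite mulf_eq0 subr_eq0 gt_eqF/= ?subr_eq0; [move/eqP|lra].
- move=> x xX; apply/negP => gS.
  have xg : (x, g k x) \in [seq (x, y) | x <- Xi, y <- s ++ Xi].
    by apply/allpairsP; exists (x, g k x).
  by have := hd _ xg k (introT andP (conj k0 kd)); rewrite eqxx.
- move=> x /Xw/andP[x1 x2]; rewrite /g.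
  have h1 : 0 <= k * (eta + w) by rewrite mulr_ge0//; lra.
  have h2 : 0 <= k * (w - eta) by rewrite mulr_ge0//; lra.
  have h3 : 0 <= (1 - k) * (x + w) by rewrite mulr_ge0//; lra.
  have h4 : 0 <= (1 - k) * (w - x) by rewrite mulr_ge0//; lra.
  by apply/andP; split; lra.
- by move=> x xX; apply: le_trans (dist k x k0 xX) ke.
Qed.

(** * The grid *)

Section Assembly.
Variable R : realType.
Variables w eps r : R.
Hypotheses (w0 : 0 < w) (r0 : 0 < r) (re : 3 * r <= eps).
Variables (s Xi : seq R) (t : R -> R -> R) (g d : R -> R).
Notation B := (bder w).
Notation Y := (Xi ++ map g Xi).
Notation Gam := (s ++ Y).
Hypothesis t_good : forall a, a \in s -> good w (t a).
Hypothesis t_nodal : forall a b, a \in s -> b \in s -> t a b = (a == b)%:R.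
Hypothesis t_sum : forall x, 1 = \sum_(a <- s) t a x.
Hypothesis t_loc : forall a x, a \in s -> - w <= x <= w -> t a x != 0 -> `|x - a| <= eps.
Hypothesis t_ker : forall c,
  (forall b, b \in s -> B (fun x => \sum_(a <- s) c a * t a x) (t b) = 0) ->
  exists C, forall a, a \in s -> c a = C.
Hypothesis g_inj : injective g.
Hypothesis g_loc : forall x, x \in Xi -> `|g x - x| <= eps.
Hypothesis uG : uniq Gam.
Hypothesis G_itv : forall a, a \in Gam -> - w <= a <= w.
Hypotheses (wG : w \in Gam) (wG' : - w \in Gam).
Hypothesis sep : forall a b, a \in Gam -> b \in Gam -> a != b -> 8 * r < `|a - b|.
Hypothesis d_int : forall a, a \in s ->
  \sum_(b <- Y) d b * t a b < itv_int (- w) w (t a).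

Lemma YG b : b \in Y -> b \in Gam.
Proof. by move=> bY; rewrite mem_cat bY orbT. Qed.

Lemma YNs b : b \in Y -> b \notin s.
Proof.
move=> bY; move: uG; rewrite cat_uniq => /and3P[_ /hasPn h _].
exact: h.
Qed.

Lemma gNXi x : x \in Xi -> g x \notin Xi.
Proof.
move: uG; rewrite cat_uniq => /and3P[_ _]; rewrite cat_uniq => /and3P[_ /hasPn h _] xX.
by apply: h; exact: map_f.
Qed.

Lemma XiY x : x \in Xi -> x \in Y.
Proof. by rewrite mem_cat => ->. Qed.

Lemma r_small : 8 * r < 2 * w.
Proof.
have [w_gt0 r_gt0 r_le] : [/\ 0 < w, 0 < r & 3 * r <= eps] by [].
have ne : w != - w by apply/eqP => ?; lra.
by have := sep wG wG' ne; rewrite opprK gtr0_norm; lra.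
Qed.

Lemma near_eq a b x : a \in Gam -> b \in Gam -> `|x - a| <= 3 * r -> `|x - b| <= 3 * r -> a = b.
Proof.
have [w_gt0 r_gt0 r_le] : [/\ 0 < w, 0 < r & 3 * r <= eps] by [].
move=> aG bG xa xb; apply/eqP/negPn/negP => ab.
by have := sep aG bG ab; have := ler_distD x a b; rewrite (distrC a x); lra.
Qed.

Lemma node_steps : exists y : R -> R -> R, forall b, b \in Y ->
  [/\ good w (y b), y b b = 1, forall x, y b x != 0 -> `|x - b| <= 3 * r &
    itv_int (- w) w (y b) = d b].
Proof.
have [w_gt0 r_gt0 r_le] : [/\ 0 < w, 0 < r & 3 * r <= eps] by [].
have h b : exists y : R -> R, b \in Y ->
    [/\ good w y, y b = 1, forall x, y x != 0 -> `|x - b| <= 3 * r &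
    itv_int (- w) w y = d b].
  have [bY|] := boolP (b \in Y); last by exists (fun=> 0).
  have bG := YG bY; have r8 := r_small.
  have [||y yP] := @node_step R w w0 b r (d b) r0; [by lra| |by exists y].
  have [->|bw] := eqVneq b w; first by constructor 1.
  have [->|bw'] := eqVneq b (- w); first by constructor 2.
  constructor 3; have /andP[b1 b2] := G_itv bG.
  have := sep bG wG bw; have := sep bG wG' bw'.
  rewrite opprK ger0_norm; last by lra.
  rewrite ler0_norm; last by lra.
  by move=> ? ?; split; lra.
by have [f hf] := choice h; exists f.
Qed.

Variable y : R -> R -> R.
Hypothesis yP : forall b, b \in Y ->
  [/\ good w (y b), y b b = 1, forall x, y b x != 0 -> `|x - b| <= 3 * r &
    itv_int (- w) w (y b) = d b].

Lemma y_nodal b x : b \in Y -> x \in Gam -> y b x = (b == x)%:R.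
Proof.
have [w_gt0 r_gt0 r_le] : [/\ 0 < w, 0 < r & 3 * r <= eps] by [].
move=> bY xG; have [_ yb ysup _] := yP bY; have [<-//|bx] := eqVneq b x.
apply/eqP/negPn/negP => /ysup xb; move/eqP: bx; apply.
apply: (near_eq (YG bY) xG xb); rewrite subrr normr0; lra.
Qed.

Definition funcs := [seq t a | a <- s] ++ [seq y b | b <- Y].

Lemma funcs_good u : u \in funcs -> good w u.
Proof.
by rewrite mem_cat => /orP[] /mapP[a aS ->]; [exact: t_good|case: (yP aS)].
Qed.

Lemma t_funcs a : a \in s -> t a \in funcs.
Proof. by move=> aS; rewrite mem_cat map_f. Qed.

Lemma y_funcs b : b \in Y -> y b \in funcs.
Proof. by move=> aS; rewrite mem_cat [X in _ || X]map_f ?orbT. Qed.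

(** Since [x] is excluded from a support of radius [r], far below the separation of the grid, both
    functions vanish at every grid point. *)
Definition pair_ok (x : R) (z z' : R -> R) :=
  [/\ good w z /\ good w z',
      forall v, (z v != 0) || (z' v != 0) -> `|v - x| <= r /\ v != x,
      itv_int (- w) w z = 0 /\ itv_int (- w) w z' = 0,
      forall u, u \in funcs -> [/\ B z u = 0, B u z = 0, B z' u = 0 & B u z' = 0] &
      [/\ B z z = 0, B z' z' = 0, B z z' = 1 & B z' z = -1]].

Lemma isotropic_pairs : exists z : R -> (R -> R) * (R -> R),
  forall x, x \in Xi -> pair_ok x (z x).1 (z x).2.
Proof.
have [w_gt0 r_gt0 r_le] : [/\ 0 < w, 0 < r & 3 * r <= eps] by [].
have h x : exists z : (R -> R) * (R -> R), x \in Xi -> pair_ok x z.1 z.2.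
  have [xX|] := boolP (x \in Xi); last by exists (fun=> 0, fun=> 0).
  have /andP[x1 x2] := G_itv (YG (XiY xX)); have r8 := r_small.
  (* The support is placed beside [x] on the side towards 0, which keeps it inside the interval even
     for [x = w] or [x = - w]. *)
  have [p [q1 q2 q3]] : exists p, [/\ - w < p, p + r / 2 < w &
      forall v, p < v < p + r / 2 -> `|v - x| <= r /\ v != x].
    have [xn|xp] := leP x 0.
      exists (x + r / 4); split; [lra|lra|move=> v /andP[v1 v2]].
      split; first by rewrite ler_norml; apply/andP; split; lra.
      by rewrite gt_eqF//; lra.
    exists (x - 3 * r / 4); split; [lra|lra|move=> v /andP[v1 v2]].
    split; first by rewrite ler_norml; apply/andP; split; lra.
    by rewrite lt_eqF//; lra.
  have r2 : 0 < r / 2 by lra.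
  have [z [z' [gz sz iz uz zz]]] := isotropic_pair w0 r2 q1 q2 funcs_good.
  by exists (z, z') => _; split=> // v /sz/q3.
by have [f hf] := choice h; exists f.
Qed.

Variables z : R -> (R -> R) * (R -> R).
Hypothesis zP : forall x, x \in Xi -> pair_ok x (z x).1 (z x).2.

Lemma pair_far x x' (u v : R -> R) : x \in Xi -> x' \in Xi -> x != x' ->
  (u = (z x).1 \/ u = (z x).2) -> (v = (z x').1 \/ v = (z x').2) -> B u v = 0.
Proof.
have [w_gt0 r_gt0 r_le] : [/\ 0 < w, 0 < r & 3 * r <= eps] by [].
move=> xX xX' xx hu hv.
have [[g1 g2] s1 _ _ _] := zP xX; have [[g1' g2'] s1' _ _ _] := zP xX'.
apply: (@bder_far R w w0 u v x x' r).
- by case: hu => ->.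
- by case: hv => ->.
- exact: G_itv (YG (XiY xX')).
- by move=> v' _ hz; apply: (s1 v' _).1; case: hu hz => -> ->; rewrite ?orbT.
- by move=> v' _ hz; apply: (s1' v' _).1; case: hv hz => -> ->; rewrite ?orbT.
- by have := sep (YG (XiY xX)) (YG (XiY xX')) xx; lra.
Qed.

Definition ginv b := nth 0 Xi (index b (map g Xi)).

Lemma ginvK x : x \in Xi -> ginv (g x) = x.
Proof. by move=> xX; rewrite /ginv index_map// nth_index. Qed.

(** Only the first function of each pair is scaled. As every nonzero pairing joins a first and a
    second function, all pairings are then linear in [S]. *)
Definition extra (S : R) b : R -> R :=
  if b \in Xi then (fun x => S * (z b).1 x) else (z (ginv b)).2.

Lemma extra_Xi S x : x \in Xi -> extra S x = fun v => S * (z x).1 v.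
Proof. by rewrite /extra => ->. Qed.

Lemma extra_g S x : x \in Xi -> extra S (g x) = (z x).2.
Proof. by move=> xX; rewrite /extra (negbTE (gNXi xX)) ginvK. Qed.

Lemma YP b : b \in Y -> (exists2 x, x \in Xi & b = x) \/ (exists2 x, x \in Xi & b = g x).
Proof.
by rewrite mem_cat => /orP[bX|/mapP[x xX ->]]; [left; exists b|right; exists x].
Qed.

Lemma extraP S b : b \in Y ->
  [/\ good w (extra S b), itv_int (- w) w (extra S b) = 0,
      forall v, v \in Gam -> extra S b v = 0,
      forall v, extra S b v != 0 -> `|v - b| <= r + eps &
      forall u, u \in funcs -> B (extra S b) u = 0 /\ B u (extra S b) = 0].
Proof.
have [w_gt0 r_gt0 r_le] : [/\ 0 < w, 0 < r & 3 * r <= eps] by [].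
have zG x v : x \in Xi -> v \in Gam -> ~~ ((z x).1 v != 0) && ~~ ((z x).2 v != 0).
  move=> xX vG; rewrite -negb_or; apply/negP => hz.
  have [_ /(_ _ hz)[h1 /eqP h2] _ _ _] := zP xX; apply: h2.
  apply: (near_eq vG (YG (XiY xX)) _ (_ : `|v - x| <= _)); [rewrite subrr normr0|]; lra.
have e0 : 0 <= eps by lra.
move=> /YP[[x xX ->]|[x xX ->]]; have [[g1 g2] s1 [i1 i2] u1 _] := zP xX.
- rewrite extra_Xi//; split.
  + exact: goodZ.
  + by rewrite itv_intZ ?i1 ?mulr0//; exact: good_BV g1.
  + move=> v vG; have /andP[/negPn/eqP -> _] := zG x v xX vG; exact: mulr0.
  + move=> v; rewrite mulf_eq0 negb_or => /andP[_ hz].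
    by have [|h _] := s1 v; [rewrite hz|lra].
  + move=> u uF; have [h1 h2 _ _] := u1 u uF; have gu := funcs_good uF.
    by rewrite (goodBZl S g1 gu) (goodBZr S u g1) h1 h2 mulr0.
- rewrite extra_g//; split => //.
  + by move=> v vG; have /andP[_ /negPn/eqP ->] := zG x v xX vG.
  + move=> v hz; have [|h _] := s1 v; first by rewrite hz orbT.
    (* The function attached to [g x] lives near [x], which costs the distance from [x] to its
       companion. *)
    rewrite (_ : v - g x = (v - x) - (g x - x)); last by ring.
    apply: le_trans (ler_normB _ _) _; apply: lerD => //; exact: g_loc.
  + by move=> u uF; have [_ _ h1 h2] := u1 u uF.
Qed.

Definition Jm b c := B (extra 1 b) (extra 1 c).

Lemma extra1 x : x \in Xi -> extra 1 x = (z x).1.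
Proof. by move=> xX; rewrite extra_Xi//; apply/funext => v; rewrite mul1r. Qed.

Lemma JmP x x' : x \in Xi -> x' \in Xi ->
  [/\ Jm x x' = 0, Jm (g x) (g x') = 0, Jm x (g x') = (x == x')%:R &
      Jm (g x) x' = - (x == x')%:R].
Proof.
move=> xX xX'; rewrite /Jm (extra1 xX) (extra1 xX') !(extra_g 1 xX) !(extra_g 1 xX').
have [<-|xx] := eqVneq x x'; first by have [_ _ _ _ []] := zP xX.
by rewrite !(pair_far xX xX' xx) ?oppr0//; [right|left|left|right|right|right|left|left].
Qed.

Lemma extra_pairing S b c : b \in Y -> c \in Y -> B (extra S b) (extra S c) = S * Jm b c.
Proof.
have gz x : x \in Xi -> good w (z x).1 /\ good w (z x).2 by move=> /zP[].
move=> /YP[[x xX ->]|[x xX ->]] /YP[[x' xX' ->]|[x' xX' ->]];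
  have [j1 j2 j3 j4] := JmP xX xX'; move: (j1) (j2) (j3) (j4);
  rewrite /Jm (extra1 xX) (extra1 xX') !(extra_g 1 xX) !(extra_g 1 xX') => k1 k2 k3 k4;
  have [g1 g2] := gz x xX; have [g1' g2'] := gz x' xX'.
- rewrite !extra_Xi// goodBZl//; last exact: goodZ.
  by rewrite goodBZr// k1 !mulr0.
- by rewrite extra_Xi// extra_g// goodBZl.
- by rewrite extra_g// extra_Xi// goodBZr.
- by rewrite !extra_g// k2 mulr0.
Qed.

Variable S0 : R.
Hypothesis S0P : forall tt c : R -> R,
    (forall a', a' \in s -> \sum_(a <- s) tt a * B (t a) (t a') +
       \sum_(b <- Y) c b * B (y b) (t a') = 0) ->
    (forall c', c' \in Y -> \sum_(a <- s) tt a * B (t a) (y c') +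
       \sum_(b <- Y) c b * (B (y b) (y c') + S0 * Jm b c') = 0) ->
    (forall b, b \in Y -> c b = 0) /\ exists k, forall a, a \in s -> tt a = k.

Definition yhat b (x : R) := y b x + extra S0 b x.

Lemma yhatP b : b \in Y ->
  [/\ good w (yhat b), itv_int (- w) w (yhat b) = d b,
      forall v, v \in Gam -> yhat b v = (b == v)%:R &
      forall v, yhat b v != 0 -> `|v - b| <= 2 * eps].
Proof.
have [w_gt0 r_gt0 r_le] : [/\ 0 < w, 0 < r & 3 * r <= eps] by [].
move=> bY; have [gy _ ysup yint] := yP bY; have [ge eint enod esup _] := extraP S0 bY.
split.
- exact: goodD.
- by rewrite itv_intD ?yint ?eint ?addr0//; [exact: good_BV gy|exact: good_BV ge].
- by move=> v vG; rewrite /yhat enod// y_nodal// addr0.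
- move=> v; have [yv|/ysup] := eqVneq (y b v) 0; last by lra.
  by rewrite /yhat yv add0r => /esup; lra.
Qed.

Lemma yhat_t a b : a \in s -> b \in Y ->
  B (t a) (yhat b) = B (t a) (y b) /\ B (yhat b) (t a) = B (y b) (t a).
Proof.
move=> aS bY; have [gy _ _ _] := yP bY; have [ge _ _ _ eu] := extraP S0 bY.
have [e1 e2] := eu _ (t_funcs aS); have gt := t_good aS.
rewrite /yhat (goodBDl gy ge gt) (goodBDr (t a) gy ge).
rewrite e1 e2 !addr0; exact: (conj erefl erefl).
Qed.

Lemma yhat_yhat b c : b \in Y -> c \in Y ->
  B (yhat b) (yhat c) = B (y b) (y c) + S0 * Jm b c.
Proof.
move=> bY cY; have [gy _ _ _] := yP bY; have [ge _ _ _ eu] := extraP S0 bY.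
have [gy' _ _ _] := yP cY; have [ge' _ _ _ eu'] := extraP S0 cY.
have [e1 e2] := eu _ (y_funcs cY); have [e1' e2'] := eu' _ (y_funcs bY).
rewrite /yhat goodBDl//; last exact: goodD.
rewrite (goodBDr (y b) gy' ge') (goodBDr (extra S0 b) gy' ge') e1 e2'.
by rewrite addr0 add0r (extra_pairing S0 bY cY).
Qed.

(** [yhat b] is already nodal on the whole grid; subtracting the values of [t a] at the extra nodes
    makes the remaining functions vanish there. *)
Definition sigma a : R -> R :=
  if a \in s then (fun x => t a x - \sum_(b <- Y) t a b * yhat b x) else yhat a.

Lemma sigma_s a : a \in s -> sigma a = fun x => t a x - \sum_(b <- Y) t a b * yhat b x.
Proof. by rewrite /sigma => ->. Qed.

Lemma sigma_Y b : b \in Y -> sigma b = yhat b.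
Proof. by move=> bY; rewrite /sigma (negbTE (YNs bY)). Qed.

Lemma good_ysum a : good w (fun x => \sum_(b <- Y) t a b * yhat b x).
Proof. by apply: good_sum => b bY; case: (yhatP bY). Qed.

Lemma sum_nodal_map (l : seq R) (c : R -> R) (F : R -> R) j : uniq l -> j \in l ->
  (forall i, i \in l -> F i = (i == j)%:R) -> \sum_(i <- l) c i * F i = c j.
Proof.
move=> ul jl h; rewrite -[RHS](sum_nodal c ul jl); apply: eq_big_seq => i il.
by rewrite h.
Qed.

Lemma uY : uniq Y.
Proof. by move: uG; rewrite cat_uniq => /and3P[]. Qed.

Lemma good_sigma a : a \in Gam -> good w (sigma a).
Proof.
rewrite mem_cat => /orP[aS|aY]; last by rewrite sigma_Y//; case: (yhatP aY).
by rewrite sigma_s//; apply: goodB; [exact: t_good|exact: good_ysum].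
Qed.

Lemma sigma_nodal a b : a \in Gam -> b \in Gam -> sigma a b = (a == b)%:R.
Proof.
move=> aG bG; move: (aG); rewrite mem_cat => /orP[aS|aY]; last first.
  by rewrite sigma_Y//; case: (yhatP aY) => _ _ ->.
rewrite sigma_s//; move: (bG); rewrite mem_cat => /orP[bS|bY].
  rewrite t_nodal// big_seq big1 ?subr0// => c cY.
  have [_ _ -> // _] := yhatP cY; case: eqVneq => [E|]; last by rewrite mulr0.
  by move: (YNs cY); rewrite E bS.
rewrite (@sum_nodal_map _ (t a) (fun c => yhat c b) b uY bY) ?subrr.
  by case: eqVneq => // E; move: (YNs bY); rewrite -E aS.
by move=> i iY; have [_ _ -> //] := yhatP iY.
Qed.

(** As [yhat b] has integral [d b], the integral of [sigma a] for [a] in [s] is exactly the gap in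
    [d_int]. *)
Lemma sigma_int a : a \in Gam -> (forall b, b \in Y -> 0 < d b) ->
  0 < itv_int (- w) w (sigma a).
Proof.
rewrite mem_cat => /orP[aS|aY] d0; last first.
  by rewrite sigma_Y//; case: (yhatP aY) => _ -> _ _; exact: d0.
rewrite sigma_s//.
have -> : itv_int (- w) w (fun x => t a x - \sum_(b <- Y) t a b * yhat b x) =
    itv_int (- w) w (t a) - itv_int (- w) w (fun x => \sum_(b <- Y) t a b * yhat b x).
  apply: RintegralB => //; apply: BV_integrable; first exact: good_BV (t_good aS).
  exact: good_BV (good_ysum a).
rewrite itv_int_sum => [|b /yhatP[/good_BV]//].
rewrite subr_gt0; apply: le_lt_trans (d_int aS).
rewrite le_eqVlt; apply/orP; left; apply/eqP; apply: eq_big_seq => b bY.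
by have [_ -> _ _] := yhatP bY; rewrite mulrC.
Qed.

Lemma sigma_sum f x : (forall x, f (clamp w x) = \sum_(a <- s) f (clamp w a) * t a x) ->
  f (clamp w x) = \sum_(a <- Gam) f a * sigma a x.
Proof.
move=> fE; have cl a : a \in Gam -> clamp w a = a.
  by move=> aG; exact: clamp_id (G_itv aG).
have sG a : a \in s -> a \in Gam by rewrite mem_cat => ->.
rewrite big_cat /= (eq_big_seq (fun a => f a * t a x -
   f a * \sum_(b <- Y) t a b * yhat b x)); last first.
  by move=> a aS; rewrite sigma_s// mulrBr.
rewrite sumrB [X in _ = _ + X](eq_big_seq (fun b => f b * yhat b x)); last first.
  by move=> b bY; rewrite sigma_Y.
have -> : \sum_(a <- s) f a * t a x = f (clamp w x).
  by rewrite fE; apply: eq_big_seq => a aS; rewrite cl// sG.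
suff -> : \sum_(a <- s) f a * \sum_(b <- Y) t a b * yhat b x =
    \sum_(b <- Y) f b * yhat b x by rewrite subrK.
under eq_bigr do rewrite mulr_sumr.
rewrite exchange_big /=; apply: eq_big_seq => b bY.
rewrite -(cl b (YG bY)) fE mulr_suml; apply: eq_big_seq => a aS.
by rewrite mulrA (cl a (sG a aS)) (cl b (YG bY)).
Qed.

Lemma sigma_one x : \sum_(a <- Gam) sigma a x = 1.
Proof.
have := @sigma_sum (fun=> 1) x; rewrite /= => -> .
  by apply: eq_bigr => a _; rewrite mul1r.
by move=> v; rewrite {1}(t_sum v); apply: eq_bigr => a _; rewrite mul1r.
Qed.

Lemma sigma_supp a x : a \in Gam -> - w <= x <= w -> sigma a x != 0 -> `|x - a| <= 3 * eps.
Proof.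
have [w_gt0 r_gt0 r_le] : [/\ 0 < w, 0 < r & 3 * r <= eps] by [].
have e0 : 0 <= eps by lra.
rewrite mem_cat => /orP[aS|aY] xw; last first.
  by rewrite sigma_Y//; have [_ _ _ h] := yhatP aY; move/h; lra.
rewrite sigma_s//; have [tx|tx _] := eqVneq (t a x) 0; last first.
  by have := t_loc aS xw tx; lra.
rewrite tx sub0r oppr_eq0 => hs.
(* A nonzero correction at [x] comes from an extra node [b] with [t a b] nonzero: [b] is within
   [eps] of [a], and [x] within [2 * eps] of [b]. *)
have [b bY hb] : exists2 b, b \in Y & t a b * yhat b x != 0.
  apply: contrapT => nh; move/eqP: hs; apply; rewrite big_seq big1// => b bY.
  by apply/eqP/negPn/negP => hb; apply: nh; exists b.
move: hb; rewrite mulf_eq0 negb_or => /andP[hb1 hb2].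
have [_ _ _ /(_ _ hb2) h2] := yhatP bY.
have h1 := t_loc aS (G_itv (YG bY)) hb1.
rewrite (_ : x - a = (x - b) + (b - a)); last by ring.
by apply: le_trans (ler_normD _ _) _; lra.
Qed.

Lemma sigma_far a x : a \in Gam -> x \in Gam -> 6 * eps < `|a - x| ->
  B (sigma a) (sigma x) = 0.
Proof.
have [w_gt0 r_gt0 r_le] : [/\ 0 < w, 0 < r & 3 * r <= eps] by [].
move=> aG xG h; apply: (@bder_far R w w0 _ _ a x (3 * eps)); last by lra.
- exact: good_sigma.
- exact: good_sigma.
- exact: G_itv.
- by move=> v; exact: sigma_supp.
- by move=> v; exact: sigma_supp.
Qed.

(** The nodal functions sum to the constant 1, whose derivative is zero. *)
Lemma sigma_colsum x : x \in Gam -> \sum_(a <- Gam) B (sigma a) (sigma x) = 0.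
Proof.
move=> xG; have gx := good_sigma xG.
have := @goodB_suml R w (sigma x) R Gam sigma (fun=> 1) gx good_sigma.
under [X in _ = X -> _]eq_bigr do rewrite mul1r.
move=> <-; rewrite (_ : (fun _ => _) = fun=> 1).
  by apply: bder_cstl; exact: good_BV gx.
by apply/funext => v; rewrite -[RHS](sigma_one v); apply: eq_bigr => a _; rewrite mul1r.
Qed.

(** In the basis of the [t a] and [yhat b], of the same span, the equations become the block system
    of [S0P], with [c'] as coefficients of the [yhat b]. *)
Lemma sigma_kernel c :
  (forall x, x \in Gam -> \sum_(a <- Gam) c a * B (sigma a) (sigma x) = 0) ->
  exists C, forall a, a \in Gam -> c a = C.
Proof.
move=> hc; pose u x := \sum_(a <- Gam) c a * sigma a x.
pose c' b := c b - \sum_(a <- s) c a * t a b.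
have gyh b : b \in Y -> good w (yhat b) by case/yhatP.
have gu : good w u by apply: good_sum => a; exact: good_sigma.
have Bu x : x \in Gam -> B u (sigma x) = 0.
  move=> xG; rewrite /u goodB_suml; [exact: hc|exact: good_sigma|].
  by move=> a; exact: good_sigma.
have Buy b : b \in Y -> B u (yhat b) = 0.
  by move=> bY; rewrite -sigma_Y// Bu// YG.
have But a : a \in s -> B u (t a) = 0.
  move=> aS; have aG : a \in Gam by rewrite mem_cat aS.
  have -> : t a = fun x => sigma a x + \sum_(b <- Y) t a b * yhat b x.
    by rewrite sigma_s//; apply/funext => x; rewrite subrK.
  rewrite goodBDr ?Bu ?add0r//; [|exact: good_sigma|exact: good_ysum].
  by rewrite goodB_sumr// big_seq big1// => b bY; rewrite Buy ?mulr0.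
have uE : u = fun x => \sum_(a <- s) c a * t a x + \sum_(b <- Y) c' b * yhat b x.
  apply/funext => x; rewrite /u big_cat /=.
  rewrite (eq_big_seq (fun a => c a * t a x - c a * \sum_(b <- Y) t a b * yhat b x)); last first.
    by move=> a aS; rewrite sigma_s// mulrBr.
  rewrite sumrB -addrA; congr (_ + _).
  rewrite [X in _ + X = _](eq_big_seq (fun b => c b * yhat b x)); last first.
    by move=> b bY; rewrite sigma_Y.
  rewrite addrC; under [X in _ - X]eq_bigr do rewrite mulr_sumr.
  rewrite exchange_big /= -sumrB; apply: eq_bigr => b _.
  rewrite /c' mulrBl mulr_suml; congr (_ - _); apply: eq_bigr => a _.
  by rewrite mulrA.
have Bexp v : good w v -> B u v =
    \sum_(a <- s) c a * B (t a) v + \sum_(b <- Y) c' b * B (yhat b) v.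
  move=> gv; rewrite uE goodBDl//; [|by apply: good_sum => a; exact: t_good|by apply: good_sum].
  by rewrite !goodB_suml// => a; exact: t_good.
have [||c'0 [k hk]] := @S0P c c'.
- move=> a aS; rewrite -[RHS](But a aS) Bexp; last exact: t_good.
  rewrite [X in _ = _ + X](eq_big_seq (fun b => c' b * B (y b) (t a))) => [|b bY].
    by [].
  by rewrite (yhat_t aS bY).2.
- move=> b bY; rewrite -[RHS](Buy b bY) Bexp; last exact: gyh.
  congr (_ + _); apply: eq_big_seq => a aS; first by rewrite (yhat_t aS bY).1.
  by rewrite yhat_yhat.
(* At an extra node [c' = 0] says that [c] interpolates its values on [s]; these are all [k], and
   the [t] sum to 1. *)
exists k => a; rewrite mem_cat => /orP[aS|aY]; first exact: hk.
have /eqP := c'0 a aY; rewrite subr_eq0 => /eqP ->.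
rewrite (eq_big_seq (fun b => k * t b a)); last by move=> b bS; rewrite hk.
by rewrite -mulr_sumr -t_sum mulr1.
Qed.

End Assembly.

(** * Choice of weights, scale and extra nodes; extension to the whole line *)

Lemma sum_sublist (R : realType) (s Y : seq R) (F : R -> R) :
  uniq s -> uniq Y -> {subset s <= Y} ->
  \sum_(b <- Y) (if b \in s then F b else 0) = \sum_(p <- s) F p.
Proof.
move=> us uY sY; rewrite [RHS](perm_big [seq b <- Y | b \in s]) /=; last first.
  apply: uniq_perm => //; first exact: filter_uniq.
  move=> b; rewrite mem_filter; have [bs|] := boolP (b \in s) => //.
  by rewrite (sY b bs).
by rewrite big_filter [RHS]big_mkcond.
Qed.

(** The weights are extended by 0 and raised by a small constant: this makes them positive at every
    extra node, and the strict inequalities survive. *)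
Lemma positive_weights (R : realType) (s ps Y : seq R) (d0 I : R -> R) (t : R -> R -> R) :
  uniq ps -> uniq Y -> {subset ps <= Y} -> (forall p, p \in ps -> 0 <= d0 p) ->
  (forall a, a \in s -> \sum_(p <- ps) d0 p * t a p < I a) ->
  exists d : R -> R, (forall b, b \in Y -> 0 < d b) /\
    forall a, a \in s -> \sum_(b <- Y) d b * t a b < I a.
Proof.
move=> ups uY psY d00 hI; pose d1 b := if b \in ps then d0 b else 0.
have d1E a : \sum_(b <- Y) d1 b * t a b = \sum_(p <- ps) d0 p * t a p.
  rewrite -(sum_sublist (fun p => d0 p * t a p) ups uY psY); apply: eq_bigr => b _.
  by rewrite /d1; case: ifP => // _; rewrite mul0r.
have [|del del0 hd] := @eventually_all R _ s (fun a tau => \sum_(b <- Y) (d1 b + tau) * t a b < I a).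
  move=> a aS; pose T := \sum_(b <- Y) `|t a b|.
  have T0 : 0 < T + 1 by rewrite ltr_wpDl// sumr_ge0.
  exists ((I a - \sum_(p <- ps) d0 p * t a p) / (T + 1)).
    by rewrite divr_gt0// subr_gt0 hI.
  move=> tau /andP[tau0]; rewrite ltr_pdivlMr// => htau.
  under eq_bigr do rewrite mulrDl.
  rewrite big_split /= d1E -mulr_sumr.
  have : tau * \sum_(b <- Y) t a b <= tau * T.
    by rewrite ler_pM2l//; apply: ler_sum => b _; exact: ler_norm.
  have : tau * (T + 1) = tau * T + tau by rewrite mulrDr mulr1.
  by lra.
exists (fun b => d1 b + del / 2); split.
  move=> b _; apply: ltr_wpDl; last by rewrite divr_gt0.
  by rewrite /d1; case: ifP => // /d00.
by move=> a aS; apply: hd => //; apply/andP; split; lra.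
Qed.

Lemma separation (R : realType) (s : seq R) (eps : R) : 0 < eps ->
  exists2 r, 0 < r & 3 * r <= eps /\
    forall a b, a \in s -> b \in s -> a != b -> 8 * r < `|a - b|.
Proof.
move=> e0.
have [|d d0 hd] := @eventually_all R _ [seq (a, b) | a <- s, b <- s]
    (fun ab r => ab.1 != ab.2 -> 8 * r < `|ab.1 - ab.2|).
  move=> _ /allpairsP[[a b] [/= aS bS ->]] /=; have [_|ab] := eqVneq a b.
    by exists 1.
  have ab0 : 0 < `|a - b| by rewrite normr_gt0 subr_eq0.
  by exists (`|a - b| / 8) => [|r /andP[_ hr] _]; lra.
have m0 : 0 < Num.min (d / 2) (eps / 3) by rewrite lt_min !divr_gt0.
have m1 : Num.min (d / 2) (eps / 3) <= d / 2 by rewrite ge_min lexx.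
have m2 : Num.min (d / 2) (eps / 3) <= eps / 3 by rewrite ge_min lexx orbT.
move: (Num.min _ _) m0 m1 m2 => r r0 r1 r2; exists r => //; split; first by lra.
move=> a b aS bS; apply: (hd (a, b)); first by apply/allpairsP; exists (a, b).
by apply/andP; split; lra.
Qed.

Lemma clamped_grid (R : realType) (w eps : R) (ws : seq (R -> R)) (P : seq R) :
  0 < w -> 0 < eps -> (forall f, f \in ws -> good w f) ->
  (forall p, p \in P -> - w <= p <= w) ->
  exists (G : seq R) (sg : R -> R -> R),
  [/\ [/\ uniq G, w \in G, - w \in G, forall a, a \in G -> - w <= a <= w & {subset P <= G}],
      (forall a, a \in G -> [/\ good w (sg a), forall b, b \in G -> sg a b = (a == b)%:R &
         0 < itv_int (- w) w (sg a)]) /\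
      (forall f x, f \in ws -> f (clamp w x) = \sum_(a <- G) f a * sg a x),
      forall a x, a \in G -> x \in G -> eps < `|a - x| -> bder w (sg a) (sg x) = 0,
      forall x, x \in G -> \sum_(a <- G) bder w (sg a) (sg x) = 0 &
      forall c, (forall x, x \in G -> \sum_(a <- G) c a * bder w (sg a) (sg x) = 0) ->
        exists C, forall a, a \in G -> c a = C].
Proof.
(* Nodal supports have radius [3 * ep], so pairings vanish beyond [6 * ep], which is below [eps]. *)
move=> w0 e0 wsg Pw; pose ep := eps / 8.
have ep0 : 0 < ep by rewrite divr_gt0.
have [s [t [[us sw] tP tloc [tws t1] tker]]] := grid_stage w0 ep0 wsg.
have gt a : a \in s -> good w (t a) by move=> /tP[].
have nt a b : a \in s -> b \in s -> t a b = (a == b)%:R.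
  by move=> aS bS; have [_ /(_ b bS)[]] := tP a aS.
have [|||ps [d0 [ups psP psI]]] := @quadrature R w s t w0 us.
- exact: sw.
- by move=> a /gt/good_BV.
- by move=> a b aS bS; have [_ /(_ b bS)] := tP a aS.
(* Points are forced into the grid by declaring them extra nodes: the quadrature points, the
   prescribed points and both ends. *)
pose Xi := [seq x <- undup (ps ++ P ++ [:: w; - w]) | x \notin s].
have Xw x : x \in Xi -> - w <= x <= w.
  rewrite mem_filter mem_undup !mem_cat => /andP[_ /or3P[/psP[]//|/Pw//|]].
  by rewrite !inE => /orP[] /eqP ->; rewrite lexx opp_le_self.
have uX : uniq Xi by rewrite filter_uniq// undup_uniq.
(* The symplectic perturbation couples the nodes in twos, so every extra node gets a companion that
   carries the second function of its pair. *)
have [g [ginj gN gw gloc]] := @companions R w ep s Xi w0 ep0 Xw.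
pose Y := Xi ++ map g Xi.
have uY : uniq Y.
  rewrite cat_uniq uX map_inj_uniq// uX andbT /=; apply/hasPn => _ /mapP[x xX ->].
  by apply: contra (gN x xX); rewrite mem_cat => ->; rewrite orbT.
have uG : uniq (s ++ Y).
  rewrite cat_uniq us uY andbT /=; apply/hasPn => y; rewrite mem_cat => /orP[].
    by rewrite mem_filter => /andP[].
  move=> /mapP[x xX ->]; apply: contra (gN x xX) => gs; by rewrite mem_cat gs.
have inXi x : x \in ps ++ P ++ [:: w; - w] -> x \in s ++ Y.
  move=> xl; rewrite 2!mem_cat; have [//|xs] := boolP (x \in s).
  by rewrite mem_filter xs mem_undup xl.
have wG : w \in s ++ Y by apply: inXi; rewrite !mem_cat !inE eqxx !orbT.
have wG' : - w \in s ++ Y by apply: inXi; rewrite !mem_cat !inE eqxx !orbT.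
have PG : {subset P <= s ++ Y} by move=> x xP; apply: inXi; rewrite !mem_cat xP orbT.
have Gw a : a \in s ++ Y -> - w <= a <= w.
  rewrite 2!mem_cat => /or3P[/sw/andP[? ?]|/Xw//|/mapP[x xX ->]]; last exact: gw.
  by rewrite !ltW.
have psY : {subset ps <= Y}.
  move=> p pp; have [_ ps' _] := psP p pp; rewrite mem_cat mem_filter ps'.
  by rewrite mem_undup mem_cat pp.
have d00 p : p \in ps -> 0 <= d0 p by move=> /psP[].
have [d [dpos dI]] := positive_weights ups uY psY d00 psI.
have [r r0 [re sep]] := separation (s ++ Y) ep0.
have [y yP] := node_steps w0 r0 re d Gw wG wG' sep.
have [z zP] := isotropic_pairs w0 r0 re gt Gw wG wG' sep yP.
have [|||S0 S0P] := @schur_list R s Xi g (fun a b => bder w (t a) (t b))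
  (fun b a => bder w (y b) (t a)) (fun a b => bder w (t a) (y b))
  (fun b c => bder w (y b) (y c)) (Jm w Xi g z) us uX.
- move=> c hc; apply: tker => b bS; rewrite goodB_suml; [exact: hc|exact: gt|exact: gt].
- move=> b bY; have [gy _ _ _] := yP b bY.
  have := @goodB_suml R w (y b) R s t (fun=> 1) gy gt.
  under [X in _ = X -> _]eq_bigr do rewrite mul1r.
  move=> <-; rewrite (_ : (fun _ => _) = fun=> 1).
    by apply: bder_cstl; exact: good_BV gy.
  by apply/funext => v; rewrite [RHS](t1 v); apply: eq_bigr => a _; rewrite mul1r.
- move=> x x' xX xX'; exact: (JmP w0 r0 re ginj uG Gw sep zP xX xX').
pose sg := sigma s Xi t g y z S0.
have e8 : 6 * ep < eps by rewrite /ep; lra.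
exists (s ++ Y), sg; split => //.
- split=> [a aG|f x fw]; first split.
  + exact: (good_sigma w0 r0 re gt ginj gloc uG sep yP zP S0 aG).
  + by move=> b bG; exact: (sigma_nodal w0 r0 re gt nt ginj gloc uG sep yP zP S0 aG bG).
  + exact: (sigma_int w0 r0 re gt ginj gloc uG sep dI yP zP S0 aG dpos).
  + apply: (sigma_sum uG Gw); by move=> v; exact: tws.
- move=> a x aG xG ax; have ax' : 6 * ep < `|a - x| by apply: lt_trans ax.
  exact: (sigma_far w0 r0 re gt tloc ginj gloc uG Gw sep yP zP S0 aG xG ax').
- move=> x xG; exact: (sigma_colsum w0 r0 re gt t1 ginj gloc uG Gw sep yP zP S0 xG).
- move=> c hc.
  exact: (sigma_kernel w0 r0 re gt t1 ginj gloc uG Gw sep yP zP S0P hc).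
Qed.

(** [nodal_basis] with a single piece: an interpolation on the whole line, needed where localisation
    to [[- w, w]] loses information. *)
Lemma unisolvent (R : realType) (ws : seq (R -> R)) : (forall f, f \in ws -> epilogic f) ->
  exists (s : seq R) (e : R -> R -> R),
  [/\ uniq s, forall a, a \in s -> epilogic (e a),
      forall a x, a \in s -> ~ disc ws x -> {for x, continuous (e a)} &
      forall f x, f \in ws -> f x = \sum_(a <- s) f a * e a x].
Proof.
move=> ews.
pose L (_ : unit) := @epilogic R `&` [set f | forall x, (~` disc ws) x -> {for x, continuous f}].
have [| | | |s [e [us _ sL _ sE]]] :=
    @nodal_basis R unit setT (fun=> tt) L [seq (tt, f) | f <- ws].
- move=> k; apply: lin_closedI; last exact: continuous_on_lin.
  split=> [|c f g ef eg]; first exact: epilogic_cst.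
  by apply: epilogicD => //; exact: epilogicZ.
- by case.
- by move=> _ f _ h x; exact: h.
- move=> i iN d; have /mapP[f fw ->] := mem_nth d iN.
  split; first exact: ews.
  by move=> x nd; apply: contrapT => h; apply: nd; exists f.
exists s, e; split => //.
- by move=> a /sL[].
- by move=> a x /sL[_ h] nd; exact: h.
- move=> f x fw; have : (tt, f) \in [seq (tt, f) | f <- ws] by exact: map_f.
  move=> /(nthP (tt, fun=> 0))[i iN iE].
  by have := sE i iN (tt, fun=> 0) x; rewrite iE.
Qed.

Lemma list_bounded (R : realType) (l : seq R) : exists M, 0 <= M /\ forall x, x \in l -> `|x| <= M.
Proof.
elim: l => [|y l [M [M0 hM]]]; first by exists 0.
exists (`|y| + M); split; first by rewrite addr_ge0.
by move=> x; rewrite inE => /predU1P[->|/hM]; [rewrite lerDl|move=> h; rewrite (le_trans h)// lerDr].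
Qed.

(** [clamped_grid] reproduces the given functions on the interval only, while the subspace must
    contain them as functions on the line. The nodes of [unisolvent] are therefore put into the
    grid. *)
Theorem nodal_system (R : realType) (ws : seq (R -> R)) (P : seq R) (eps : R) :
  (forall f, f \in ws -> epilogic f) -> 0 < eps ->
  exists (G : seq R) (w : R) (sg : R -> R -> R),
  [/\ [/\ uniq G, w \in G, - w \in G, forall a, a \in G -> - w <= a <= w & {subset P <= G}],
      (forall a, a \in G -> [/\ epilogic (sg a), forall b, b \in G -> sg a b = (a == b)%:R &
         0 < itv_int (- w) w (sg a)]) /\
      (forall f x, f \in ws -> f x = \sum_(a <- G) f a * sg a x),
      (forall a x, a \in G -> x \in G -> eps < `|a - x| -> bder w (sg a) (sg x) = 0) /\
      (forall u c, (forall x, u x = \sum_(a <- G) c a * sg a x) -> forall x, x \in G ->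
        bder w u (sg x) = \sum_(a <- G) c a * bder w (sg a) (sg x)),
      forall x, x \in G -> \sum_(a <- G) bder w (sg a) (sg x) = 0 &
      forall c, (forall x, x \in G -> \sum_(a <- G) c a * bder w (sg a) (sg x) = 0) ->
        exists C, forall a, a \in G -> c a = C].
Proof.
move=> ews e0; have [s [e [us es ces wsE]]] := unisolvent ews.
have [M [M0 hM]] := list_bounded (s ++ P).
have cd : countable (disc ws) by apply: disc_countable => f /ews[].
have cE : countable (disc ws `|` -%R @` disc ws).
  rewrite -bigcup2E; apply: bigcup_countable => // -[|[|n]] _ /=.
  + exact: cd.
  + by apply: sub_countable cd; exact: card_image_le.
  + exact: countable0.
(* [w] lies beyond all required points, and all given functions are continuous at both [w] and
   [- w]. *)
have [w [/andP[wM _] wE]] := @countable_avoid R M (M + 1) _ (ltac:(lra)) cE.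
have w0 : 0 < w by lra.
have dw : ~ disc ws w by move=> h; apply: wE; left.
have dw' : ~ disc ws (- w) by move=> h; apply: wE; right; exists (- w) => //; rewrite opprK.
have lw x : x \in s ++ P -> - w <= x <= w.
  by move=> /hM h; rewrite -ler_norml; apply: le_trans h _; exact: ltW.
have gws f : f \in ws -> good w f.
  move=> fw; split; first exact: ews.
    by apply: contrapT => h; apply: dw; exists f.
  by apply: contrapT => h; apply: dw'; exists f.
have ge a : a \in s -> good w (e a) by move=> aS; split; [exact: es|exact: ces|exact: ces].
have [G [sg [[uG wG wG' Gw PG] [sgP sgE] far colsum ker]]] := clamped_grid w0 e0 gws lw.
(* Off [-w, w] the pairing is blind, so the basis can be corrected there. *)
pose h a x := if a \in s then e a x - e a (clamp w x) else 0.
have gh a : good w (h a).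
  rewrite /h; have [aS|aS] := boolP (a \in s); last exact: good_cst.
  by apply: (goodB (ge a aS)); apply: (good_clamp w0); exact: ge.
have h0 a x : - w <= x <= w -> h a x = 0.
  by move=> xw; rewrite /h clamp_id// subrr if_same.
pose sg' a x := sg a x + h a x.
have sgw a x : - w <= x <= w -> sg' a x = sg a x.
  by move=> xw; rewrite /sg' h0// addr0.
have gsg a : a \in G -> good w (sg a) by move=> /sgP[].
have gsg' a : a \in G -> good w (sg' a) by move=> aG; apply: goodD; [exact: gsg|exact: gh].
have Bsg a x : a \in G -> x \in G -> bder w (sg' a) (sg' x) = bder w (sg a) (sg x).
  move=> aG xG; rewrite (bder_eqr _ (v2 := sg x)); last by move=> v; exact: sgw.
  rewrite (goodBDl (gsg a aG) (gh a) (gsg x xG)).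
  rewrite (good_bder_eql w0 (gh a) (gsg x xG)) ?addr0// => v; exact: h0.
exists G, w, sg'; split.
- by split=> // x xP; apply: PG; rewrite mem_cat xP orbT.
- split=> [a aG|f x fw].
    have [gs ns si] := sgP a aG; split.
    + by case: (gsg' a aG).
    + by move=> b bG; rewrite sgw ?ns//; exact: Gw.
    + rewrite (@eq_itv_int _ _ _ _ (sg a))// => v; exact: sgw.
  rewrite /sg'; under eq_bigr do rewrite mulrDr.
  rewrite big_split /= -sgE//.
  (* The corrections add the interpolant of [f] at [x] and remove the one at [clamp w x]; by [wsE]
     these are [f x] and [f (clamp w x)]. *)
  rewrite (eq_bigr (fun a => if a \in s then f a * e a x - f a * e a (clamp w x) else 0)).
    rewrite sum_sublist//; last by move=> y ys; apply: PG; rewrite mem_cat ys.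
    by rewrite sumrB -!wsE// addrC subrK.
  by move=> a _; rewrite /h; case: ifP => _; rewrite ?mulr0// mulrBr.
- split=> [a x aG xG ax|u c uE x xG]; first by rewrite Bsg// far.
  rewrite (_ : u = fun x => \sum_(a <- G) c a * sg' a x); last exact/funext.
  by rewrite (goodB_suml _ (gsg' x xG) gsg').
- move=> x xG; rewrite -[RHS](colsum x xG); apply: eq_big_seq => a aG.
  exact: Bsg.
- move=> c hc; apply: ker => x xG; rewrite -[RHS](hc x xG); apply: eq_big_seq => a aG.
  by rewrite Bsg.
Qed.

(** * Passage to the limit *)

Section Transfer.
Variables (R : realType) (L : bigset R) (U : fine_ultrafilter L).
Variables (Gs : {fset L} -> seq R) (w : {fset L} -> R) (sg : {fset L} -> R -> R -> R).

Definition gridn l : {fset R} := seq_fset tt (Gs l).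
Notation Gn := gridn.

Lemma gridnE l a : (a \in Gn l) = (a \in Gs l).
Proof. exact: seq_fsetE. Qed.

Definition spann l : set (R -> R) :=
  [set f | exists c : R -> R, forall x, f x = \sum_(a <- Gs l) c a * sg l a x].
Notation Vn := spann.
Notation plim := (lam_lim U).
Notation d := (fun l a => itv_int (- w l) (w l) (sg l a)).
Notation B := (fun l => bder (w l)).

Hypothesis Gs_uniq : forall l, uniq (Gs l).
Hypothesis Gs_w : forall l, w l \in Gs l.
Hypothesis Gs_wN : forall l, - w l \in Gs l.
Hypothesis Gs_itv : forall l a, a \in Gs l -> - w l <= a <= w l.
Hypothesis sg_epi : forall l a, a \in Gs l -> epilogic (sg l a).
Hypothesis sg_nodal : forall l a b, a \in Gs l -> b \in Gs l -> sg l a b = (a == b)%:R.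
Hypothesis sg_int : forall l a, a \in Gs l -> 0 < d l a.
Hypothesis sg_comb : forall l u c, (forall x, u x = \sum_(a <- Gs l) c a * sg l a x) ->
  forall x, x \in Gs l -> B l u (sg l x) = \sum_(a <- Gs l) c a * B l (sg l a) (sg l x).
Hypothesis sg_colsum : forall l x, x \in Gs l ->
  \sum_(a <- Gs l) B l (sg l a) (sg l x) = 0.
Hypothesis sg_ker : forall l c,
  (forall x, x \in Gs l -> \sum_(a <- Gs l) c a * B l (sg l a) (sg l x) = 0) ->
  exists C, forall a, a \in Gs l -> c a = C.

Lemma spann_coef l f c : (forall x, f x = \sum_(a <- Gs l) c a * sg l a x) ->
  forall a, a \in Gs l -> f a = c a.
Proof.
move=> fE a aG; rewrite fE -[RHS](sum_nodal c (Gs_uniq l) aG).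
by apply: eq_big_seq => b bG; rewrite sg_nodal.
Qed.

Lemma spannP l f : Vn l f -> forall x, f x = \sum_(a <- Gs l) f a * sg l a x.
Proof.
move=> [c fE] x; rewrite fE; apply: eq_big_seq => a aG.
by rewrite (spann_coef fE aG).
Qed.

Lemma spann_eq l f g : Vn l f -> Vn l g -> (forall a, a \in Gs l -> f a = g a) -> f = g.
Proof.
move=> Vf Vg fg; apply/funext => x; rewrite (spannP Vf) (spannP Vg).
by apply: eq_big_seq => a aG; rewrite fg.
Qed.

Lemma spann_sg l a : a \in Gs l -> Vn l (sg l a).
Proof.
move=> aG; exists (fun b => (b == a)%:R) => x.
under eq_bigr do rewrite mulrC.
by rewrite (sum_nodal (fun b => sg l b x) (Gs_uniq l) aG).
Qed.

Lemma spann_lin l : lin_closed (Vn l).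
Proof.
split; first by exists (fun=> 0) => x; rewrite big1// => a _; rewrite mul0r.
move=> c f g [cf fE] [cg gE]; exists (fun a => cf a + c * cg a) => x.
rewrite fE gE mulr_sumr -big_split /=; apply: eq_bigr => a _.
by rewrite mulrDl mulrA.
Qed.

Lemma spannZ l c f : Vn l f -> Vn l (fun x => c * f x).
Proof.
move=> Vf; have := (spann_lin l).2 c _ _ (spann_lin l).1 Vf.
by under eq_fun do rewrite add0r.
Qed.

Lemma findim_spann l : findim_subspace (Vn l).
Proof.
split.
  split; first by rewrite inE; exact: (spann_lin l).1.
  move=> c f g; rewrite !inE => Vf Vg.
  have -> : c *: f + g = fun x => g x + c * f x by apply/funext => x; rewrite addrC.
  exact: (spann_lin l).2.
exists (size (Gs l)), (fun i => sg l (nth 0 (Gs l) i)) => f [c fE].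
exists (fun i => c (nth 0 (Gs l) i)); apply/funext => x.
rewrite fct_sumE fE (big_nth_ord _ (erefl (size (Gs l)))).
by apply: eq_bigr.
Qed.

Lemma spann_epilogic l : Vn l `<=` @epilogic R.
Proof.
move=> f [c fE]; rewrite (_ : f = fun x => \sum_(a <- Gs l) c a * sg l a x); last exact/funext.
apply: (@lin_closed_sum _ (@epilogic R)); last by move=> a aG _; exact: sg_epi.
split=> [|k f' g ef eg]; first exact: epilogic_cst.
by apply: epilogicD => //; exact: epilogicZ.
Qed.

Lemma spann_bij l : set_bij (Vn l) [set: Gn l -> R]
  (fun (f : R -> R) (x : Gn l) => f (val x)).
Proof.
split => //.
- move=> f g; rewrite !inE => Vf Vg fg; apply: (spann_eq Vf Vg) => a aG.
  have aG' : a \in Gn l by rewrite gridnE.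
  exact: (congr1 (fun h : Gn l -> R => h [` aG']%fset) fg).
- move=> h _ /=; pose c a := if insub a is Some x then h x else 0.
  exists (fun x => \sum_(a <- Gs l) c a * sg l a x); first by exists c.
  apply/funext => x; have xG : val x \in Gs l by rewrite -gridnE (valP x).
  rewrite (@spann_coef l _ c (fun=> erefl) _ xG) /c.
  by rewrite valK.
Qed.

Lemma ultra_all (P : set {fset L}) : (forall l, P l) -> U P.
Proof. by move=> h; apply: filterS (filterT) => l _. Qed.

Lemma plim_eq_near (f g : {fset L} -> R) : U [set l | f l = g l] -> plim f = plim g.
Proof. by move/lam_limP. Qed.

Lemma plim_gt0 (f : {fset L} -> R) : U [set l | 0 < f l] -> 0 < plim f.
Proof.
move=> h; rewrite lt_neqAle; apply/andP; split.
  apply/eqP => /lam_limP h'; apply: (@filter_not_empty _ (fine_sets U) _).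
  by apply: filterS2 h h' => l /= h1 h2; move: h1; rewrite -h2 ltxx.
by apply/lam_lim_le; apply: filterS h => l /ltW.
Qed.

(** A net that picks a counterexample at every index having one turns a statement about each net of
    nodes into one about all nodes at once, on a single set of the ultrafilter. *)
Lemma overspill (Q : {fset L} -> R -> Prop) :
  (forall xn, (forall l, xn l \in Gs l) -> U [set l | Q l (xn l)]) ->
  U [set l | forall a, a \in Gs l -> Q l a].
Proof.
move=> h.
have ex l : exists x, x \in Gs l /\ (Q l x -> forall a, a \in Gs l -> Q l a).
  have [hl|/existsNP[a /not_implyP[aG Qa]]] := pselect (forall a, a \in Gs l -> Q l a).
    by exists (w l); split.
  by exists a; split.
have [xn xnP] := choice ex.
apply: filterS (h xn (fun l => (xnP l).1)) => l /= Ql; exact: (xnP l).2.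
Qed.

Notation grid := (grid U Gn).

Definition net_points (x : grid) (xn : {fset L} -> R) :=
  (forall l, xn l \in Gs l) /\ val x = plim xn.

Lemma net_points_exists (x : grid) : exists xn, net_points x xn.
Proof.
have : (val x) \in grid by exact: valP.
rewrite inE => -[xn xnG xE]; exists xn; split => // l.
by rewrite -gridnE; exact: xnG.
Qed.

Lemma net_points_near (x : grid) xn xn' : net_points x xn -> net_points x xn' ->
  U [set l | xn l = xn' l].
Proof. by move=> [_ h] [_ h']; apply/lam_limP; rewrite -h -h'. Qed.

Lemma grid_of xn : (forall l, xn l \in Gs l) -> exists x : grid, net_points x xn.
Proof.
move=> h; have xg : plim xn \in grid.
  by rewrite inE; exists xn => // l; rewrite /= gridnE.
by exists (exist _ (plim xn) xg).
Qed.

Definition repr_net (v : {fset L} -> R -> R) (u : grid -> euclid R U) :=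
  (forall l, Vn l (v l)) /\ forall x xn, net_points x xn -> u x = plim (fun l => v l (xn l)).

Lemma repr_netP v u : represents Vn v u <-> repr_net v u.
Proof.
split=> -[h1 h2]; split=> // x xn.
  by move=> [xG xE]; apply: h2 => // l; rewrite gridnE.
by move=> xG xE; apply: h2; split => // l; rewrite -gridnE.
Qed.

Lemma repr_net_uniq v v' u : repr_net v u -> repr_net v' u -> U [set l | v l = v' l].
Proof.
move=> [V h] [V' h']; have := @overspill (fun l a => v l a = v' l a).
have -> : [set l | v l = v' l] = [set l | forall a, a \in Gs l -> v l a = v' l a].
  apply/seteqP; split=> l /= => [-> //|hl]; exact: (spann_eq (V l) (V' l)).
apply => xn xG; have [x xP] := grid_of xG.
by apply/lam_limP; rewrite -(h x) -?(h' x).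
Qed.

Lemma net_ofP v u : repr_net v u -> U [set l | net_of Vn u l = v l].
Proof.
move=> h; apply: (repr_net_uniq _ h); apply/repr_netP.
exact: (@xgetPex _ (fun _ _ => 0) [set v | represents Vn v u] (ex_intro _ v ((repr_netP v u).2 h))).
Qed.

Lemma V_gridP u : V_grid Vn u <-> exists v, repr_net v u.
Proof. by split=> -[v /repr_netP]; exists v. Qed.

Lemma repr_chi (a : grid) an : net_points a an -> repr_net (fun l => sg l (an l)) (chi a).
Proof.
move=> aP; have [aG aE] := aP; split=> [l|x xn xP]; first exact: spann_sg.
have [xG xE] := xP; rewrite /chi; have [xa|xa] := eqVneq x a.
  apply: plim_eq_near; apply: filterS (net_points_near aP (_ : net_points a xn)) => [l /= E|].
    by rewrite sg_nodal// E eqxx.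
  by rewrite -xa.
(* The ultrafilter decides whether the nets agree; agreement would force [x = a]. *)
have [h|h] := in_ultra_setVsetC [set l | an l = xn l] (fine_ultra U).
  case/eqP: xa; apply: val_inj; rewrite xE aE; apply/esym.
  exact: plim_eq_near.
apply: plim_eq_near; apply: filterS h => l /= /eqP/negbTE E.
by rewrite sg_nodal// E.
Qed.

Lemma volE (a : grid) an : net_points a an -> vol w Vn a = plim (fun l => d l (an l)).
Proof.
move=> aP; apply: plim_eq_near; apply: filterS (net_ofP (repr_chi aP)) => l /= ->.
by [].
Qed.

Lemma vol_gt0 (a : grid) : 0 < vol w Vn a.
Proof.
have [an aP] := net_points_exists a; rewrite (volE aP); apply: plim_gt0.
apply: ultra_all => l; apply: sg_int; exact: aP.1.
Qed.

Lemma repr_delta (a : grid) an : net_points a an ->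
  repr_net (fun l x => (d l (an l))^-1 * sg l (an l) x) (delta w Vn a).
Proof.
move=> aP; have [V h] := repr_chi aP; split=> [l|x xn xP]; first exact: spannZ.
rewrite /delta (h x xn xP) (volE aP) lam_limV lam_limM.
by congr lam_lim; apply/funext => l /=; rewrite mulrC.
Qed.

(** On a set of the ultrafilter the chosen representing nets are the explicit ones, that of
    [delta a] being the nodal function divided by its integral. *)
Lemma gderivE u v (a : grid) an : repr_net v u -> net_points a an ->
  gderiv w Vn u a = plim (fun l => (d l (an l))^-1 * B l (v l) (sg l (an l))).
Proof.
move=> vu aP; apply: plim_eq_near.
apply: filterS2 (net_ofP vu) (net_ofP (repr_delta aP)) => l /= -> ->.
apply: (bderZr (w l)); case: (sg_epi (aP.1 l)) => bv _; exact: bv.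
Qed.

Lemma gderiv_fun : set_fun (V_grid Vn : set (grid -> euclid R U)) (V_grid Vn) (gderiv w Vn).
Proof.
move=> u /V_gridP[v vu]; apply/V_gridP.
exists (fun l x => \sum_(b <- Gs l) ((d l b)^-1 * B l (v l) (sg l b)) * sg l b x).
split=> [l|x xn xP]; first by exists (fun b => (d l b)^-1 * B l (v l) (sg l b)).
rewrite (gderivE vu xP); congr lam_lim; apply/funext => l.
by rewrite (@spann_coef l _ (fun b => (d l b)^-1 * B l (v l) (sg l b)) (fun=> erefl) _ (xP.1 l)).
Qed.

Lemma gderiv_local (a : grid) :
  (forall r : R, 0 < r -> U [set l | forall b x, b \in Gs l -> x \in Gs l ->
     r <= `|b - x| -> B l (sg l b) (sg l x) = 0]) ->
  [set val x | x in [set x | gderiv w Vn (chi a) x != 0]] `<=` monad (val a).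
Proof.
move=> far _ [x /= Dx <-] r r0; rewrite ltNge; apply/negP => hr.
move/eqP: Dx; apply.
have [an aP] := net_points_exists a; have [xn xP] := net_points_exists x.
rewrite (gderivE (repr_chi aP) xP); apply: plim_eq_near.
move: hr; rewrite xP.2 aP.2 lam_limN lam_limD lam_lim_norm => /lam_lim_le hr.
apply: filterS2 hr (far r r0) => l /= hl ->; first by rewrite mulr0.
- exact: aP.1.
- exact: xP.1.
- by rewrite distrC.
Qed.

(** The two directions are the two finite facts about the matrix: its left kernel consists of
    constants, and its columns sum to zero. *)
Lemma gderiv_ker u : V_grid Vn u ->
  (gderiv w Vn u = cst 0 <-> exists c : euclid R U, u = c \*o one_grid U Gn).
Proof.
move=> /V_gridP[v vu]; have [V h] := vu.
have BE l x : x \in Gs l -> B l (v l) (sg l x) = \sum_(a <- Gs l) v l a * B l (sg l a) (sg l x).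
  by move=> xG; apply: sg_comb xG; exact: spannP.
split=> [D0|[c uc]].
  (* [Du = 0] is a statement about one net of nodes at a time, while the kernel lemma needs all
     nodes for the same index. Dividing by the positive integrals loses nothing. *)
  have H : U [set l | forall a, a \in Gs l -> B l (v l) (sg l a) = 0].
    apply: (@overspill (fun l a => B l (v l) (sg l a) = 0)) => xn xG.
    have [x xP] := grid_of xG; have := congr1 (fun f : grid -> _ => f x) D0.
    rewrite (gderivE vu xP) => /lam_limP; apply: filterS => l /= /eqP.
    rewrite mulf_eq0 invr_eq0 => /orP[|/eqP//].
    by rewrite gt_eqF// sg_int// xG.
  exists (plim (fun l => v l (w l))); apply/funext => x; rewrite /one_grid /= mulr1.
  have [xn xP] := net_points_exists x; rewrite (h x xn xP); apply: plim_eq_near.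
  apply: filterS H => l /= Hl.
  have [|C hC] := @sg_ker l (v l).
    by move=> y yG; rewrite -BE// Hl.
  by rewrite !hC//; exact: xP.1.
have [cn cE] : exists cn, c = plim cn by exists (repr c); rewrite lam_lim_repr.
have H : U [set l | forall a, a \in Gs l -> v l a = cn l].
  apply: (@overspill (fun l a => v l a = cn l)) => xn xG.
  have [x xP] := grid_of xG; apply/lam_limP; rewrite -(h x xn xP) uc /=.
  by rewrite /one_grid mulr1 cE.
apply/funext => x; have [xn xP] := net_points_exists x; rewrite (gderivE vu xP).
apply: plim_eq_near; apply: filterS H => l /= Hl.
rewrite BE; last exact: xP.1.
rewrite (eq_big_seq (fun a => cn l * B l (sg l a) (sg l (xn l)))); last first.
  by move=> a aG; rewrite Hl.
by rewrite -mulr_sumr sg_colsum ?mulr0//; exact: xP.1.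
Qed.

Lemma chi_V_grid (a : grid) : V_grid Vn (chi a).
Proof.
have [an aP] := net_points_exists a; apply/V_gridP.
by exists (fun l => sg l (an l)); exact: repr_chi.
Qed.

Lemma gridn_max l : is_max [set` Gn l] (w l) /\ is_min [set` Gn l] (- w l).
Proof.
by split; split; rewrite /= ?gridnE// => x /=; rewrite gridnE => /Gs_itv/andP[].
Qed.

Lemma grid_max : is_max grid (plim w) /\ is_min grid (- plim w).
Proof.
have hw : grid (plim w) by exists w => // l /=; rewrite gridnE.
have hwN : grid (- plim w).
  by exists (\- w); [move=> l /=; rewrite gridnE|rewrite lam_limN].
split; split => // _ [xn xG <-].
  by apply/lam_lim_le; apply: ultra_all => l; have := xG l; rewrite /= gridnE => /Gs_itv/andP[].
rewrite lam_limN; apply/lam_lim_le; apply: ultra_all => l.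
by have := xG l; rewrite /= gridnE => /Gs_itv/andP[].
Qed.

Lemma real_grid : (forall r : R, U [set l | r \in Gs l]) ->
  [set eucl U r | r in [set: R]] `<=` grid.
Proof.
move=> h _ [r _ <-]; exists (fun l => if r \in Gs l then r else w l).
  by move=> l /=; case: ifP; rewrite gridnE.
by apply: plim_eq_near; apply: filterS (h r) => l /= ->.
Qed.

End Transfer.

(** * Finite data of an index and the conclusion *)

Lemma fset_preimage (T A : choiceType) (i : A -> T) (a0 : A) (l : {fset T}) :
  injective i -> exists s : seq A, forall a, i a \in l -> a \in s.
Proof.
move=> iinj; pose h (x : T) : A := xget a0 [set a | i a = x].
exists (map h l) => a al; have -> : a = h (i a); last exact: map_f.
by apply: iinj; rewrite /h (@xgetPex _ a0 [set b | i b = i a])//; exists a.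
Qed.

Lemma positive_lower_bound (R : realType) (s : seq R) :
  exists2 eps : R, 0 < eps & forall r, r \in s -> 0 < r -> eps <= r.
Proof.
elim: s => [|x s [eps e0 he]]; first by exists 1.
have [x0|x0] := ltP 0 x; last first.
  exists eps => // r; rewrite inE => /predU1P[->|]; last exact: he.
  by rewrite ltNge x0.
exists (Num.min x eps); first by rewrite lt_min x0.
move=> r; rewrite inE => /predU1P[->|rs r0]; rewrite ge_min ?lexx//.
by rewrite (he r rs r0) orbT.
Qed.

Theorem mainTheorem1 (R : realType) (L : bigset R) (U : fine_ultrafilter L) :
  exists (Gn : {fset L} -> {fset R}) (w : {fset L} -> R)
         (Vn : {fset L} -> set (R -> R))
         (VG : set (grid U Gn -> euclid R U)),
    (* grid *)
    [/\ forall l, is_max [set` Gn l] (w l) /\ is_min [set` Gn l] (- w l),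
        [set eucl U r | r in [set: R]] `<=` grid U Gn
      & is_max (grid U Gn) (lam_lim U w) /\
        is_min (grid U Gn) (- lam_lim U w)] /\
    (* approximating spaces *)
    [/\ forall l, findim_subspace (Vn l) /\ Vn l `<=` @epilogic R,
        forall l, @epilogic R `&` [set f | fun_in L f \in l] `<=` Vn l,
        forall l (f g : R -> R),
          (@locally_lipschitz R `&` [set h | fun_in L h \in l]) f ->
          (@locally_lipschitz R `&` [set h | fun_in L h \in l]) g ->
          Vn l (f \* g)
      & forall l, set_bij (Vn l) [set: Gn l -> R]
          (fun (f : R -> R) (x : Gn l) => f (val x))] /\
    (* Axiom 1 *)
    VG = V_grid Vn /\
    (* Axiom 2 *)
    (forall a : grid U Gn, VG (chi a)) /\
    (* Axiom 3 *)
    (forall a : grid U Gn, 0 < pw_integral w Vn (chi a)) /\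
    (* Axiom 4, together with D mapping VG to itself *)
    [/\ set_fun VG VG (gderiv w Vn),
        forall a : grid U Gn,
          [set val x | x in [set x | gderiv w Vn (chi a) x != 0]]
            `<=` monad (val a)
      & forall u, VG u ->
          (gderiv w Vn u = cst 0 <->
           exists c : euclid R U, u = c \*o one_grid U Gn)].
Proof.
have finj : injective (@fun_in R L) by move=> f g /bigset_in_inj[].
pose real_in r : L := bigset_in L (inl (inl r)).
have rinj : injective real_in by move=> r r' /bigset_in_inj[].
have [fs fsP] := choice (fun l => fset_preimage (fun=> 0) l finj).
have [rs rsP] := choice (fun l => fset_preimage 0 l rinj).
(* Each positive real belongs to almost every index, so this choice makes [eps] infinitesimal in the
   limit. *)
have [eps epsP] : exists eps : {fset L} -> R, forall l,
    0 < eps l /\ forall r, r \in rs l -> 0 < r -> eps l <= r.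
  have h l : exists e : R, 0 < e /\ forall r, r \in rs l -> 0 < r -> e <= r.
    by have [e] := positive_lower_bound (rs l); exists e.
  by have [f hf] := choice h; exists f.
(* All functions of the index and all their products, kept only if epilogic; products of locally
   Lipschitz functions always pass. *)
pose ws l := [seq f <- fs l ++ [seq f \* g | f <- fs l, g <- fs l] | `[< epilogic f >]].
have ws_epi l f : f \in ws l -> epilogic f by rewrite mem_filter => /andP[/asboolP].
have sys l := nodal_system (rs l) (@ws_epi l) (epsP l).1.
have [Gs Gs1] := choice sys.
have [w w1] := choice Gs1.
have [sg sgP] := choice w1.
have H1 l : uniq (Gs l) by case: (sgP l) => -[].
have H2 l : w l \in Gs l by case: (sgP l) => -[].
have H3 l : - w l \in Gs l by case: (sgP l) => -[].
have H4 l a : a \in Gs l -> - w l <= a <= w l by case: (sgP l) => -[_ _ _ + _] _ _ _ _; exact.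
have H5 l : {subset rs l <= Gs l} by case: (sgP l) => -[].
have H6 l a : a \in Gs l -> epilogic (sg l a) by case: (sgP l) => _ [+ _] _ _ _ => /[apply] -[].
have H7 l a b : a \in Gs l -> b \in Gs l -> sg l a b = (a == b)%:R.
  by case: (sgP l) => _ [+ _] _ _ _ => /[apply] -[_ + _]; exact.
have H8 l a : a \in Gs l -> 0 < itv_int (- w l) (w l) (sg l a).
  by case: (sgP l) => _ [+ _] _ _ _ => /[apply] -[].
have H9 l f : f \in ws l -> spann Gs sg l f.
  by move=> fw; exists f => x; case: (sgP l) => _ [_ +] _ _ _; exact.
have H10 l a x : a \in Gs l -> x \in Gs l -> eps l < `|a - x| ->
    bder (w l) (sg l a) (sg l x) = 0 by case: (sgP l) => _ _ [+ _] _ _; exact.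
have H11 l u c : (forall x, u x = \sum_(a <- Gs l) c a * sg l a x) -> forall x, x \in Gs l ->
    bder (w l) u (sg l x) = \sum_(a <- Gs l) c a * bder (w l) (sg l a) (sg l x).
  by case: (sgP l) => _ _ [_ +] _ _; exact.
have H12 l x : x \in Gs l -> \sum_(a <- Gs l) bder (w l) (sg l a) (sg l x) = 0.
  by case: (sgP l) => _ _ _ + _; exact.
have H13 l c : (forall x, x \in Gs l ->
    \sum_(a <- Gs l) c a * bder (w l) (sg l a) (sg l x) = 0) ->
  exists C, forall a, a \in Gs l -> c a = C.
  by case: (sgP l) => _ _ _ _; exact.
have near_real r : U [set l | r \in rs l].
  apply: filterS (fine_fine U [fset real_in r]%fset) => l /= /fsubsetP h.
  by apply: rsP; apply: h; rewrite inE.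
exists (gridn Gs), w, (spann Gs sg), (V_grid (spann Gs sg)).
split; [split|split; [split|split; [|split; [|split; [|split]]]]].
- by move=> l; exact: gridn_max.
- by apply: real_grid => // r; apply: filterS (near_real r) => l /= /H5.
- exact: grid_max.
- by move=> l; split; [exact: findim_spann|exact: spann_epilogic].
- move=> l f [ef fl]; apply: H9; rewrite mem_filter; apply/andP; split; first exact/asboolP.
  by rewrite mem_cat fsP.
- move=> l f g [lf fl] [lg gl]; apply: H9; rewrite mem_filter; apply/andP; split.
    exact/asboolP/epilogicM_lipschitz.
  rewrite mem_cat; apply/orP; right; apply/allpairsP; exists (f, g) => /=.
  by split => //; exact: fsP.
- by move=> l; exact: spann_bij.
- by [].
- by move=> a; exact: chi_V_grid.
- by move=> a; exact: vol_gt0.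
- exact: gderiv_fun.
- move=> a; apply: gderiv_local => // r r0.
  (* Halving turns the weak bound [r <= |b - x|] into the strict one required by the locality of the
     matrix. *)
  have r2 : 0 < r / 2 by rewrite divr_gt0.
  apply: filterS (near_real (r / 2)) => l /= rl b x bG xG rb.
  apply: H10 => //; have := (epsP l).2 _ rl r2; lra.
- by move=> u Vu; exact: gderiv_ker.
Qed.
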